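(* Let $n,m\ge1$. The identity $$\sum_\lambda\mathbb{F}^*_{\lambda}(\chi_1,\dots,\chi_m\mid\bar{\mathsf{S}},\mathsf{S})\,\mathbb{F}_{\lambda}(\kappa_1,\dots,\kappa_n\mid\mathsf{S},\mathsf{S})=\prod_{i=1}^n\prod_{j=1}^m\frac{(\kappa_i;q)_\infty(s_i^2\chi_j;q)_\infty}{(s_i^2;q)_\infty(\kappa_i\chi_j;q)_\infty},$$ where the sum is over all partitions $\lambda$, holds in the space of formal power series in $\kappa_1,\dots,\kappa_n,\chi_1,\dots,\chi_m,q$ with coefficients rational in $\mathsf{S}$. The same identity holds numerically for $0<|q|,|\kappa_1|,\dots,|\kappa_n|,|\chi_1|,\dots,|\chi_m|<1$.
   Context: Write $(x;q)_n:=\prod_{i=1}^n(1-xq^{i-1})$, $(x;q)_0:=1$, $(x;q)_\infty:=\prod_{i\ge1}(1-xq^{i-1})$. A partition is a weakly decreasing sequence $\lambda=(\lambda_1\ge\lambda_2\ge\dots\ge0)$ of nonnegative integers with finitely many nonzero entries; $\varnothing$ is the zero partition, $l(\lambda)$ is the number of nonzero parts and $\lambda'$ is the conjugate partition, so the number of parts of $\lambda'$ equal to $j$ is $m_j(\lambda')=\lambda_j-\lambda_{j+1}$. $\mathsf{S}=(s_0,s_1,\dots)$ is a sequence of parameters (indeterminates in the formal statement; generic complex numbers, so that all denominators are nonzero, in the numerical one), $\bar{\mathsf{S}}:=(s_0^{-1},s_1^{-1},\dots)$. General functions. For sequences $\Xi=(\xi_0,\xi_1,\dots)$ and $\mathsf{S}$,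 and $k\ge0$, put $s_i^{(k)}:=\sqrt{s_{i+k}\xi_{i+k}s_i/\xi_i}$ and $\tau^k_{\Xi}\mathsf{S}:=(s^{(k)}_0,s^{(k)}_1,\dots)$. Only two cases are needed, with square roots chosen so that: if $\Xi=\mathsf{S}$ then $s_i^{(k)}=s_{i+k}$; if $\Xi=\bar{\mathsf{S}}$ then $s_i^{(k)}=s_i$. Put $\mathsf{c}_{\mathsf{S}}(\lambda):=\prod_{i\ge1}\frac{(s_i^2;q)_{\lambda_i-\lambda_{i+1}}}{(q;q)_{\lambda_i-\lambda_{i+1}}}$, $(-\mathsf{S})^\lambda:=\prod_{i\ge1}(-s_{i-1})^{\lambda_i}$ (likewise for other sequences in place of $\mathsf S$). For $i,j,k,l\in\mathbb{Z}_{\ge0}$ (labels of the bottom, left, top, right edge) let $$W_{t,s}(i,j;k,l):=\mathbf{1}_{i+j=k+l}\,\mathbf{1}_{i\ge l}\,(s^2/t^2)^{l}\frac{(s^2/t^2;q)_{i-l}(t^2;q)_l}{(s^2;q)_i}\frac{(q;q)_i}{(q;q)_{i-l}(q;q)_l}.$$ For $a_1,\dots,a_n\in\mathbb{Z}_{\ge0}$ and $L>l(\lambda),l(\mu)$, $$ZW^{(a_1,\dots,a_n)}_{\lambda/\mu}(\kappa_1,\dots,\kappa_n\mid\Xi,\mathsf{S}):=\sum\prod_{r=1}^n\prod_{c=1}^L W_{t_{r,c},\,s^{(r)}_c}(v_{r,c},h_{r,c-1};v_{r-1,c},h_{r,c}),\qquad t_{r,c}^2=\frac{\xi_{r+c}s_{r+c}}{\kappa_r},$$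 the sum being over all nonnegative integers $v_{r,c}$ ($0\le r\le n$, $1\le c\le L$) and $h_{r,c}$ ($1\le r\le n$, $0\le c\le L$) with $v_{0,c}=m_c(\lambda')$, $v_{n,c}=m_c(\mu')$, $h_{r,0}=a_r$, $h_{r,L}=0$ (independent of $L$). Then $$\mathbb{F}_{\lambda/\mu}(\kappa_1,\dots,\kappa_n\mid\Xi,\mathsf{S}):=\frac{(-\tau^n_\Xi\mathsf{S})^{\mu}}{(-\mathsf{S})^{\lambda}}\frac{\mathsf{c}_{\tau^n_\Xi\mathsf{S}}(\mu)}{\mathsf{c}_{\mathsf{S}}(\lambda)}\sum_{a_1+\dots+a_n=\lambda_1-\mu_1}\Bigl(\prod_{i=1}^n(\kappa_is_0/\xi_0)^{a_i}\frac{(\kappa_i^{-1}s_i\xi_i;q)_{a_i}}{(q;q)_{a_i}}\Bigr)ZW^{(a_1,\dots,a_n)}_{\lambda/\mu}(\kappa_1,\dots,\kappa_n\mid\Xi,\mathsf{S}),$$ $$\mathbb{F}^*_{\lambda/\mu}(\kappa_1,\dots,\kappa_n\mid\Xi,\mathsf{S}):=\frac{\mathsf{c}_{\mathsf{S}}(\lambda)}{\mathsf{c}_{\tau^n_\Xi\mathsf{S}}(\mu)}\,\mathbb{F}_{\lambda/\mu}(\kappa_1,\dots,\kappa_n\mid\Xi,\mathsf{S}),$$ and $\mathbb{F}_\lambda:=\mathbb{F}_{\lambda/\varnothing}$, $\mathbb{F}^*_\lambda:=\mathbb{F}^*_{\lambda/\varnothing}$. These are polynomials in the variables $\kappa_1,\dots,\kappa_n$,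 and in the formal statement are regarded as formal power series in the variables and $q$ with coefficients rational in $\mathsf{S}$. *)

(* Defs.v *)
From HB Require Import structures.
From mathcomp Require Import all_boot all_order all_algebra.
From mathcomp Require Import fraction.
From mathcomp Require monalg mpoly.
Import (canonicals, coercions) mpoly.
From mathcomp Require Import zify.
From mathcomp Require Import boolp classical_sets.

Set Implicit Arguments.
Unset Strict Implicit.
Unset Printing Implicit Defensive.
Import Order.TTheory GRing.Theory Num.Theory.
Local Open Scope ring_scope.

Section PowerSeries.
Import mpoly.
Variables (N : nat) (K : fieldType).

(* Formal power series K[[X_0, ..., X_(N-1)]], given by their coefficients. *)
Record fps := FPS { fps_coef : 'X_{1..N} -> K }.

HB.instance Definition _ := gen_eqMixin fps.
HB.instance Definition _ := gen_choiceMixin fps.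

Implicit Types f g h : fps.

Lemma fpsP f g : (forall m, fps_coef f m = fps_coef g m) -> f = g.
Proof. by case: f g => [f] [g] /= /funext ->. Qed.

Definition fps_add f g := FPS (fun m => fps_coef f m + fps_coef g m).
Definition fps_opp f := FPS (fun m => - fps_coef f m).
Definition fps_const (c : K) := FPS (fun m => if m == 0%MM then c else 0).
Definition fps_mul f g := FPS (fun m =>
  \sum_(k : 'X_{1..N < (mdeg m).+1} | (k <= m)%MM)
    fps_coef f k * fps_coef g (m - k)%MM).

Let addA : associative fps_add.
Proof. by move=> f g h; apply/fpsP => m /=; rewrite addrA. Qed.
Let addC : commutative fps_add.
Proof. by move=> f g; apply/fpsP => m /=; rewrite addrC. Qed.
Let add0 : left_id (fps_const 0) fps_add.
Proof. by move=> f; apply/fpsP => m /=; rewrite if_same add0r. Qed.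
Let addN : left_inverse (fps_const 0) fps_opp fps_add.
Proof. by move=> f; apply/fpsP => m /=; rewrite if_same addNr. Qed.

HB.instance Definition _ := GRing.isZmodule.Build fps addA addC add0 addN.

(* Multiplication is compared with that of multivariate polynomials through
   truncation in degree < d. *)
Let trunc d f : {mpoly K[N]} :=
  \sum_(m : 'X_{1..N < d}) fps_coef f m *: 'X_[m].

Let truncE d f m : (mdeg m < d)%N -> (trunc d f)@_m = fps_coef f m.
Proof. exact: mcoeff_mpoly. Qed.

Let truncM d (p q : {mpoly K[N]}) f g m : (mdeg m < d)%N ->
    (forall k, (mdeg k < d)%N -> p@_k = fps_coef f k) ->
    (forall k, (mdeg k < d)%N -> q@_k = fps_coef g k) ->
  (p * q)@_m = fps_coef (fps_mul f g) m.
Proof.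
move=> md pf qg; rewrite [LHS](@mcoeff_poly_mul_lin _ _ _ _ _ (mdeg m).+1) //=.
apply: eq_bigr => k km; rewrite pf ?qg //.
  exact: leq_ltn_trans (mdegB _ _) md.
exact: leq_trans (bmdeg k) md.
Qed.

Let mulA : associative fps_mul.
Proof.
move=> f g h; apply/fpsP => m; pose d := (mdeg m).+1.
rewrite -(@truncM d (trunc d f) (trunc d g * trunc d h)) //; first last.
- by move=> k kd; apply: truncM kd _ _; apply: truncE.
- exact: truncE.
rewrite mulrA; apply: (@truncM d) => // [k kd|]; last exact: truncE.
by apply: truncM kd _ _; apply: truncE.
Qed.

Let mulC : commutative fps_mul.
Proof.
move=> f g; apply/fpsP => m; pose d := (mdeg m).+1.
rewrite -(@truncM d (trunc d f) (trunc d g)) //; try exact: truncE.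
by rewrite mulrC; apply: (@truncM d); first by []; apply: truncE.
Qed.

Let mul1 : left_id (fps_const 1) fps_mul.
Proof.
move=> f; apply/fpsP => m; pose d := (mdeg m).+1.
rewrite -(@truncM d 1 (trunc d f)) //; try exact: truncE.
  by rewrite mul1r truncE.
by move=> k _; rewrite mcoeff1 /=; case: eqP.
Qed.

Let mulDl : left_distributive fps_mul fps_add.
Proof.
move=> f g h; apply/fpsP => m /=; rewrite -big_split /=.
by apply: eq_bigr => k _; rewrite mulrDl.
Qed.

Let one_neq0 : fps_const 1 != fps_const 0.
Proof.
apply/eqP => /(congr1 (fun f => fps_coef f 0%MM)) /=.
by rewrite eqxx => /eqP; rewrite oner_eq0.
Qed.

HB.instance Definition _ := GRing.Zmodule_isComNzRing.Build fps
  mulA mulC mul1 mulDl one_neq0.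

Let fps_coefM0 f g : fps_coef (f * g) 0%MM = fps_coef f 0%MM * fps_coef g 0%MM.
Proof.
rewrite -(@truncM 1 (trunc 1 f) (trunc 1 g)) ?mdeg0 //; try exact: truncE.
by rewrite rmorphM /= !truncE ?mdeg0.
Qed.

Lemma fps_integral f g : f * g = 0 -> (f == 0) || (g == 0).
Proof.
have low h : h != 0 -> exists m, fps_coef h m != 0 /\
    forall k, (k < m)%O -> fps_coef h k = 0.
  move=> h0; apply/not_existsP => none; case/eqP: h0; apply/fpsP => m /=.
  rewrite if_same; elim/(@ltmwf N): m => m IH; apply/eqP/negP => /negP hm.
  exact: none m (conj hm IH).
move=> fg0; rewrite -[_ || _]negbK negb_or; apply/negP.
case/andP => /low[mf [f_nz f_low]] /low[mg [g_nz g_low]].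
have : fps_coef (f * g) (mf + mg)%MM = fps_coef f mf * fps_coef g mg.
  have lt : (mdeg mf < (mdeg (mf + mg)).+1)%N by rewrite mdegD ltnS leq_addr.
  have sub : (mf + mg - mf)%MM = mg by rewrite addmC addmK.
  rewrite /= (bigD1 (BMultinom lt)) /= ?lem_addr // sub.
  rewrite big1 ?addr0 // => k /andP[km]; rewrite bmeqP /= => ne.
  have [lk|] := boolP (k < mf :> 'X_{1..N})%O; first by rewrite f_low ?mul0r.
  rewrite -leNgt le_eqVlt eq_sym (negPf ne) /= => gk.
  rewrite g_low ?mulr0 //; rewrite -(ltmc_add2r k) [(k + _)%MM]addmC submK //.
  by rewrite ltmc_add2l.
rewrite fg0 /= if_same => /esym/eqP; rewrite mulf_eq0.
by rewrite (negPf f_nz) (negPf g_nz).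
Qed.

Definition fps_unit : {pred fps} := fun f => fps_coef f 0%MM != 0.

Let coefB f g m : fps_coef (f - g) m = fps_coef f m - fps_coef g m.
Proof. by []. Qed.

Let pow_low f d m : fps_coef f 0%MM = 0 -> (mdeg m < d)%N ->
  fps_coef (f ^+ d) m = 0.
Proof.
move=> f0; elim: d m => // d IH m md; rewrite exprS /=.
apply: big1 => k km; have [->|k0] := eqVneq (k : 'X_{1..N}) 0%MM.
  by rewrite f0 mul0r.
rewrite IH ?mulr0 //; have : mdeg k != 0%N by rewrite mdeg_eq0.
have := congr1 (@mdeg N) (submK km); rewrite mdegD; move: md; lia.
Qed.

Let fps_inv_ex f : f \in fps_unit -> exists g, g * f = 1.
Proof.
move=> f0; pose c := (fps_coef f 0%MM)^-1; pose g := 1 - fps_const c * f.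
have g0 : fps_coef g 0%MM = 0.
  by rewrite /g coefB fps_coefM0 /= !eqxx mulVf // subrr.
have sumE d m : fps_coef (\sum_(i < d) g ^+ i) m = \sum_(i < d) fps_coef (g ^+ i) m.
  by apply: (big_morph (fun f => fps_coef f m)) => //=; rewrite if_same.
pose h := FPS (fun m => fps_coef (\sum_(i < (mdeg m).+1) g ^+ i) m).
exists (h * fps_const c); rewrite -mulrA.
have -> : fps_const c * f = 1 - g by rewrite opprB addrC subrK.
apply/fpsP => m; pose d := (mdeg m).+1.
have -> : fps_coef (h * (1 - g)) m = fps_coef ((\sum_(i < d) g ^+ i) * (1 - g)) m.
  apply: eq_bigr => k _; congr (_ * _); rewrite /h /= !sumE.
  rewrite -[d](subnKC (bmdeg k : _ <= d)%N) big_split_ord /=.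
  by rewrite [X in _ + X]big1 ?addr0 // => i _; rewrite pow_low //= ltnS leq_addr.
have -> : (\sum_(i < d) g ^+ i) * (1 - g) = 1 - g ^+ d 
  by rewrite mulrC -opprB mulNr -subrX1 opprB.
by rewrite coefB pow_low ?subr0.
Qed.

Let fps_inv f : fps :=
  if f \in fps_unit then xget f [set g | g * f = 1]%classic else f.

Let fps_mulVf : {in fps_unit, left_inverse 1 fps_inv *%R}.
Proof.
move=> f uf; rewrite /fps_inv uf; have [g gf] := fps_inv_ex uf.
by apply: (@xgetPex _ f [set g | g * f = 1]%classic); exists g.
Qed.

Let fps_unitP f g : g * f = 1 -> fps_unit f.
Proof.
move/(congr1 (fun f => fps_coef f 0%MM)); rewrite fps_coefM0 /= eqxx => gf.
by apply/eqP => f0; move/eqP: gf; rewrite f0 mulr0 eq_sym oner_eq0.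
Qed.

Let fps_inv_out : {in [predC fps_unit], fps_inv =1 id}.
Proof. by move=> f /negbTE; rewrite /fps_inv => ->. Qed.

HB.instance Definition _ := GRing.ComNzRing_hasMulInverse.Build fps
  fps_mulVf fps_unitP fps_inv_out.
HB.instance Definition _ := GRing.ComUnitRing_isIntegral.Build fps
  fps_integral.

Lemma fps_unitE f : (f \is a GRing.unit) = (fps_coef f 0%MM != 0).
Proof. by []. Qed.

Definition fpsX (i : 'I_N) : fps := FPS (fun m => (m == U_(i)%MM)%:R).
End PowerSeries.

Section InfinitePolynomials.
Import finmap monalg.
Local Open Scope monom_scope.
Local Open Scope fset_scope.
Local Notation "'U_(' i )" := (ucm i) : monom_scope.
Variable R : idomainType.
(* R[s_0, s_1, ...]: polynomials in countably many variables. Integrality is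
   obtained by mapping to R[s_0, ..., s_(d-1)] for large d. *)
Definition infpoly := malg (cmonom nat) R.
HB.instance Definition _ := GRing.ComNzRing.on infpoly.
Implicit Types f g : infpoly.

Let trunc_mon d (m : cmonom nat) : mpoly.multinom d :=
  mpoly.Multinom [tuple m i | i < d].

Let to_mpoly d f : mpoly.mpoly d R :=
  @mmap _ _ (mpoly.mpoly d R : comNzRingType) (@mpoly.mpolyC d R)
    (fun m => mpoly.mpolyX R (trunc_mon d m)) f.

Let trunc_monE d m i : trunc_mon d m i = m i.
Proof. by rewrite mpoly.multinomE tnth_mktuple. Qed.

Let to_mpolyM d f g : to_mpoly d (f * g) = to_mpoly d f * to_mpoly d g.
Proof.
have hm : mmorphism (fun m => mpoly.mpolyX R (trunc_mon d m)).
  split=> [x y|].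
    rewrite -mpoly.mpolyXD; congr mpoly.mpolyX; apply/mpoly.mnmP => i.
    by rewrite mpoly.mnmDE !trunc_monE cmM.
  rewrite -[RHS]mpoly.mpolyX0; congr mpoly.mpolyX; apply/mpoly.mnmP => i.
  by rewrite mpoly.mnm0E trunc_monE cm1.
pose h := MMorphism.Pack (MMorphism.Class (isMultiplicative.Build _ _ _ hm)).
exact: (@mmap_is_multiplicative _ _ (mpoly.mpoly d R : comNzRingType)
          (@mpoly.mpolyC d R) h).1.
Qed.

Let to_mpoly_neq0 d f :
    (forall m, m \in msupp f -> forall i, (d <= i)%N -> m i = 0%N) ->
  f != 0 -> to_mpoly d f != 0.
Proof.
rewrite -msupp_eq0 => supp /fset0Pn[m fm]; apply: contraTneq fm => f0.
rewrite -mcoeff_neq0 negbK -[mcoeff m f]/(id _).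
have := congr1 (mpoly.mcoeff (trunc_mon d m)) f0.
rewrite mpoly.mcoeff0 /to_mpoly /mmap raddf_sum /= => Hs.
have [fm|fm] := boolP (m \in msupp f); last by rewrite mcoeff_eq0.
move: Hs; rewrite (big_fsetD1 m) //= mpoly.mcoeffCM mpoly.mcoeffX eqxx mulr1.
rewrite big_seq big1 ?addr0 => [->//|m' /fsetD1P[ne m'f]].
rewrite mpoly.mcoeffCM mpoly.mcoeffX; case: eqP => [eq|]; last by rewrite mulr0.
case/eqP: ne; apply/eqP/cmP => i; have [lt|ge] := ltnP i d.
  by move/mpoly.mnmP/(_ (Ordinal lt)): eq; rewrite !trunc_monE.
by rewrite !supp.
Qed.

Let supp_bound f : exists d, forall d', (d <= d')%N ->
  forall m, m \in msupp f -> forall i, (d' <= i)%N -> m i = 0%N.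
Proof.
exists (\max_(m <- msupp f) \max_(i <- finsupp m) i.+1) => d' le m mf i le'.
apply/eqP; rewrite cmE_eq0; apply/negP => im.
have := leq_trans le le'; apply/negP; rewrite -ltnNge.
apply: leq_trans (leq_bigmax_seq _ mf _) => //.
exact: (@leq_bigmax_seq _ _ xpredT (fun i => i.+1) i).
Qed.

Lemma infpoly_integral f g : f * g = 0 -> (f == 0) || (g == 0).
Proof.
have [df Hf] := supp_bound f; have [dg Hg] := supp_bound g => fg0.
rewrite -[_ || _]negbK negb_or; apply/negP => /andP[f0 g0].
have := mulf_neq0 (to_mpoly_neq0 (Hf _ (leq_maxl df dg)) f0)
                  (to_mpoly_neq0 (Hg _ (leq_maxr df dg)) g0).
by rewrite -to_mpolyM fg0 /to_mpoly mmap0 eqxx.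
Qed.

Let infpoly_unit : {pred infpoly} := fun f => `[< exists g, g * f = 1 >].
Let infpoly_inv f : infpoly :=
  if f \in infpoly_unit then xget f [set g | g * f = 1]%classic else f.

Let infpoly_mulVf : {in infpoly_unit, left_inverse 1 infpoly_inv *%R}.
Proof.
move=> f uf; rewrite /infpoly_inv uf.
move/asboolP: uf => [g gf].
by apply: (@xgetPex _ f [set g | g * f = 1]%classic); exists g.
Qed.

Let infpoly_unitP f g : g * f = 1 -> infpoly_unit f.
Proof. by move=> gf; apply/asboolP; exists g. Qed.

Let infpoly_inv_out : {in [predC infpoly_unit], infpoly_inv =1 id}.
Proof. by move=> f /negbTE; rewrite /infpoly_inv => ->. Qed.

HB.instance Definition _ := GRing.ComNzRing_hasMulInverse.Build infpoly
  infpoly_mulVf infpoly_unitP infpoly_inv_out.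
HB.instance Definition _ := GRing.ComUnitRing_isIntegral.Build infpoly
  infpoly_integral.

Definition infpolyX (i : nat) : infpoly := << U_(i)%M >>.
End InfinitePolynomials.

(* The field Q(s_0, s_1, ...) and its generators. *)
Definition ratfunS : fieldType := {fraction infpoly rat}.
Definition indetS (i : nat) : ratfunS := FracField.tofrac (infpolyX rat i).
From mathcomp Require Import all_classical all_reals all_analysis.
From mathcomp Require Import complex.
From mathcomp.analysis.showcase Require Import summability.
Import numFieldNormedType.Exports.

Local Open Scope classical_set_scope.

(* A partition is stored as the list of its nonzero parts, so that its length
   l(la) is [size la]. *)
Record intpart := IntPart {
  parts :> seq nat;
  _ : sorted geq parts && (0%N \notin parts)
}.

HB.instance Definition _ := [isSub for parts].
HB.instance Definition _ := [Countable of intpart by <:].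

Definition empty_intpart : intpart := @IntPart [::] isT.

(* 1-based: [part la i] is la_i for i >= 1; [part la 0] is meaningless. *)
Definition part (la : intpart) (i : nat) : nat := nth 0%N la i.-1.

(* la'_(j+1) = #{i | la_i > j} for 0 <= j < la_1 *)
Definition conj_parts (la : intpart) : seq nat :=
  mkseq (fun j => count (fun p => j < p)%N la) (part la 1).

Definition multiplicity (j : nat) (s : seq nat) : nat := count_mem j s.

Lemma part_leq (la : intpart) i j : (i <= j)%N -> (part la j <= part la i)%N.
Proof.
have ss : sorted geq la by case: la => s /= /andP[].
move=> ij; rewrite /part.
have [js|js] := ltnP j.-1 (size la); last by rewrite nth_default.
have ij1 : (i.-1 <= j.-1)%N by lia.
have geqT : transitive geq by move=> x y z xy yz; apply: leq_trans yz xy.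
apply: (@sorted_leq_nth _ geq geqT leqnn 0%N la ss i.-1 j.-1 _ js ij1).
exact: leq_ltn_trans js.
Qed.

Lemma ltn_count_sorted (s : seq nat) i k : sorted geq s ->
  (k < count (fun p => i < p) s)%N = (i < nth 0 s k)%N.
Proof.
have geqT : transitive geq by move=> x y z xy yz; apply: leq_trans yz xy.
elim: s k => [|x s IH] k /=; first by rewrite nth_nil.
rewrite path_sortedE // => /andP[/allP xs ss]; case: (ltnP i x) => ix.
  by case: k => [|k] /=; rewrite ?ix // add1n ltnS IH.
have -> : count (fun p => i < p)%N s = 0%N.
  apply/eqP; rewrite -leqn0 leqNgt -has_count; apply/hasPn => p /xs /= px.
  by rewrite -leqNgt (leq_trans px).
case: k => [|k] /=; first by apply/esym/negbTE; rewrite -leqNgt.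
apply/esym/negbTE; rewrite -leqNgt.
have [ks|ks] := ltnP k (size s); last by rewrite nth_default.
by apply: leq_trans ix; apply: xs; apply: mem_nth.
Qed.

Lemma multiplicity_conj (la : intpart) j : (0 < j)%N ->
  multiplicity j (conj_parts la) = (part la j - part la j.+1)%N.
Proof.
case: j => // j _; rewrite /multiplicity /conj_parts count_map.
set b := part la j.+2; set a := part la j.+1; set M := part la 1.
have ba : (b <= a)%N by apply: part_leq.
have aM : (a <= M)%N by apply: part_leq.
rewrite (@eq_count _ _ (fun i => (b <= i < a)%N)); last first.
  move=> i /=; rewrite eqn_leq leqNgt.
  have ss : sorted geq la by case: {b a M ba aM} la => s /= /andP[].
  by rewrite !ltn_count_sorted // -leqNgt.
have -> : M = (b + ((a - b) + (M - a)))%N by lia.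
rewrite !iotaD !count_cat /=.
rewrite [X in (X + _)%N](@eq_in_count _ _ pred0); last first.
  by move=> i; rewrite mem_iota /=; lia.
rewrite [X in (_ + (X + _))%N](@eq_in_count _ _ predT); last first.
  by move=> i; rewrite mem_iota /=; lia.
rewrite [X in (_ + (_ + X))%N](@eq_in_count _ _ pred0); last first.
  by move=> i; rewrite mem_iota /=; lia.
by rewrite !count_pred0 count_predT size_iota; lia.
Qed.

Section QPochhammer.
Variable A : comUnitRingType.

Definition qpoch (q x : A) (n : nat) : A := \prod_(i < n) (1 - x * q ^+ i).

(* [pinf] stands for x |-> (x; q)_oo. The ordinal i denotes kappa_(i+1), whose
   factors involve s_(i+1) = S i.+1. *)
Definition cauchy_product n m (pinf : A -> A) (kappa : 'I_n -> A)
    (chi : 'I_m -> A) (S : nat -> A) : A :=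
  \prod_(i < n) \prod_(j < m)
    ((pinf (kappa i) * pinf (S i.+1 ^+ 2 * chi j)) /
     (pinf (S i.+1 ^+ 2) * pinf (kappa i * chi j))).
End QPochhammer.

Section Functions.
Variables (E : fieldType) (q : E).

(* W_{t,s}(i,j;k,l), where i, j, k, l label the bottom, left, top and right
   edges. It depends on t only through t2 = t ^ 2. *)
Definition vertex_weight (t2 s : E) (i j k l : nat) : E :=
  if (i + j == k + l)%N && (l <= i)%N then
    (s ^+ 2 / t2) ^+ l *
    (qpoch q (s ^+ 2 / t2) (i - l) * qpoch q t2 l / qpoch q (s ^+ 2) i) *
    (qpoch q q i / (qpoch q q (i - l) * qpoch q q l))
  else 0.

(* c_S(la); the factors with i > l(la) are equal to 1, here and in [negS]. *)
Definition cS (S : nat -> E) (la : intpart) : E :=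
  \prod_(1 <= i < (size la).+1)
    (qpoch q (S i ^+ 2) (part la i - part la i.+1) /
     qpoch q q (part la i - part la i.+1)).

(* (- S)^la *)
Definition negS (S : nat -> E) (la : intpart) : E :=
  \prod_(1 <= i < (size la).+1) (- S i.-1) ^+ part la i.

(* [tau k i] is a choice of the square roots s_i^(k) defining tau^k_Xi S. *)
Definition is_tau (Xi S : nat -> E) (tau : nat -> nat -> E) : Prop :=
  forall k i, tau k i ^+ 2 = S (i + k)%N * Xi (i + k)%N * S i / Xi i.

(* The choices made when Xi = S, resp. when Xi = (s_0^-1, s_1^-1, ...). *)
Definition tau_diag (S : nat -> E) : nat -> nat -> E := fun k i => S (i + k)%N.
Definition tau_inv (S : nat -> E) : nat -> nat -> E := fun k i => S i.

Lemma tau_diagP S : (forall i, S i != 0) -> is_tau S S (tau_diag S).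
Proof. by move=> S0 k i; rewrite /tau_diag mulfK // expr2. Qed.

Lemma tau_invP S : (forall i, S i != 0) ->
  is_tau (fun i => (S i)^-1) S (tau_inv S).
Proof. by move=> S0 k i; rewrite /tau_inv divff // mul1r invrK expr2. Qed.

Section General.
Variables (n : nat) (kappa : 'I_n -> E) (Xi S : nat -> E).
Variables (tau : nat -> nat -> E).
Variables (la mu : intpart).

(* An array of labels consists of v_{r,c} (0 <= r <= n, 1 <= c <= L), stored in
   column c - 1 of v, and h_{r,c} (1 <= r <= n, 0 <= c <= L), stored in row
   r - 1 of h. *)
Definition boundary L (a : 'I_n -> nat) (v : 'M[nat]_(n.+1, L))
    (h : 'M[nat]_(n, L.+1)) : Prop :=
  [/\ forall c, v ord0 c = multiplicity c.+1 (conj_parts la),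
      forall c, v ord_max c = multiplicity c.+1 (conj_parts mu),
      forall r, h r ord0 = a r
    & forall r, h r ord_max = 0%N].

Definition row_weight L (v : 'M[nat]_(n.+1, L)) (h : 'M[nat]_(n, L.+1))
    (r : 'I_n) (c : 'I_L) : E :=
  vertex_weight (Xi (r.+1 + c.+1)%N * S (r.+1 + c.+1)%N / kappa r) (tau r.+1 c.+1)
    (v (lift ord0 r) c) (h r (widen_ord (leqnSn L) c))
    (v (widen_ord (leqnSn n) r) c) (h r (lift ord0 c)).

(* The index set is infinite, but only finitely many terms are nonzero: since
   v_{r,c} + h_{r,c-1} = v_{r-1,c} + h_{r,c} and h_{r,c} <= v_{r,c}, all the
   labels contributing are bounded by la_1 whenever L > l(la). *)
Definition ZW (L : nat) (a : 'I_n -> nat) : E :=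
  \sum_(vh \in [set vh : 'M[nat]_(n.+1, L) * 'M[nat]_(n, L.+1) |
                 boundary a vh.1 vh.2])
    \prod_(r < n) \prod_(c < L) row_weight vh.1 vh.2 r c.

(* F_{la/mu}(kappa | Xi, S). The least admissible L is used; ZW does not depend
   on L > l(la), l(mu). The bound a_i <= la_1 follows from the sum condition. *)
Definition bbF : E :=
  negS (tau n) mu / negS S la * (cS (tau n) mu / cS S la) *
  \sum_(a : {ffun 'I_n -> 'I_(part la 1).+1} |
        (\sum_i a i + part mu 1 == part la 1)%N)
    (\prod_(i < n)
       ((kappa i * S 0%N / Xi 0%N) ^+ a i *
        (qpoch q ((kappa i)^-1 * S i.+1 * Xi i.+1) (a i) / qpoch q q (a i)))) *
    ZW (maxn (size la) (size mu)).+1 (fun i => a i : nat).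

Definition bbFstar : E := cS S la / cS (tau n) mu * bbF.
End General.

Definition bbF_diag n (kappa : 'I_n -> E) (S : nat -> E) (la : intpart) : E :=
  bbF kappa S S (tau_diag S) la empty_intpart.

Definition bbFstar_inv m (chi : 'I_m -> E) (S : nat -> E) (la : intpart) : E :=
  bbFstar chi (fun i => (S i)^-1) S (tau_inv S) la empty_intpart.

End Functions.

Section PowerSeriesLimits.
Variables (N : nat) (K : fieldType).

(* Coefficientwise limit for the discrete topology on K. *)
Definition fps_lim (u : nat -> fps N K) : fps N K :=
  FPS (fun m => xget 0 [set c | \forall k \near \oo, fps_coef (u k) m = c]).

(* Unordered summation: every coefficient of the sum over a finite subset of I
   is equal to that of g as soon as the subset is large enough. *)
Definition fps_sums_to (I : choiceType) (f : I -> fps N K) (g : fps N K) :=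
  forall m, \forall B \near totally,
    fps_coef (partial_sum f B) m = fps_coef g m.
End PowerSeriesLimits.

Section FormalSetting.
Variables n m : nat.

(* Q(s_0, s_1, ...)[[kappa_1, ..., kappa_n, chi_1, ..., chi_m, q]] *)
Definition formal_ring := fps (n + m + 1) ratfunS.
HB.instance Definition _ := GRing.IntegralDomain.on formal_ring.

Definition var_kappa (i : 'I_n) : formal_ring := fpsX _ (lshift 1 (lshift m i)).
Definition var_chi (j : 'I_m) : formal_ring := fpsX _ (lshift 1 (rshift n j)).
Definition var_q : formal_ring := fpsX _ (rshift (n + m) ord0).
Definition par_s (i : nat) : formal_ring := fps_const _ (indetS i).
End FormalSetting.

Definition complex_field (R : realType) : numClosedFieldType := complex R.

Definition qpoch_inf (C : numFieldType) (q x : C) : C :=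
  lim (qpoch q x k @[k --> \oo]).

(* Main.v *)
(* Removing the gauge factor (-S)^la turns F and F* into sums over chains of interlacing
   partitions, weighted by explicit q-Pochhammer branching coefficients f and g.  Let
   E(u) be the transfer matrix of a row of spin-1/2 vertices.

   Pieri relation: f is an eigenfunction of E(u),
     sum_h E(u)_(mu+h/mu) F_(mu+h)(kappa) = F_mu(kappa) prod_i (1 - kappa_i u).
   It follows variable by variable from an exchange relation between E(u) and f, which is
   proved column by column.

   Fusion: replacing chi by q chi in g amounts to composing with E(chi),
     g_(la/mu)(q chi) prod_(i <= n) (1 - s_i^2 chi) = sum_h E(chi)_(la/la-h) g_(la-h/mu)(chi).

   Hence the left-hand side Z, as a function of one of the chi's, satisfies
     Z(q chi) prod_i (1 - s_i^2 chi) = Z(chi) prod_i (1 - kappa_i chi).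
   Iterating from chi and from 1, where this variable drops out of F*, both times towards
   Z(0), expresses Z(chi) through the sum with one variable fewer.  The limits are taken in
   a complete normed ring, which is either the complex numbers or the formal power series
   with the norm 2^(-order). *)
Require Import Defs.
From mathcomp Require Import all_boot all_order all_algebra.
From mathcomp Require Import fraction.
From mathcomp Require monalg mpoly.
Import (canonicals, coercions) mpoly.
From mathcomp Require Import boolp classical_sets.
From mathcomp Require Import ring lra zify.
Set Implicit Arguments.
Unset Strict Implicit.
Unset Printing Implicit Defensive.
Import Order.TTheory GRing.Theory Num.Theory.
Local Open Scope ring_scope.

(** * Branching weights *)

(** Z(0) has no closed form to start from; it only links the two iterations and is then eliminated.
    The point 1 is special because a step of g carries the product (x - 1)(x - q)..., which vanishes
    at x = 1 unless the step is trivial. As 1 is not inside the unit disc, convergence there has to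
    come from the decay of f, and g is merely bounded.

    Sums over partitions run over boxes of arbitrary sequences: the weights vanish off interlacing
    pairs, so the sums carry no order condition and factor over columns. The price is that adding a
    vertical strip may leave the box. The functional equation therefore holds for a box only up to a
    boundary term, which must be shown to tend to 0.

    The rational identities are checked over a field and descend to power series through the
    fraction field. The infinite products are kept in multiplied form and divided out only at the
    end. *)

Fixpoint box (M n : nat) : seq (seq nat) :=
  if n is n'.+1 then [seq x :: s | x <- iota 0 M, s <- box M n'] else [:: [::]].

Lemma big_box_cons (V : nmodType) M n (phi : seq nat -> V) :
  \sum_(s <- box M n.+1) phi s =
  \sum_(x < M) \sum_(s <- box M n) phi (nat_of_ord x :: s).
Proof.
rewrite /= big_allpairs_dep -(big_mkord xpredT (fun x => \sum_(s <- box M n) phi (x :: s))).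
by rewrite /index_iota subn0.
Qed.

Lemma mem_box M n s : (s \in box M n) = (size s == n) && all (fun x => x < M)%N s.
Proof.
elim: n s => [|n IH] [|x s] //=.
  by apply/allpairsP => -[[? ?]] [].
rewrite eqSS andbCA -IH; apply/allpairsP/andP => [[[y t] /= [+ yt [-> ->]]]|[xM sB]].
  by rewrite mem_iota add0n.
by exists (x, s); rewrite /= mem_iota add0n.
Qed.

Lemma box_uniq M n : uniq (box M n).
Proof.
elim: n => //= n IH; apply: allpairs_uniq => //; first exact: iota_uniq.
by move=> [x s] [y t] _ _ [-> ->].
Qed.

Lemma big_box0 (V : nmodType) M (phi : seq nat -> V) :
  \sum_(s <- box M 0) phi s = phi [::].
Proof. by rewrite /= big_seq1. Qed.

Arguments box : simpl never.

Fixpoint seqD (s t : seq nat) : seq nat :=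
  match s, t with
  | x :: s', y :: t' => (x + y)%N :: seqD s' t'
  | _, _ => [::]
  end.

Fixpoint seqB (s t : seq nat) : seq nat :=
  match s, t with
  | x :: s', y :: t' => (x - y)%N :: seqB s' t'
  | _, _ => [::]
  end.

Definition shift_seq (T : Type) (A : nat -> T) : nat -> T := fun c => A c.+1.

Section Weights.
Variables (R : comUnitRingType) (q : R).
Implicit Types (x u b : R) (A : nat -> R) (la mu nu h : seq nat).

(* [hpoch x b k] is x^k (b/x; q)_k, also for x = 0. *)
Definition hpoch x b (k : nat) : R := \prod_(i < k) (x - b * q ^+ i).

(* With A c = s_(c+1)^2, [fstep x A] and [gstep x A] are the one-variable functions
   F_(la/nu)(x | S, S) and F*_(la/mu)(x | S-bar, S) without the factors (-S)^la, and
   [fcol], [gcol] are their column factors, with arguments la_c, la_(c+1), nu_c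
   (and nu_(c+1)). *)
Definition fcol x b (l0 l1 n0 : nat) : R :=
  if (l1 <= n0 <= l0)%N then
    qpoch q q (l0 - l1) / qpoch q b (l0 - l1) *
    (hpoch x b (l0 - n0) / qpoch q q (l0 - n0)) *
    (qpoch q x (n0 - l1) / qpoch q q (n0 - l1))
  else 0.

Definition gcol x b (l0 l1 m0 m1 : nat) : R :=
  if (l1 <= m0 <= l0)%N then
    hpoch x 1 (l0 - m0) / qpoch q q (l0 - m0) *
    (qpoch q (b * x) (m0 - l1) / qpoch q q (m0 - l1)) *
    (qpoch q q (m0 - m1) / qpoch q b (m0 - m1))
  else 0.

(* Vertices of spin 1/2: every positive label counts as 1.  [estep u A mu h] is the
   weight of a row that turns mu into the vertical-strip extension mu + h. *)
Definition ecol u b (h0 h1 d : nat) : R :=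
  match h0, h1 with
  | 0, 0 => 1 - b * u * q ^+ d
  | 0, _ => 1 - q ^+ d
  | _, 0 => - u * (1 - b * q ^+ d)
  | _, _ => q ^+ d - u
  end.

Fixpoint fstep x A la nu : R :=
  if la is l :: la' then
    fcol x (A 0%N) l (head 0%N la') (head 0%N nu) * fstep x (shift_seq A) la' (behead nu)
  else 1.

Fixpoint gstep x A la mu : R :=
  if la is l :: la' then
    gcol x (A 0%N) l (head 0%N la') (head 0%N mu) (head 0%N (behead mu)) *
    gstep x (shift_seq A) la' (behead mu)
  else 1.

Fixpoint estep u A mu h : R :=
  if mu is m :: mu' then
    ecol u (A 0%N) (head 0%N h) (head 0%N (behead h)) (m - head 0%N mu') *
    estep u (shift_seq A) mu' (behead h)
  else 1.

(* Each variable of F removes the last column parameter shift and one row: the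
   sequence [la] is expected to have as many entries as there are variables.  In
   [gpol] the number of entries is constant. *)
Fixpoint fpol (xs : seq R) A la : R :=
  if xs is x :: xs' then
    \sum_(nu <- box (head 0%N la).+1 (size xs'))
      fstep x A la nu * fpol xs' (shift_seq A) nu
  else (all (pred1 0%N) la)%:R.

Fixpoint gpol (xs : seq R) A la : R :=
  if xs is x :: xs' then
    \sum_(mu <- box (head 0%N la).+1 (size la)) gstep x A la mu * gpol xs' A mu
  else (all (pred1 0%N) la)%:R.

(* The 2 x 2 matrix through which the columns [c, c+1, ...] enter the exchange relation
   of column [c-1]; there y = q^(mu_c - (nu_c - k)). *)
Definition exchange_weight x u b (h k : nat) (y : R) : R :=
  match h, k with
  | 0, 0 => 1 - b * u * y
  | 0, _ => 1 - y
  | _, 0 => - u * (x - b * y)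
  | _, _ => y - x * u
  end.

Lemma qpochS x k : qpoch q x k.+1 = qpoch q x k * (1 - x * q ^+ k).
Proof. by rewrite /qpoch big_ord_recr. Qed.

Lemma hpochS x b k : hpoch x b k.+1 = hpoch x b k * (x - b * q ^+ k).
Proof. by rewrite /hpoch big_ord_recr. Qed.

Lemma qpoch0 x : qpoch q x 0 = 1.
Proof. by rewrite /qpoch big_ord0. Qed.

Lemma hpoch0 x b : hpoch x b 0 = 1.
Proof. by rewrite /hpoch big_ord0. Qed.

End Weights.

Arguments fpol : simpl never.
Arguments gpol : simpl never.

(** * The exchange relation of a single column *)

Section Exchange.
Variables (E : fieldType) (q : E).
Hypothesis q_reg : forall k, qpoch q q k != 0.
Implicit Types (x u b : E) (A : nat -> E) (la mu nu h : seq nat).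

Let qS k : 1 - q * q ^+ k != 0.
Proof. by move: (q_reg k.+1); rewrite qpochS mulf_eq0 negb_or => /andP[]. Qed.

(** Writing the entries as [m], [m + t], [m + t + s] removes the truncated subtractions, so that the
    identities below become rational ones in powers of q. *)
Lemma fcol_in x b t s l m e : e = (m + t)%N -> l = (e + s)%N ->
  fcol q x b l m e = qpoch q q (t + s) / qpoch q b (t + s) *
    (hpoch q x b s / qpoch q q s) * (qpoch q x t / qpoch q q t).
Proof.
move=> -> ->; rewrite /fcol !leq_addr /=.
by rewrite -{1 2}addnA !addKn.
Qed.

Lemma fcol_out x b l m e : ~~ (m <= e <= l)%N -> fcol q x b l m e = 0.
Proof. by rewrite /fcol => /negbTE ->. Qed.

(** The exchange matrix passes from the right of a column to its left. Here [l], [m] are consecutive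
    entries of mu, [e] is the entry of nu in this column, and [g] is the next entry of nu after the
    removal of [k']. Far outside the interlacing range both sides vanish; at the two ends of the
    range some terms do; in the interior a common factor is cleared and polynomials in powers of q
    are compared. *)
Lemma fcol_exchange x u b b' (h k' l m e g : nat) :
    (forall k, qpoch q b k != 0) -> (g <= m <= l)%N -> (h < 2)%N -> (k' < 2)%N ->
  \sum_(h' < 2) ecol q u b h h' (l - m) * fcol q x b (l + h) (m + h') e *
                exchange_weight x u b' h' k' (q ^+ (m - g)) =
  \sum_(k < 2 | (k <= e)%N) exchange_weight x u b h k (q ^+ (l - (e - k))) *
     fcol q x b l m (e - k) * ecol q u b' k k' (e - k - g).
Proof.
move=> b_reg /andP[gm ml] h2 k2.
have bS k : 1 - b * q ^+ k != 0.
  by move: (b_reg k.+1); rewrite qpochS mulf_eq0 negb_or => /andP[].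
rewrite [RHS]big_mkcond /= !big_ord_recl !big_ord0 /= /bump /= !addr0 !addn0 !subn0 addn1.
have out := fcol_out x b.
have [em|me] := ltnP e m.
  have [? ? ? ?] : [/\ ~~ (m <= e <= l + h)%N, ~~ (m < e <= l + h)%N,
    ~~ (m <= e <= l)%N & ~~ (m <= e - 1 <= l)%N] by split; lia.
  by rewrite !out // ?mulr0 ?mul0r if_same addr0.
have [le|el] := ltnP l.+1 e.
  have [? ? ? ?] : [/\ ~~ (m <= e <= l + h)%N, ~~ (m < e <= l + h)%N,
    ~~ (m <= e <= l)%N & ~~ (m <= e - 1 <= l)%N] by split; lia.
  by rewrite !out // ?mulr0 ?mul0r if_same addr0.
have [j jE] : exists j, m = (g + j)%N by exists (m - g)%N; lia.
have [d dE] : exists d, l = (m + d)%N by exists (l - m)%N; lia.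
have [-> ->] : (l - m)%N = d /\ (m - g)%N = j by lia.
(* Upper end [e = l.+1]: for [h = 0] the surviving exchange weight is 1 - y at y = 1. *)
have [lE|el'] := ltnP l e.
  have eE : e = l.+1 by lia.
  have o1 : ~~ (m <= l.+1 <= l)%N by lia.
  have -> : (e - 1 - g)%N = (d + j)%N by lia.
  rewrite eE subn1 /= subnn (out _ _ _ o1) mulr0 mul0r add0r.
  case: h h2 => [|[|//]] _.
    have [o2 o3] : ~~ (m <= l.+1 <= l + 0)%N /\ ~~ (m < l.+1 <= l + 0)%N by lia.
    rewrite (out _ _ _ o2) (out _ _ _ o3) !mulr0 !mul0r.
    by case: k' k2 => [|[|//]] _ /=; rewrite subrr !mul0r addr0.
  have [e1 e2 e3 e4] : [/\ l.+1 = (m + d.+1)%N, (l + 1 = l.+1 + 0)%N,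
    l.+1 = (m.+1 + d)%N & l = (m + d)%N] by split; lia.
  rewrite (fcol_in _ _ e1 e2) (fcol_in _ _ e3 e2) (fcol_in _ _ e4 (esym (addn0 l))) !addn0.
  rewrite hpoch0 !qpochS qpoch0 exprD.
  have := (qS d, bS d, q_reg d, b_reg d).
  by case: k' k2 => [|[|//]] _ /=; move: (q ^+ d) (q ^+ j) => y z [[[q1 q2] q3] q4];
    field; rewrite ?oner_neq0 ?q1 ?q2 ?q3 ?q4.
have [s lE] : exists s, l = (e + s)%N by exists (l - e)%N; lia.
(* Lower end: the terms with [m.+1] or [e - 1] are out of range. *)
have [eE|me'] := eqVneq e m.
  subst e; have o2 : ~~ (m < m <= l + h)%N by lia.
  have zz (X Y : E) : (if (0 < m)%N then X * fcol q x b l m (m - 1) * Y else 0) = 0.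
    by case: ifP => // m0; rewrite out ?mulr0 ?mul0r //; lia.
  rewrite zz (out _ _ _ o2) mulr0 mul0r !addr0.
  have [-> -> ->] : [/\ (l - m)%N = s, (m - g)%N = j & d = s] by split; lia.
  have e1 : (l + h = m + (s + h))%N by lia.
  rewrite (fcol_in _ _ (esym (addn0 m)) e1) (fcol_in _ _ (esym (addn0 m)) lE) !add0n !qpoch0.
  have [q1 q2] := (qS s, bS s); have [q3 q4] := (q_reg s, b_reg s).
  case: h h2 {e1 o2 zz} => [|[|//]] _; rewrite ?addn1 ?addn0 ?qpochS ?hpochS /=.
    by case: k' k2 => [|[|//]] _ /=; move: (q ^+ s) (q ^+ j) => y z; ring.
  by case: k' k2 => [|[|//]] _ /=; move: (q ^+ s) (q ^+ j) q1 q2 => y z q1 q2;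
    field; rewrite ?oner_neq0 ?q1 ?q2 ?q3 ?q4.
have [t eE] : exists t, e = (m + t.+1)%N by exists (e - m.+1)%N; lia.
have -> : (0 < e)%N by lia.
have [-> -> ->] : [/\ (l - e)%N = s, (l - (e - 1))%N = s.+1 & (e - g)%N = (t + j).+1] by split; lia.
have [-> ->] : (e - 1 - g)%N = (t + j)%N /\ d = (t + s).+1 by lia.
have [e1 e2 e3 e4] : [/\ (l + h = e + (s + h))%N, (e - 1 = m + t)%N, (l = (e - 1) + s.+1)%N &
  (e = m.+1 + t)%N] by split; lia.
rewrite (fcol_in _ _ eE e1) (fcol_in _ _ e4 e1) (fcol_in _ _ eE lE) (fcol_in _ _ e2 e3).
rewrite ?addSn ?addnS.
have [[q1 q2] q3] := (qS t, qS s, bS (t + s)%N).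
have [q4 q5] := (bS (t + s).+1, q_reg t).
have [q6 q7] := (q_reg s, b_reg (t + s)%N).
(* A common factor of all four terms; what remains after dividing by it is polynomial in the powers
   of q. *)
pose X := qpoch q q (t + s) / qpoch q b (t + s).+1 * (hpoch q x b s / qpoch q q s.+1) *
  (qpoch q x t / qpoch q q t.+1).
have -> : qpoch q q (t + s).+1 / qpoch q b (t + s).+1 * (hpoch q x b s / qpoch q q s) *
    (qpoch q x t.+1 / qpoch q q t.+1) =
    X * ((1 - q * q ^+ (t + s)) * (1 - q * q ^+ s) * (1 - x * q ^+ t)).
  by rewrite /X !qpochS; field; rewrite ?oner_neq0 ?q1 ?q2 ?q3 ?q5 ?q6 ?q7.
have -> : qpoch q q (t + s).+1 / qpoch q b (t + s).+1 * (hpoch q x b s.+1 / qpoch q q s.+1) *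
    (qpoch q x t / qpoch q q t) =
    X * ((1 - q * q ^+ (t + s)) * (x - b * q ^+ s) * (1 - q * q ^+ t)).
  by rewrite /X !qpochS hpochS; field; rewrite ?oner_neq0 ?q1 ?q2 ?q3 ?q5 ?q6 ?q7.
case: h h2 {e1} => [|[|//]] _; rewrite ?addn1 ?addn0 ?addnS.
  have -> : qpoch q q (t + s).+1 / qpoch q b (t + s).+1 * (hpoch q x b s / qpoch q q s) *
      (qpoch q x t.+1 / qpoch q q t.+1) =
      X * ((1 - q * q ^+ (t + s)) * (1 - q * q ^+ s) * (1 - x * q ^+ t)).
    by rewrite /X !qpochS; field; rewrite ?oner_neq0 ?q1 ?q2 ?q3 ?q5 ?q6 ?q7.
  have -> : qpoch q q (t + s) / qpoch q b (t + s) * (hpoch q x b s / qpoch q q s) *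
      (qpoch q x t / qpoch q q t) =
      X * ((1 - b * q ^+ (t + s)) * (1 - q * q ^+ s) * (1 - q * q ^+ t)).
    by rewrite /X !qpochS; field; rewrite ?oner_neq0 ?q1 ?q2 ?q3 ?q5 ?q6 ?q7.
  by case: k' k2 => [|[|//]] _ /=; rewrite !(exprS, exprD);
    move: (q ^+ t) (q ^+ s) (q ^+ j) X => y w z X; ring.
(* This weight is rewritten together with its vertex, whose factor 1 - b q^d cancels the additional
   denominator. *)
have -> : ecol q u b 1 0 (t + s).+1 * (qpoch q q (t + s).+2 / qpoch q b (t + s).+2 *
      (hpoch q x b s.+1 / qpoch q q s.+1) * (qpoch q x t.+1 / qpoch q q t.+1)) =
    - u * X * ((1 - q * q ^+ (t + s)) * (1 - q * q ^+ (t + s).+1) * (x - b * q ^+ s) *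
               (1 - x * q ^+ t)).
  by rewrite /X /= !qpochS hpochS; field; rewrite ?oner_neq0 ?q1 ?q2 ?q3 ?q4 ?q5 ?q6 ?q7.
have -> : qpoch q q (t + s).+1 / qpoch q b (t + s).+1 * (hpoch q x b s.+1 / qpoch q q s.+1) *
    (qpoch q x t / qpoch q q t) =
    X * ((1 - q * q ^+ (t + s)) * (x - b * q ^+ s) * (1 - q * q ^+ t)).
  by rewrite /X !qpochS hpochS; field; rewrite ?oner_neq0 ?q1 ?q2 ?q3 ?q5 ?q6 ?q7.
by case: k' k2 => [|[|//]] _ /=; rewrite !(exprS, exprD);
  move: (q ^+ t) (q ^+ s) (q ^+ j) X => y w z X; ring.
Qed.
End Exchange.

(** * Interlacing sequences and the support of the weights *)

Lemma size_seqD s t : size (seqD s t) = minn (size s) (size t).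
Proof. by elim: s t => [|x s IH] [|y t] //=; rewrite IH minnSS. Qed.

Lemma size_seqB s t : size (seqB s t) = minn (size s) (size t).
Proof. by elim: s t => [|x s IH] [|y t] //=; rewrite IH minnSS. Qed.

Lemma nth_behead (s : seq nat) c : nth 0%N (behead s) c = nth 0%N s c.+1.
Proof. by case: s => [|x s] //=; rewrite nth_nil. Qed.

Lemma box_widen (V : nmodType) M M' n (phi : seq nat -> V) : (M' <= M)%N ->
    (forall s, size s = n -> ~~ all (fun x => x < M')%N s -> phi s = 0) ->
  \sum_(s <- box M n) phi s = \sum_(s <- box M' n) phi s.
Proof.
move=> le0 phi0; rewrite (bigID (fun s => all (fun x => x < M')%N s)) /=.
rewrite [X in _ + X]big_seq_cond [X in _ + X]big1 ?addr0; last first.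
  by move=> s /andP[]; rewrite mem_box => /andP[/eqP sn _] /(phi0 _ sn).
rewrite -big_filter; apply/perm_big/uniq_perm; rewrite ?filter_uniq ?box_uniq // => s.
rewrite mem_filter !mem_box andbC -andbA; congr andb; apply: andb_idl.
by apply: sub_all => x xM'; apply: leq_trans le0.
Qed.

(** Missing entries of [nu] read as 0, so one predicate serves both F, where a step shortens the
    sequence by one, and F*, where it keeps the length. *)
Fixpoint interlace (la nu : seq nat) : bool :=
  if la is l :: la' then
    (head 0 la' <= head 0 nu <= l)%N && interlace la' (behead nu)
  else nu == [::].

Lemma interlaceP la nu : (size nu <= size la)%N ->
  reflect (forall c, nth 0 la c.+1 <= nth 0 nu c <= nth 0 la c)%N (interlace la nu).
Proof.
elim: la nu => [|l la IH] nu /= sz.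
  case: nu sz => //= _; apply: ReflectT => c; by rewrite !nth_nil.
have sz' : (size (behead nu) <= size la)%N by rewrite size_behead; lia.
apply: (iffP andP) => [[h0 /(IH _ sz') h] [|c]|h].
- by rewrite -!nth0 in h0.
- by move: (h c); rewrite nth_behead.
by split; [move: (h 0%N); rewrite -!nth0|apply/IH => // c; move: (h c.+1); rewrite nth_behead].
Qed.

Lemma interlace_head la nu c : (size nu <= size la)%N -> interlace la nu ->
  (nth 0 nu c <= head 0 la)%N.
Proof.
move=> sz /(interlaceP sz) H; rewrite -nth0.
elim: c => [|c IH]; first by have /andP[] := H 0%N.
apply: leq_trans IH; have /andP[_ h1] := H c.+1; have /andP[h2 _] := H c.
exact: leq_trans h1 h2.
Qed.

Lemma interlace_all la nu M : (size nu <= size la)%N -> interlace la nu ->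
  (head 0 la < M)%N -> all (fun x => x < M)%N nu.
Proof.
move=> sz il lM; apply/(all_nthP 0%N) => c _.
exact: leq_ltn_trans (interlace_head c sz il) lM.
Qed.

Lemma interlace_sorted la nu : (size nu <= size la)%N -> interlace la nu ->
  sorted geq la /\ sorted geq nu.
Proof.
move=> sz /(interlaceP sz) H; split; apply/(sortedP 0%N) => c _ /=.
  by have /andP[h1 h2] := H c; apply: leq_trans h1 h2.
have /andP[_ h1] := H c.+1; have /andP[h2 _] := H c; exact: leq_trans h1 h2.
Qed.

Section Support.
Variables (R : comUnitRingType) (q : R).
Implicit Types (x u b : R) (A : nat -> R) (la mu nu h : seq nat).

Lemma fstep_out x A la nu : (size nu <= size la)%N -> ~~ interlace la nu ->
  fstep q x A la nu = 0.
Proof.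
elim: la A nu => [|l la IH] A nu /=; first by case: nu.
move=> sz; rewrite negb_and => /orP[h|h].
  by rewrite /fcol (negbTE h) mul0r.
by rewrite IH ?mulr0 // size_behead; lia.
Qed.

Lemma gstep_out x A la nu : (size nu <= size la)%N -> ~~ interlace la nu ->
  gstep q x A la nu = 0.
Proof.
elim: la A nu => [|l la IH] A nu /=; first by case: nu.
move=> sz; rewrite negb_and => /orP[h|h].
  by rewrite /gcol (negbTE h) mul0r.
by rewrite IH ?mulr0 // size_behead; lia.
Qed.

(** The freedom in [M] lets several sums be brought to a common box before summations are
    exchanged. *)
Lemma fpolE x xs A la M : size la = (size xs).+1 -> (head 0 la < M)%N ->
  fpol q (x :: xs) A la =
  \sum_(nu <- box M (size xs)) fstep q x A la nu * fpol q xs (shift_seq A) nu.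
Proof.
move=> sz lM; symmetry; apply: box_widen => // nu sn.
apply: contraNeq => ne0; have snl : (size nu <= size la)%N by rewrite sn sz.
have il : interlace la nu.
  by apply: contraNT ne0 => /(fstep_out x A snl) ->; rewrite mul0r.
exact: interlace_all il _.
Qed.

Lemma gpolE x xs A la M : (head 0 la < M)%N ->
  gpol q (x :: xs) A la =
  \sum_(mu <- box M (size la)) gstep q x A la mu * gpol q xs A mu.
Proof.
move=> lM; symmetry; apply: box_widen => // nu sn.
apply: contraNeq => ne0; have snl : (size nu <= size la)%N by rewrite sn.
have il : interlace la nu.
  by apply: contraNT ne0 => /(gstep_out x A snl) ->; rewrite mul0r.
exact: interlace_all il _.
Qed.

End Support.

(** * The exchange relation across several columns *)

Section Pieri.
Variables (E : fieldType) (q : E).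
Hypothesis q_reg : forall k, qpoch q q k != 0.
Implicit Types (x u b : E) (A : nat -> E) (la mu nu h : seq nat).

(** The last column of mu faces no entry of nu and creates the exchange matrix. The induction
    hypothesis has brought the matrix to the right of the current column, and [fcol_exchange] moves
    it across. *)
Lemma exchange_tail x u mu nu A (h : nat) : size mu = (size nu).+1 -> sorted geq mu ->
    (h < 2)%N -> (forall c k, qpoch q (A c) k != 0) ->
  \sum_(hs <- box 2 (size nu))
     estep q u A mu (h :: hs) * fstep q x A (seqD mu (h :: hs)) nu =
  \sum_(ks <- box 2 (size nu) | all2 leq ks nu)
     exchange_weight x u (A 0%N) h (head 0%N ks) (q ^+ (head 0 mu - (head 0 nu - head 0 ks))) *
     (fstep q x A mu (seqB nu ks) * estep q u (shift_seq A) (seqB nu ks) ks).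
Proof.
elim: nu mu A h => [|e nu IH] [|l mu] // A h.
  case: mu => // _ _ h2 A_reg; rewrite [RHS]big_mkcond /= !big_box0 /= !subn0 !mulr1.
  have e0 : (l + h = 0 + (l + h))%N by [].
  have e0' : (l = 0 + l)%N by [].
  rewrite (fcol_in _ _ _ (esym (addn0 0)) e0) (fcol_in _ _ _ (esym (addn0 0)) e0').
  rewrite !add0n !qpoch0; move: (A_reg 0%N l) (A_reg 0%N l.+1) (q_reg l) (q_reg l.+1).
  case: h h2 {e0 e0'} => [|[|//]] _; rewrite ?addn1 ?addn0 ?qpochS ?hpochS /=.
    by rewrite !divff ?oner_neq0.
  rewrite !mulf_eq0 !negb_or => ? /andP[? ?] ? /andP[? ?].
  by field; do ?[apply/andP; split]; rewrite ?oner_neq0.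
case: mu => // m mu [sz] /= /andP[ml srt] h2 A_reg.
pose F ks := fstep q x (shift_seq A) (m :: mu) (seqB nu ks) *
             estep q u (shift_seq (shift_seq A)) (seqB nu ks) ks.
transitivity (\sum_(ks <- box 2 (size nu) | all2 leq ks nu) \sum_(h' < 2)
    ecol q u (A 0%N) h h' (l - m) * fcol q x (A 0%N) (l + h) (m + h') e *
    exchange_weight x u (A 1%N) h' (head 0%N ks) (q ^+ (m - (head 0 nu - head 0 ks))) * F ks).
  rewrite exchange_big big_box_cons /=; apply: eq_bigr => h' _.
  under [RHS]eq_bigr => ks _ do rewrite -mulrA.
  rewrite -big_distrr /= -(IH (m :: mu) (shift_seq A)) //=; [|by rewrite sz|by move=> c k; apply: A_reg].
  by rewrite big_distrr /=; apply: eq_bigr => hs _; rewrite mulrACA.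
rewrite [RHS]big_mkcond [RHS]big_box_cons [RHS]exchange_big [LHS]big_mkcond /=.
apply: eq_big_seq => ks; rewrite mem_box => /andP[/eqP sk ak].
rewrite -big_mkcond /=.
case le: (all2 leq ks nu); last by rewrite big1 // => k; rewrite andbF.
under [RHS]eq_bigl => k do rewrite andbT.
have k2 : (head 0 ks < 2)%N by case: (ks) ak => //= ? ? /andP[].
have hE : head 0%N (seqB nu ks) = (head 0 nu - head 0 ks)%N.
  by case: (ks) (nu) sk => [|? ?] [|? ?].
rewrite -big_distrl /=; set g := (head 0 nu - head 0 ks)%N in hE *.
have sz' : (size (seqB nu ks) <= size (m :: mu))%N.
  by rewrite size_seqB /=; move: sz => /= sz; lia.
transitivity ((\sum_(k < 2 | (k <= e)%N) exchange_weight x u (A 0%N) h k (q ^+ (l - (e - k))) *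
     fcol q x (A 0%N) l m (e - k) * ecol q u (A 1%N) k (head 0%N ks) (e - k - g)) * F ks).
  (* If the tails interlace, the bound [g <= m] required by [fcol_exchange] holds; otherwise the
     factor [F ks] kills both sides. *)
  have [il|/(fstep_out q x (shift_seq A) sz') F0] := boolP (interlace (m :: mu) (seqB nu ks)).
    congr (_ * _); apply: fcol_exchange => //; rewrite ml andbT -hE -nth0.
    exact: interlace_head il.
  by rewrite /F F0 mul0r !mulr0.
rewrite mulr_suml; apply: eq_bigr => k _.
by rewrite /F /= hE -/g /shift_seq; ring.
Qed.
End Pieri.

(** * Pieri and fusion relations *)

Lemma reindex_nat_sub (V : nmodType) M (g : nat -> nat -> nat -> V) :
  \sum_(x < M) \sum_(k < 2 | (k <= x)%N) g (x - k)%N k x =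
  \sum_(y < M) \sum_(k < 2 | (y + k < M)%N) g y k (y + k)%N.
Proof.
under eq_bigr => x _ do rewrite big_mkcond !big_ord_recl big_ord0 /= addr0 subn0 /bump /=.
under [RHS]eq_bigr => x _ do
  rewrite big_mkcond !big_ord_recl big_ord0 /= addr0 addn0 ltn_ord /bump /= addn1.
rewrite !big_split /=; congr (_ + _); case: M => [|M]; first by rewrite !big_ord0.
rewrite big_ord_recl big_ord_recr /= ltnn add0r addr0; apply: eq_bigr => i _.
by rewrite /bump /= add1n subn1 /= ltnS ltn_ord.
Qed.

(** Substitution s = r + k, entry by entry. The condition that r + k stays in the box is the origin
    of the boundary term in [cauchy_sum_dilate]. *)
Lemma reindex_box_sub (V : nmodType) M n (G : seq nat -> seq nat -> seq nat -> V) :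
  \sum_(s <- box M n) \sum_(k <- box 2 n | all2 leq k s) G (seqB s k) k s =
  \sum_(r <- box M n) \sum_(k <- box 2 n | all (fun x => x < M)%N (seqD r k))
     G r k (seqD r k).
Proof.
elim: n G => [|n IH] G; first by rewrite !big_box0 !big_mkcond !big_box0.
transitivity (\sum_(x < M) \sum_(k0 < 2 | (k0 <= x)%N)
   \sum_(s <- box M n) \sum_(k <- box 2 n | all2 leq k s)
     G ((x - k0)%N :: seqB s k) (nat_of_ord k0 :: k) (nat_of_ord x :: s)).
  rewrite big_box_cons; apply: eq_bigr => x _.
  rewrite exchange_big /=; apply: eq_bigr => s _.
  rewrite big_mkcond big_box_cons [RHS]big_mkcond /=; apply: eq_bigr => k0 _.
  by case: ifP => k0x; rewrite -?big_mkcond //= big1.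
under eq_bigr => x _.
  under eq_bigr => k0 _ do
    rewrite (IH (fun a b c => G ((x - k0)%N :: a) (nat_of_ord k0 :: b) (nat_of_ord x :: c))).
  over.
rewrite (reindex_nat_sub M (fun y k0 x => \sum_(r <- box M n)
  \sum_(k <- box 2 n | all (fun x => x < M)%N (seqD r k)) G (y :: r) (k0 :: k) (x :: seqD r k))).
rewrite [RHS]big_box_cons; apply: eq_bigr => x _.
rewrite exchange_big /=; apply: eq_bigr => s _.
rewrite [RHS]big_mkcond big_box_cons [LHS]big_mkcond /=; apply: eq_bigr => k0 _.
by case: ifP => k0x; rewrite -?big_mkcond //= big1.
Qed.

Section PieriFusion.
Variables (E : fieldType) (q : E).
Hypothesis q_reg : forall k, qpoch q q k != 0.
Implicit Types (x u b : E) (A : nat -> E) (la mu nu h : seq nat).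

(** At the left edge the label of the matrix is summed freely. Both columns of [exchange_weight]
    have sum 1 - xu, whatever b and y are, so the matrix disappears and leaves this scalar. *)
Lemma exchange x u mu nu A : size mu = (size nu).+1 -> sorted geq mu ->
    (forall c k, qpoch q (A c) k != 0) ->
  \sum_(hs <- box 2 (size mu)) estep q u A mu hs * fstep q x A (seqD mu hs) nu =
  (1 - x * u) * \sum_(ks <- box 2 (size nu) | all2 leq ks nu)
     fstep q x A mu (seqB nu ks) * estep q u (shift_seq A) (seqB nu ks) ks.
Proof.
move=> sz srt A_reg; rewrite sz big_box_cons.
under eq_bigr => h _ do rewrite (exchange_tail q_reg) //.
rewrite exchange_big big_distrr /= big_seq_cond [RHS]big_seq_cond.
apply: eq_bigr => ks /andP[]; rewrite mem_box => /andP[_ ks2] _.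
rewrite -big_distrl /=; congr (_ * _); rewrite !big_ord_recl big_ord0 /=.
by case: ks ks2 => [|[|k] ks] /= _; ring.
Qed.

(** One use of [exchange] extracts the factor of the first variable and leaves the same kind of sum
    for the remaining variables and the shifted parameters. *)
Lemma pieri u xs A mu : size mu = size xs -> sorted geq mu ->
    (forall c k, qpoch q (A c) k != 0) ->
  \sum_(h <- box 2 (size mu)) estep q u A mu h * fpol q xs A (seqD mu h) =
  (\prod_(x <- xs) (1 - x * u)) * fpol q xs A mu.
Proof.
elim: xs A mu => [|x xs IH] A mu sz srt A_reg.
  by rewrite sz big_box0 big_nil; case: mu sz {srt} => //= _; rewrite mul1r.
(* The first entry of mu + h is at most [(head 0 mu).+1], so this box serves every h. *)
pose M := (head 0%N mu).+2.
transitivity (\sum_(h <- box 2 (size mu)) \sum_(nu <- box M (size xs))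
   (estep q u A mu h * fstep q x A (seqD mu h) nu) * fpol q xs (shift_seq A) nu).
  apply: eq_big_seq => h; rewrite mem_box => /andP[/eqP sh h2].
  rewrite (@fpolE _ _ _ _ _ _ M) ?size_seqD ?sh ?sz ?minnn //; last first.
    by rewrite /M; case: (mu) (h) h2 sz => [|m mu'] [|[|[|y]] h'] //=; lia.
  by rewrite big_distrr /=; apply: eq_bigr => nu _; rewrite mulrA.
rewrite exchange_big /=.
transitivity (\sum_(nu <- box M (size xs)) \sum_(ks <- box 2 (size xs) | all2 leq ks nu)
  (1 - x * u) * (fpol q xs (shift_seq A) nu *
     (fstep q x A mu (seqB nu ks) * estep q u (shift_seq A) (seqB nu ks) ks))).
  apply: eq_big_seq => nu; rewrite mem_box => /andP[/eqP snu _].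
  rewrite -big_distrl /= exchange // ?snu // mulrC mulrCA -!big_distrr /=.
  by rewrite mulrA.
rewrite (reindex_box_sub M _ (fun a k nu => (1 - x * u) * (fpol q xs (shift_seq A) nu *
     (fstep q x A mu a * estep q u (shift_seq A) a k)))).
rewrite big_cons -mulrA (@fpolE _ _ _ _ _ _ M) // ?sz // !big_distrr /=.
apply: eq_big_seq => r; rewrite mem_box => /andP[/eqP sr _].
have szr : (size r <= size mu)%N by rewrite sr sz /=.
have [il|/(fstep_out q x A szr) F0] := boolP (interlace mu r); last first.
  by rewrite F0 big1 => [|k _]; rewrite !(mul0r, mulr0).
have [_ srt'] := interlace_sorted szr il.
rewrite [LHS](_ : _ = (1 - x * u) * (fstep q x A mu r *
    \sum_(k <- box 2 (size r)) estep q u (shift_seq A) r k * fpol q xs (shift_seq A) (seqD r k))).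
  by rewrite IH //; [ring|move=> c k; apply: A_reg].
(* The box condition left by the reindexing is automatic: entries of [r] are at most [head 0 mu] and
   those of [k] at most 1. *)
rewrite sr !big_distrr /= [RHS]big_seq [LHS]big_seq_cond; apply: eq_big => k.
  rewrite mem_box; case: eqP => //= sk; apply: andb_idr => k2.
  apply/(all_nthP 0%N) => i _.
  have ri := interlace_head i szr il.
  have ki : (nth 0 k i < 2)%N.
    have [ik|ik] := ltnP i (size k); last by rewrite nth_default.
    exact: (all_nthP 0%N k2).
  have -> : nth 0%N (seqD r k) i = (nth 0 r i + nth 0 k i)%N.
    have : size r = size k by rewrite sr.
    elim: (r) (k) (i) => [|y r' IHr] [|z k'] [|j] //= [] //; exact: IHr.
  by rewrite /M; lia.
by move=> _; ring.
Qed.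

Lemma qpochSl x k : qpoch q x k.+1 = (1 - x) * qpoch q (q * x) k.
Proof.
rewrite /qpoch big_ord_recl /= expr0 mulr1; congr (_ * _).
by apply: eq_bigr => i _; rewrite /bump /= add1n exprS mulrCA mulrA.
Qed.

(** Since qx - q^(i+1) = q(x - q^i), all factors but the first are those of [hpoch q x 1 k], up to a
    power of q. *)
Lemma hpoch_dilate x k :
  hpoch q (q * x) 1 k.+1 = (q * x - 1) * q ^+ k * hpoch q x 1 k.
Proof.
elim: k => [|k IH]; first by rewrite hpochS !hpoch0 expr0; ring.
by rewrite hpochS IH hpochS exprS; ring.
Qed.

Lemma gcol_in x b l0 l1 m0 m1 d m : m0 = (l1 + m)%N -> l0 = (m0 + d)%N ->
  gcol q x b l0 l1 m0 m1 = hpoch q x 1 d / qpoch q q d *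
    (qpoch q (b * x) m / qpoch q q m) * (qpoch q q (m0 - m1) / qpoch q b (m0 - m1)).
Proof. by move=> -> ->; rewrite /gcol !leq_addr /= !addKn. Qed.

Lemma gcol_out x b l0 l1 m0 m1 : ~~ (l1 <= m0 <= l0)%N -> gcol q x b l0 l1 m0 m1 = 0.
Proof. by rewrite /gcol => /negbTE ->. Qed.

(* The sum over the left label does not depend on the right label [h1]: this is
   what lets the columns decouple. *)
Lemma gcol_fusion x b l0 l1 m0 m1 (h1 : nat) : (h1 <= l1)%N -> (h1 < 2)%N ->
  \sum_(h0 < 2 | (h0 <= l0)%N) ecol q x b h0 h1 ((l0 - h0) - (l1 - h1)) *
     gcol q x b (l0 - h0) (l1 - h1) m0 m1 =
  (1 - b * x) * gcol q (q * x) b l0 l1 m0 m1.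
Proof.
have qS k : 1 - q * q ^+ k != 0.
  by move: (q_reg k.+1); rewrite qpochS mulf_eq0 negb_or => /andP[].
move=> hl1 h12; rewrite big_mkcond !big_ord_recl big_ord0 /= /bump /= addr0 !subn0.
have out y := @gcol_out y b.
have [lm|ml] := ltnP l0 m0.
  have [? ? ?] : [/\ ~~ (l1 - h1 <= m0 <= l0)%N, ~~ (l1 - h1 <= m0 <= l0 - 1)%N &
    ~~ (l1 <= m0 <= l0)%N] by split; lia.
  by rewrite !out // !mulr0 if_same addr0.
have [d dE] : exists d, l0 = (m0 + d)%N by exists (l0 - m0)%N; lia.
(* Here the right-hand side is 0. The left-hand side has nonzero terms only for [h1 = 1] and
   [m0 = l1 - 1], and there they cancel. *)
have [lm|ml1] := ltnP m0 l1.
  have o : ~~ (l1 <= m0 <= l0)%N by lia.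
  rewrite (out _ _ _ _ _ o) mulr0.
  have [lm1|ml1] := ltnP m0 (l1 - h1)%N.
    have [? ?] : ~~ (l1 - h1 <= m0 <= l0)%N /\ ~~ (l1 - h1 <= m0 <= l0 - 1)%N by lia.
    by rewrite !out // !mulr0 if_same addr0.
  have hE : h1 = 1%N by lia.
  have e1 : m0 = (l1 - h1 + 0)%N by lia.
  rewrite hE in e1 *; rewrite (gcol_in _ _ _ e1 dE) (_ : (l0 - (l1 - 1))%N = d); last by lia.
  case: d dE => [|d] dE.
    rewrite /= expr0 subrr mul0r add0r; case: ifP => // l00.
    by rewrite out ?mulr0 //; lia.
  have [-> e2] : (0 < l0)%N /\ (l0 - 1 = m0 + d)%N by lia.
  rewrite (gcol_in _ _ _ e1 e2) (_ : (l0 - 1 - (l1 - 1))%N = d) /=; last by lia.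
  rewrite exprS hpochS qpochS !qpoch0; move: (qS d) (q_reg d) => q1 q2.
  set Y := _ / qpoch q b _.
  by move: (q ^+ d) (qpoch q q d) q1 q2 => y z q1 q2; field; rewrite ?oner_neq0 ?q1 ?q2.
have [m mE] : exists m, m0 = (l1 + m)%N by exists (m0 - l1)%N; lia.
have e1 : m0 = (l1 - h1 + (m + h1))%N by lia.
rewrite (gcol_in _ _ _ e1 dE) (gcol_in _ _ _ mE dE).
have -> : (l0 - (l1 - h1))%N = (d + (m + h1))%N by lia.
set Y := _ / qpoch q b _.
have [q1 q2] := (qS m, q_reg m).
(* Trades the dilated symbol for the undilated one, so that both sides share [qpoch q (b * x) m]. *)
have xS : (1 - b * x) * qpoch q (b * (q * x)) m = qpoch q (b * x) m * (1 - b * x * q ^+ m).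
  by rewrite mulrCA -qpochSl qpochS.
case: d dE => [|d] dE.
  have -> (U V : E) : (if (0 < l0)%N then U * gcol q x b (l0 - 1) (l1 - h1) m0 m1 else V) =
     if (0 < l0)%N then 0 else V.
    case: ifP => // l00; rewrite out ?mulr0 //; lia.
  rewrite if_same addr0 add0n !hpoch0 !qpoch0 divr1 !mul1r.
  transitivity (((1 - b * x) * qpoch q (b * (q * x)) m) / qpoch q q m * Y); last by ring.
  rewrite xS.
  case: h1 h12 {hl1 e1} => [|[|//]] _; rewrite ?addn0 ?addn1 /=; first by ring.
  by rewrite !qpochS exprS; field; rewrite ?oner_neq0 ?q1 ?q2.
have [-> e2] : (0 < l0)%N /\ (l0 - 1 = m0 + d)%N by lia.
rewrite (gcol_in _ _ _ e1 e2) (_ : (l0 - 1 - (l1 - h1))%N = (d + (m + h1))%N); last by lia.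
rewrite -/Y hpoch_dilate hpochS !qpochS.
have [q3 q4] := (qS d, q_reg d).
transitivity (((q * x - 1) * q ^+ d * hpoch q x 1 d / (qpoch q q d * (1 - q * q ^+ d)) *
  (((1 - b * x) * qpoch q (b * (q * x)) m) / qpoch q q m) * Y)); last by ring.
rewrite xS; case: h1 h12 {hl1 e1} => [|[|//]] _; rewrite ?addn0 ?addn1 /= ?addSn ?addnS.
  by rewrite !exprS !exprD; field; rewrite ?oner_neq0 ?q1 ?q2 ?q3 ?q4.
by rewrite !qpochS !exprS !exprD; field; rewrite ?oner_neq0 ?q1 ?q2 ?q3 ?q4.
Qed.

(** The first column can be summed over its left label whatever label it shares with the rest, so
    the sum over strips becomes a product over columns. *)
Lemma fusion x A la mu : size mu = size la ->
  (\prod_(c < size la) (1 - A c * x)) * gstep q (q * x) A la mu =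
  \sum_(k <- box 2 (size la) | all2 leq k la)
     estep q x A (seqB la k) k * gstep q x A (seqB la k) mu.
Proof.
elim: la A mu => [|l la IH] A [|m mu] //=.
  by move=> _; rewrite [RHS]big_mkcond big_box0 big_ord0 !mul1r.
case=> sz; rewrite [RHS]big_mkcond big_box_cons exchange_big big_ord_recl /=.
rewrite mulrACA (eq_bigr (fun c : 'I_(size la) => 1 - shift_seq A c * x)) //.
rewrite IH // mulr_sumr big_mkcond; apply: eq_big_seq => k.
rewrite mem_box => /andP[/eqP sk k2].
case le: (all2 leq k la); last by rewrite big1 // => k0 _; rewrite andbF.
have hE : head 0%N (seqB la k) = (head 0 la - head 0 k)%N.
  by case: (la) (k) sk => [|? ?] [|? ?].
have k12 : (head 0 k < 2)%N by case: (k) k2 => //= ? ? /andP[].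
have k1l : (head 0 k <= head 0 la)%N by case: (k) (la) le => [|? ?] [|? ?] //= /andP[].
rewrite -(gcol_fusion x (A 0%N) l m (head 0%N mu) k1l k12) big_mkcond big_distrl /=.
apply: eq_bigr => k0 _; rewrite andbT hE; case: ifP => _; last by rewrite mul0r.
by rewrite mulrACA.
Qed.

End PieriFusion.

(** * Descent from fields to integral domains *)

Section Morphism.
Variables (R S : comUnitRingType) (f : {rmorphism R -> S}) (q : R).
Hypothesis q_unit : forall k, qpoch q q k \is a GRing.unit.
Implicit Types (x u b : R) (A : nat -> R) (la mu nu h : seq nat).

Lemma rmorph_qpoch x k : f (qpoch q x k) = qpoch (f q) (f x) k.
Proof.
rewrite /qpoch rmorph_prod; apply: eq_bigr => i _.
by rewrite rmorphB rmorph1 rmorphM rmorphXn.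
Qed.

Lemma rmorph_hpoch x b k : f (hpoch q x b k) = hpoch (f q) (f x) (f b) k.
Proof.
rewrite /hpoch rmorph_prod; apply: eq_bigr => i _.
by rewrite rmorphB rmorphM rmorphXn.
Qed.

Lemma rmorph_fstep x A la nu : (forall c k, qpoch q (A c) k \is a GRing.unit) ->
  f (fstep q x A la nu) = fstep (f q) (f x) (f \o A) la nu.
Proof.
elim: la nu A => [|l la IH] nu A A_unit /=; first by rewrite rmorph1.
rewrite rmorphM IH => [|c k]; last exact: A_unit.
congr (_ * _); rewrite /fcol; case: ifP => _; last by rewrite rmorph0.
by rewrite !rmorphM !rmorphV ?A_unit // rmorph_hpoch !rmorph_qpoch.
Qed.

Lemma rmorph_gstep x A la mu : (forall c k, qpoch q (A c) k \is a GRing.unit) ->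
  f (gstep q x A la mu) = gstep (f q) (f x) (f \o A) la mu.
Proof.
elim: la mu A => [|l la IH] mu A A_unit /=; first by rewrite rmorph1.
rewrite rmorphM IH => [|c k]; last exact: A_unit.
congr (_ * _); rewrite /gcol; case: ifP => _; last by rewrite rmorph0.
by rewrite !rmorphM !rmorphV ?A_unit // rmorph_hpoch !rmorph_qpoch rmorphM rmorph1.
Qed.

Lemma rmorph_estep u A mu h :
  f (estep q u A mu h) = estep (f q) (f u) (f \o A) mu h.
Proof.
elim: mu h A => [|m mu IH] h A /=; first by rewrite rmorph1.
rewrite rmorphM IH; congr (_ * _).
case: (head 0%N h) (head 0%N (behead h)) => [|?] [|?] /=;
  by rewrite ?(rmorphM, rmorphN, rmorphB, rmorph1, rmorphXn).
Qed.

Lemma rmorph_fpol xs A la : (forall c k, qpoch q (A c) k \is a GRing.unit) ->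
  f (fpol q xs A la) = fpol (f q) (map f xs) (f \o A) la.
Proof.
elim: xs la A => [|x xs IH] la A A_unit; rewrite /fpol /= -/fpol.
  by rewrite rmorph_nat.
rewrite rmorph_sum size_map; apply: eq_bigr => nu _.
by rewrite rmorphM rmorph_fstep // IH // => c k; apply: A_unit.
Qed.

Lemma rmorph_gpol xs A la : (forall c k, qpoch q (A c) k \is a GRing.unit) ->
  f (gpol q xs A la) = gpol (f q) (map f xs) (f \o A) la.
Proof.
elim: xs la => [|x xs IH] la A_unit; rewrite /gpol /= -/gpol.
  by rewrite rmorph_nat.
rewrite rmorph_sum; apply: eq_bigr => mu _.
by rewrite rmorphM rmorph_gstep // IH.
Qed.

End Morphism.

Lemma tofrac_qpoch_neq0 (R : idomainType) (q x : R) :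
    (forall k, qpoch q x k \is a GRing.unit) ->
  forall k, qpoch (FracField.tofrac q) (FracField.tofrac x) k != 0.
Proof.
move=> xu k; rewrite -(rmorph_qpoch (@FracField.tofrac R)) tofrac_eq0.
by apply/eqP => x0; move: (xu k); rewrite x0 unitr0.
Qed.

Section IntegralDomain.
Variables (R : idomainType) (q : R) (A : nat -> R).
Hypothesis q_unit : forall k, qpoch q q k \is a GRing.unit.
Hypothesis A_unit : forall c k, qpoch q (A c) k \is a GRing.unit.
Implicit Types (x u : R) (la mu nu h : seq nat).

Let tofrac_inj : injective (@FracField.tofrac R).
Proof. by move=> x y /eqP; rewrite tofrac_eq => /eqP. Qed.


(** All denominators are units, so the weights commute with the injective map to the fraction field,
    where the relation is known. *)
Lemma pieri_domain u xs mu : size mu = size xs -> sorted geq mu ->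
  \sum_(h <- box 2 (size mu)) estep q u A mu h * fpol q xs A (seqD mu h) =
  (\prod_(x <- xs) (1 - x * u)) * fpol q xs A mu.
Proof.
move=> sz srt; apply: tofrac_inj; rewrite rmorph_sum rmorphM rmorph_fpol //.
rewrite rmorph_prod [in RHS](_ : \prod_(i <- xs) _ =
   \prod_(x <- map (@FracField.tofrac R) xs) (1 - x * FracField.tofrac u)); last first.
  by rewrite big_map; apply: eq_bigr => x _; rewrite rmorphB rmorph1 rmorphM.
rewrite -pieri ?size_map //; [|exact: tofrac_qpoch_neq0|by move=> c; apply: tofrac_qpoch_neq0].
by apply: eq_bigr => h _; rewrite rmorphM rmorph_estep rmorph_fpol.
Qed.

Lemma fusion_domain x la mu : size mu = size la ->
  (\prod_(c < size la) (1 - A c * x)) * gstep q (q * x) A la mu =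
  \sum_(k <- box 2 (size la) | all2 leq k la)
     estep q x A (seqB la k) k * gstep q x A (seqB la k) mu.
Proof.
move=> sz; apply: tofrac_inj; rewrite rmorph_sum rmorphM rmorph_gstep // rmorphM.
rewrite rmorph_prod [in LHS](eq_bigr (fun c : 'I_(size la) =>
  1 - (@FracField.tofrac R \o A) c * FracField.tofrac x)); last first.
  by move=> c _; rewrite rmorphB rmorph1 rmorphM.
rewrite fusion //; last exact: tofrac_qpoch_neq0.
by apply: eq_bigr => h _; rewrite rmorphM rmorph_estep rmorph_gstep.
Qed.

Lemma gpol_dilate x xs la :
  (\prod_(c < size la) (1 - A c * x)) * gpol q (q * x :: xs) A la =
  \sum_(k <- box 2 (size la) | all2 leq k la)
     estep q x A (seqB la k) k * gpol q (x :: xs) A (seqB la k).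
Proof.
rewrite (gpolE _ _ _ _ (ltnSn (head 0%N la))) big_distrr /=.
transitivity (\sum_(mu <- box (head 0 la).+1 (size la))
   \sum_(k <- box 2 (size la) | all2 leq k la)
     estep q x A (seqB la k) k * gstep q x A (seqB la k) mu * gpol q xs A mu).
  apply: eq_big_seq => mu; rewrite mem_box => /andP[/eqP sm _].
  by rewrite mulrA fusion_domain // mulr_suml.
rewrite exchange_big /= big_seq_cond [RHS]big_seq_cond; apply: eq_bigr => k.
rewrite mem_box -andbA => /and3P[/eqP sk _ le].
have ss : size (seqB la k) = size la by rewrite size_seqB sk minnn.
have hl : (head 0 (seqB la k) < (head 0 la).+1)%N.
  by case: (la) (k) sk => [|? ?] [|? ?] //= _; rewrite ltnS leq_subr.
rewrite (gpolE _ _ _ _ hl) ss big_distrr /=; apply: eq_bigr => mu _.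
by rewrite mulrA.
Qed.

Lemma gpol_unsorted x xs la : ~~ sorted geq la -> gpol q (x :: xs) A la = 0.
Proof.
move=> ns; rewrite /gpol /= -/gpol big_seq big1 // => mu.
rewrite mem_box => /andP[/eqP sm _].
have sm' : (size mu <= size la)%N by rewrite sm.
rewrite gstep_out ?mul0r //; apply: contra ns => il.
by have [] := interlace_sorted sm' il.
Qed.

(** Summation by parts: fusion turns the dilation into the removal of a strip from la, the
    reindexing puts the strip back on the side of F, and Pieri evaluates the sum over all strips.
    The reindexed sum misses the strips that leave the box, hence the subtracted term. *)
Lemma cauchy_sum_dilate x xs ks M n : size ks = n ->
  (\prod_(c < n) (1 - A c * x)) *
     (\sum_(la <- box M n) gpol q (q * x :: xs) A la * fpol q ks A la) =
  (\prod_(k <- ks) (1 - k * x)) *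
     (\sum_(la <- box M n) gpol q (x :: xs) A la * fpol q ks A la) -
  \sum_(la <- box M n) \sum_(h <- box 2 n | ~~ all (fun y => y < M)%N (seqD la h))
     estep q x A la h * gpol q (x :: xs) A la * fpol q ks A (seqD la h).
Proof.
move=> sk; apply/eqP; rewrite -subr_eq opprK eq_sym; apply/eqP.
rewrite [X in _ = X + _](_ : _ = \sum_(la <- box M n) \sum_(h <- box 2 n |
   all (fun y => y < M)%N (seqD la h))
     estep q x A la h * gpol q (x :: xs) A la * fpol q ks A (seqD la h)); last first.
  rewrite -(reindex_box_sub M n (fun r k la => estep q x A r k * gpol q (x :: xs) A r
     * fpol q ks A la)) big_distrr /=.
  apply: eq_big_seq => la; rewrite mem_box => /andP[/eqP sl _].
  by rewrite mulrA -sl gpol_dilate mulr_suml.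
rewrite -big_split big_distrr /=; apply: eq_big_seq => la.
rewrite mem_box => /andP[/eqP sl _].
rewrite -[RHS](bigID (fun h => all (fun y => y < M)%N (seqD la h)) xpredT) /=.
(* Pieri is available for sorted sequences only; on the others F* is 0. *)
have [srt|ns] := boolP (sorted geq la); last first.
  by rewrite gpol_unsorted // mul0r mulr0 big1 // => h _; rewrite mulr0 mul0r.
rewrite mulrCA -pieri_domain ?sl // mulrC mulr_suml; apply: eq_bigr => h _.
by rewrite mulrAC.
Qed.

End IntegralDomain.

(** * Estimates in an archimedean field *)

Section RealEstimates.
Variable F : archiRealFieldType.
Implicit Types (r x a e : F).

Lemma bernoulli x k : 0 <= x -> 1 + x *+ k <= (1 + x) ^+ k.
Proof.
move=> x0; elim: k => [|k IH]; first by rewrite mulr0n addr0 expr0.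
rewrite exprSr; apply: le_trans (ler_wpM2r _ IH); last by lra.
have : 0 <= x * (x *+ k) by rewrite mulr_ge0 ?mulrn_wge0.
by rewrite mulrSr; nra.
Qed.

Lemma expr_eventually_lt r e : 0 <= r < 1 -> 0 < e ->
  exists k0, forall k, (k0 <= k)%N -> r ^+ k < e.
Proof.
case/andP=> r0 r1 e0; have [->|rn0] := eqVneq r 0.
  by exists 1%N => -[|k] // _; rewrite expr0n.
have rp : 0 < r by rewrite lt_neqAle eq_sym rn0.
pose x := r^-1 - 1; have xp : 0 < x by rewrite subr_gt0 invf_gt1.
pose k0 := Num.bound (e^-1 / x).
have hk0 : e^-1 < x *+ k0.
  have := archi_boundP (_ : 0 <= e^-1 / x); rewrite -/k0 => /(_ _) h.
  rewrite -mulr_natl -ltr_pdivrMr //; apply: h.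
  by rewrite divr_ge0 ?invr_ge0 ?ltW.
exists k0 => k k0k; apply: le_lt_trans (_ : r ^+ k0 < e).
  by rewrite ler_wiXn2l // ltW.
rewrite -[e]invrK -[r]invrK exprVn ltf_pV2 ?posrE ?invr_gt0 ?exprn_gt0 ?invr_gt0 //.
apply: lt_le_trans hk0 _; rewrite (_ : r^-1 = 1 + x); last by rewrite /x; ring.
by apply: le_trans (bernoulli k0 (ltW xp)); rewrite lerDr.
Qed.

Lemma geometric_sum_le r k : 0 <= r < 1 -> \sum_(i < k) r ^+ i <= (1 - r)^-1.
Proof.
case/andP=> r0 r1; have r1' : 0 < 1 - r by lra.
rewrite -(ler_pM2l r1') divff ?gt_eqF // -opprB mulNr -subrX1 opprB.
by have := exprn_ge0 k r0; lra.
Qed.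

(** For a product P whose increments have sum S <= 1/2, the inequality P(1 - S) <= 1 gives P <= 2.
    In general this is applied to the factors from some [i0] on. *)
Lemma prod1D_bounded a r : 0 <= a -> 0 <= r < 1 ->
  exists2 C, 0 <= C & forall k, \prod_(i < k) (1 + a * r ^+ i) <= C.
Proof.
move=> a0 r01; have /andP[r0 r1] := r01; have r1' : 0 < 1 - r by lra.
have small b : 0 <= b -> b / (1 - r) <= 2^-1 -> forall k, \prod_(i < k) (1 + b * r ^+ i) <= 2.
  move=> b0 bs k.
  have H : \prod_(i < k) (1 + b * r ^+ i) * (1 - \sum_(i < k) b * r ^+ i) <= 1 /\
      0 <= \sum_(i < k) b * r ^+ i /\ 0 <= \prod_(i < k) (1 + b * r ^+ i).
    elim: k => [|k [IH [IH0 IH1]]]; first by rewrite !big_ord0; split; [lra|split; lra].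
    rewrite !big_ord_recr /=; have bp : 0 <= b * r ^+ k by rewrite mulr_ge0 ?exprn_ge0.
    set P := \prod_(i < k) _ in IH IH1 *; set S := \sum_(i < k) _ in IH IH0 *.
    have := mulr_ge0 IH1 (mulr_ge0 bp IH0); have := mulr_ge0 IH1 (mulr_ge0 bp bp).
    set c := b * r ^+ k in bp *.
    by split; [nra|split; [lra|apply: mulr_ge0; lra]].
  case: H => H [S0 P0].
  have : \sum_(i < k) b * r ^+ i <= 2^-1.
    apply: le_trans bs; rewrite -mulr_sumr; apply: ler_wpM2l => //.
    exact: geometric_sum_le.
  by move: H S0 P0; set P := \prod_(i < k) _; set S := \sum_(i < k) _; nra.
have [i0 Hi0] : exists i0, a * r ^+ i0 / (1 - r) <= 2^-1.
  have e0 : 0 < (1 - r) / (2 * (1 + a)) by rewrite divr_gt0 //; lra.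
  have [i0 /(_ i0 (leqnn _)) h] := expr_eventually_lt r01 e0; exists i0.
  rewrite ler_pdivrMr //; move: h; rewrite ltr_pdivlMr; last by lra.
  by have := exprn_ge0 i0 r0; nra.
exists (\prod_(i < i0) (1 + a * r ^+ i) * 2).
  rewrite mulr_ge0 // prodr_ge0 // => i _.
  by have := mulr_ge0 a0 (exprn_ge0 i r0); lra.
have pos k : 0 <= \prod_(i < k) (1 + a * r ^+ i).
  by rewrite prodr_ge0 // => i _; have := mulr_ge0 a0 (exprn_ge0 i r0); lra.
move=> k; apply: (@le_trans _ _ (\prod_(i < i0 + k) (1 + a * r ^+ i))).
  rewrite addnC big_split_ord /= ler_peMr ?pos //.
  apply: (big_ind (fun y => 1 <= y)) => // [y z|i _]; first exact: mulr_ege1.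
  by rewrite lerDl mulr_ge0 ?exprn_ge0.
rewrite big_split_ord /= ler_wpM2l ?pos //.
under eq_bigr => i _ do rewrite exprD mulrA.
by apply: small => //; rewrite mulr_ge0 ?exprn_ge0.
Qed.

(** As x < s, all factors from some [i0] on are at most s; each earlier one is at most [D * s]. *)
Lemma prod_geometric_bounded x a r s : 0 <= x < s -> 0 <= a -> 0 <= r < 1 ->
  exists2 C, 0 <= C & forall k, \prod_(i < k) (x + a * r ^+ i) <= C * s ^+ k.
Proof.
case/andP=> x0 xs a0 r01; have /andP[r0 r1] := r01; have s0 : 0 < s by lra.
have [i0 Hi0] : exists i0, forall i, (i0 <= i)%N -> x + a * r ^+ i <= s.
  have e0 : 0 < (s - x) / (1 + a) by rewrite divr_gt0 //; lra.
  have [i0 h] := expr_eventually_lt r01 e0; exists i0 => i /h.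
  rewrite ltr_pdivlMr; last by lra.
  by have := exprn_ge0 i r0; nra.
pose D := (x + a) / s + 1.
have D1 : 1 <= D by rewrite lerDr divr_ge0 //; lra.
have Ds : x + a <= D * s by rewrite /D mulrDl mul1r mulfVK ?gt_eqF //; lra.
exists (D ^+ i0); first by rewrite exprn_ge0 //; lra.
have key k : \prod_(i < k) (x + a * r ^+ i) <= D ^+ minn k i0 * s ^+ k.
  elim: k => [|k IH]; first by rewrite big_ord0 min0n !expr0 mulr1.
  rewrite big_ord_recr /= exprSr.
  have ge0 : 0 <= x + a * r ^+ k by have := mulr_ge0 a0 (exprn_ge0 k r0); lra.
  have [ki|ki] := ltnP k i0.
    have -> : minn k.+1 i0 = (minn k i0).+1 by lia.
    rewrite exprSr mulrACA; apply: ler_pM => //.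
      by rewrite prodr_ge0 // => i _; have := mulr_ge0 a0 (exprn_ge0 i r0); lra.
    apply: le_trans Ds; rewrite lerD2l ler_piMr // exprn_ile1 // ltW //.
  have -> : minn k.+1 i0 = minn k i0 by lia.
  rewrite mulrA; apply: ler_pM => //; last exact: Hi0.
  by rewrite prodr_ge0 // => i _; have := mulr_ge0 a0 (exprn_ge0 i r0); lra.
move=> k; apply: le_trans (key k) _; apply: ler_wpM2r.
  by apply: exprn_ge0; apply: ltW.
by apply: ler_weXn2l => //; apply: geq_minr.
Qed.

Lemma box_geometric_sum r M n : 0 <= r < 1 ->
  \sum_(s <- box M n) r ^+ sumn s <= (1 - r)^-1 ^+ n.
Proof.
move=> r01; have /andP[r0 r1] := r01; elim: n => [|n IH].
  by rewrite big_box0 expr0.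
rewrite big_box_cons /=; under eq_bigr => x _.
  under eq_bigr => s _ do rewrite exprD.
  rewrite -mulr_sumr; over.
rewrite -mulr_suml exprS; apply: ler_pM => //.
- by rewrite sumr_ge0 // => i _; rewrite exprn_ge0.
- by rewrite sumr_ge0 // => i _; rewrite exprn_ge0.
- exact: geometric_sum_le.
Qed.

Lemma sumn_dominated (nu la : seq nat) : all2 leq nu la -> (sumn nu <= sumn la)%N.
Proof.
elim: nu la => [|x nu IH] [|y la] //= /andP[xy /IH h].
exact: leq_add.
Qed.

(** The bound depends on [la] only through its length; this uniformity lets the bounds on F and F*
    pass through a branching step. *)
Lemma box_dominated_sum r M (la : seq nat) : 0 <= r < 1 ->
  \sum_(nu <- box M (size la) | all2 leq nu la) r ^+ (sumn la - sumn nu) <=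
  (1 - r)^-1 ^+ size la.
Proof.
move=> r01; have /andP[r0 r1] := r01; have r1' : 0 < 1 - r by lra.
elim: la => [|l la IH].
  by rewrite big_mkcond big_box0 /= expr0.
rewrite big_mkcond big_box_cons /=.
apply: (@le_trans _ _ (\sum_(x < M) (if (x <= l)%N then r ^+ (l - x) else 0) *
   \sum_(nu <- box M (size la) | all2 leq nu la) r ^+ (sumn la - sumn nu))).
  apply: ler_sum => x _; case: ifP => xl; last by rewrite mul0r big1.
  rewrite mulr_sumr [leRHS]big_mkcond; apply: ler_sum => nu _ /=.
  case: ifP => // /sumn_dominated le; rewrite -exprD.
  by rewrite (_ : (l + sumn la - (x + sumn nu) = l - x + (sumn la - sumn nu))%N) //; lia.
rewrite -mulr_suml exprS; apply: ler_pM => //.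
- by rewrite sumr_ge0 // => i _; case: ifP => // _; rewrite exprn_ge0.
- by rewrite sumr_ge0 // => i _; rewrite exprn_ge0.
apply: le_trans (@geometric_sum_le r l.+1 r01).
rewrite -(big_mkord xpredT (fun y : nat => if (y <= l)%N then r ^+ (l - y) else 0)).
apply: (@le_trans _ _ (\sum_(0 <= y < maxn M l.+1) if (y <= l)%N then r ^+ (l - y) else 0)).
  rewrite [leRHS](big_cat_nat (n := M)) //= ?leq_maxl // lerDl sumr_ge0 // => i _.
  by case: ifP => // _; rewrite exprn_ge0.
rewrite (big_cat_nat (n := l.+1)) //= ?leq_maxr // [X in _ + X]big_nat_cond.
rewrite [X in _ + X]big1 ?addr0 => [|i /andP[/andP[li _] _]]; last by rewrite leqNgt li.
rewrite big_mkord (reindex_inj rev_ord_inj) /=; apply: ler_sum => i _.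
by rewrite subSS leq_subr subKn // -ltnS.
Qed.

End RealEstimates.

(** * Norms and limits *)

Definition norm_cvg (F : archiRealFieldType) (R : comNzRingType) (N : R -> F)
    (u : nat -> R) (l : R) : Prop :=
  forall e, 0 < e -> exists k0, forall k, (k0 <= k)%N -> N (u k - l) < e.

(** The target is an archimedean field because norms are rational for power series and real for
    complex numbers. Completeness is asked only for geometrically small increments, the kind that
    the estimates produce. *)
Record complete_norm (F : archiRealFieldType) (R : comNzRingType) (N : R -> F) : Prop := {
  norm_eq0 : forall x, N x = 0 -> x = 0;
  norm_0 : N 0 = 0;
  norm_1 : N 1 <= 1;
  norm_N : forall x, N (- x) = N x;
  norm_D : forall x y, N (x + y) <= N x + N y;
  norm_M : forall x y, N (x * y) <= N x * N y;
  norm_complete : forall (u : nat -> R) C r, 0 <= r < 1 ->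
    (forall k, N (u k.+1 - u k) <= C * r ^+ k) -> exists l, norm_cvg N u l
}.

Section NormedRing.
Variables (F : archiRealFieldType) (R : comNzRingType) (N : R -> F).
Hypothesis HN : complete_norm N.
Implicit Types (x y l : R) (u v : nat -> R) (e : F).

Lemma norm_ge0 x : 0 <= N x.
Proof.
have := norm_D HN x (- x); rewrite subrr (norm_0 HN) (norm_N HN); lra.
Qed.

Lemma norm_sum (I : Type) (s : seq I) (P : pred I) (f : I -> R) :
  N (\sum_(i <- s | P i) f i) <= \sum_(i <- s | P i) N (f i).
Proof.
elim/big_rec2: _ => [|i y x _ h]; first by rewrite (norm_0 HN).
by apply: le_trans (norm_D HN _ _) _; rewrite lerD2l.
Qed.

Lemma norm_prod (I : Type) (s : seq I) (f : I -> R) :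
  N (\prod_(i <- s) f i) <= \prod_(i <- s) N (f i).
Proof.
elim/big_rec2: _ => [|i y x _ h]; first exact: norm_1 HN.
by apply: le_trans (norm_M HN _ _) _; rewrite ler_wpM2l ?norm_ge0.
Qed.

Lemma norm_exp x k : N (x ^+ k) <= N x ^+ k.
Proof.
elim: k => [|k IH]; first by rewrite !expr0 (norm_1 HN).
by rewrite !exprS; apply: le_trans (norm_M HN _ _) _; rewrite ler_wpM2l ?norm_ge0.
Qed.

Lemma norm_distC x y : N (x - y) = N (y - x).
Proof. by rewrite -(norm_N HN) opprB. Qed.

Lemma norm_cvg_unique u l l' : norm_cvg N u l -> norm_cvg N u l' -> l = l'.
Proof.
move=> ul ul'; apply/eqP; rewrite -subr_eq0; apply/eqP/(norm_eq0 HN).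
apply/eqP; rewrite eq_le norm_ge0 andbT leNgt; apply/negP => d0.
have d2 : 0 < N (l - l') / 2 by lra.
have [k1 /(_ (maxn k1 _) (leq_maxl _ _)) h1] := ul _ d2.
have [k2 h2] := ul' _ d2.
have {}h1 := h1 k2; have {}h2 := h2 (maxn k1 k2) (leq_maxr _ _).
have := norm_D HN (l - u (maxn k1 k2)) (u (maxn k1 k2) - l').
rewrite addrA subrK norm_distC; lra.
Qed.

Lemma norm_cvg_ext u v l : (forall k, u k = v k) -> norm_cvg N u l -> norm_cvg N v l.
Proof. by move=> uv ul e /ul [k0 h]; exists k0 => k; rewrite -uv; apply: h. Qed.

Lemma norm_cvg_cst l : norm_cvg N (fun=> l) l.
Proof. by move=> e e0; exists 0%N => k _; rewrite subrr (norm_0 HN). Qed.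

Lemma norm_cvgD u v l l' : norm_cvg N u l -> norm_cvg N v l' ->
  norm_cvg N (fun k => u k + v k) (l + l').
Proof.
move=> ul vl e e0; have e2 : 0 < e / 2 by lra.
have [k1 h1] := ul _ e2; have [k2 h2] := vl _ e2.
exists (maxn k1 k2) => k; rewrite geq_max => /andP[/h1 {}h1 /h2 {}h2].
rewrite opprD addrACA; have := norm_D HN (u k - l) (v k - l'); lra.
Qed.

Lemma norm_cvgN u l : norm_cvg N u l -> norm_cvg N (fun k => - u k) (- l).
Proof.
by move=> ul e /ul [k0 h]; exists k0 => k /h; rewrite -opprD (norm_N HN).
Qed.

Lemma norm_cvgM u v l l' : norm_cvg N u l -> norm_cvg N v l' ->
  norm_cvg N (fun k => u k * v k) (l * l').
Proof.
move=> ul vl e e0.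
have B0 := norm_ge0 l; have B0' := norm_ge0 l'.
pose d := Num.min 1 (e / (2 + N l + N l')).
have d0 : 0 < d by rewrite lt_min ltr01 divr_gt0 //; lra.
have d1 : d <= 1 by rewrite ge_min lexx.
have dE : d * (2 + N l + N l') <= e.
  by rewrite -ler_pdivlMr ?ge_min ?lexx ?orbT //; lra.
have [k1 h1] := ul _ d0; have [k2 h2] := vl _ d0.
exists (maxn k1 k2) => k; rewrite geq_max => /andP[/h1 {}h1 /h2 {}h2].
have -> : u k * v k - l * l' = (u k - l) * (v k - l') + (l * (v k - l') + (u k - l) * l') by ring.
have m1 := norm_M HN (u k - l) (v k - l').
have m2 := norm_M HN l (v k - l'); have m3 := norm_M HN (u k - l) l'.
have a1 := norm_D HN ((u k - l) * (v k - l')) (l * (v k - l') + (u k - l) * l').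
have a2 := norm_D HN (l * (v k - l')) ((u k - l) * l').
have g1 := norm_ge0 (u k - l); have g2 := norm_ge0 (v k - l').
have p1 : N (u k - l) * N (v k - l') <= d * 1 by apply: ler_pM; lra.
have p2 : N l * N (v k - l') <= N l * d by apply: ler_wpM2l; lra.
have p3 : N (u k - l) * N l' <= d * N l' by apply: ler_wpM2r; lra.
lra.
Qed.

Lemma norm_cvg_sum (I : Type) (s : seq I) (P : pred I) (f : I -> nat -> R) (l : I -> R) :
    (forall i, norm_cvg N (f i) (l i)) ->
  norm_cvg N (fun k => \sum_(i <- s | P i) f i k) (\sum_(i <- s | P i) l i).
Proof.
move=> h; elim: s => [|i s IH].
  by rewrite big_nil; apply: norm_cvg_ext (norm_cvg_cst 0) => k; rewrite big_nil.
rewrite big_cons; case: ifP => Pi.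
  by apply: norm_cvg_ext (norm_cvgD (h i) IH) => k; rewrite big_cons Pi.
by apply: norm_cvg_ext IH => k; rewrite big_cons Pi.
Qed.

Lemma norm_cvg_prod (I : Type) (s : seq I) (f : I -> nat -> R) (l : I -> R) :
    (forall i, norm_cvg N (f i) (l i)) ->
  norm_cvg N (fun k => \prod_(i <- s) f i k) (\prod_(i <- s) l i).
Proof.
move=> h; elim: s => [|i s IH].
  by rewrite big_nil; apply: norm_cvg_ext (norm_cvg_cst 1) => k; rewrite big_nil.
by rewrite big_cons; apply: norm_cvg_ext (norm_cvgM (h i) IH) => k; rewrite big_cons.
Qed.

Lemma norm_cvg_geometric u l C r : 0 <= r < 1 ->
  (forall k, N (u k - l) <= C * r ^+ k) -> norm_cvg N u l.
Proof.
move=> r01 h e e0; have C0 : 0 <= C.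
  by have := h 0%N; rewrite expr0 mulr1; apply: le_trans (norm_ge0 _).
have e1 : 0 < e / (C + 1) by rewrite divr_gt0 //; lra.
have [k0 h0] := expr_eventually_lt r01 e1; exists k0 => k /h0.
rewrite ltr_pdivlMr; last by lra.
have /andP[r0 _] := r01; have := exprn_ge0 k r0; have := h k; nra.
Qed.

Lemma norm_cvg_bound u l a B k0 : norm_cvg N u l ->
  (forall k, (k0 <= k)%N -> N (u k - a) <= B) -> N (l - a) <= B.
Proof.
move=> ul ub; rewrite leNgt; apply/negP => lt.
have d0 : 0 < N (l - a) - B by lra.
have [k1 h1] := ul _ d0.
have {}h1 := h1 (maxn k0 k1) (leq_maxr _ _).
have {}ub := ub (maxn k0 k1) (leq_maxl _ _).
have := norm_D HN (l - u (maxn k0 k1)) (u (maxn k0 k1) - a).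
rewrite addrA subrK norm_distC; lra.
Qed.

End NormedRing.

(** * Bounds on the branching weights and on F, F* *)

Lemma interlace_dominated la nu : (size nu <= size la)%N -> interlace la nu ->
  all2 leq nu (take (size nu) la).
Proof.
elim: la nu => [|l la IH] [|x nu] //= sz /andP[/andP[_ ->] il] /=.
exact: IH.
Qed.

Lemma sumn_take_le m la : (sumn (take m la) <= sumn la)%N.
Proof. by elim: la m => [|l la IH] [|m] //=; rewrite leq_add2l. Qed.

Lemma interlace_sumn la nu : (size nu <= size la)%N -> interlace la nu ->
  (sumn nu <= sumn la)%N.
Proof.
move=> sz /(interlace_dominated sz) /sumn_dominated h.
exact: leq_trans h (sumn_take_le _ _).
Qed.

Section Bounds.
Variables (F : archiRealFieldType) (R : idomainType) (N : R -> F).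
Hypothesis HN : complete_norm N.
Variable q : R.
Hypothesis q_lt1 : N q < 1.
Hypothesis q_unit : forall k, qpoch q q k \is a GRing.unit.
Hypothesis q_inv : exists C, forall k, N (qpoch q q k)^-1 <= C.
Implicit Types (x u b : R) (A : nat -> R) (la mu nu h : seq nat).

Let nge0 := norm_ge0 HN.
Let q01 : 0 <= N q < 1. Proof. by rewrite nge0. Qed.

(** Proved separately in the two applications: it is immediate for power series, where norms are at
    most 1, and an estimate on infinite products for complex numbers. *)
Definition inv_bounded (b : R) := exists C, forall k, N (qpoch q b k)^-1 <= C.

Lemma norm_1B_le x : N (1 - x) <= 1 + N x.
Proof.
apply: le_trans (norm_D HN _ _) _; rewrite (norm_N HN) lerD2r; exact: norm_1 HN.
Qed.

Lemma qpoch_bounded (X : F) : 0 <= X ->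
  exists2 C, 0 <= C & forall x, N x <= X -> forall k, N (qpoch q x k) <= C.
Proof.
move=> X0; have [C C0 hC] := prod1D_bounded X0 q01; exists C => // x xX k.
apply: le_trans (hC k); apply: le_trans (norm_prod HN _ _) _.
apply: ler_prod => i _; rewrite nge0 /=; apply: le_trans (norm_1B_le _) _.
rewrite lerD2l; apply: le_trans (norm_M HN _ _) _.
by apply: ler_pM => //; apply: norm_exp.
Qed.

Lemma qpoch_cvg x : exists l, norm_cvg N (qpoch q x) l.
Proof.
have [B B0 hB] := qpoch_bounded (nge0 x).
apply: (norm_complete HN (C := B * N x) q01) => k.
rewrite qpochS mulrBr mulr1 addrAC subrr add0r (norm_N HN).
apply: le_trans (norm_M HN _ _) _; rewrite -mulrA; apply: ler_pM => //; first exact: hB.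
by apply: le_trans (norm_M HN _ _) _; apply: ler_wpM2l => //; exact: norm_exp.
Qed.

Lemma hpoch_bounded (X B s : F) : 0 <= X < s -> 0 <= B ->
  exists2 C, 0 <= C & forall x b, N x <= X -> N b <= B ->
    forall k, N (hpoch q x b k) <= C * s ^+ k.
Proof.
move=> Xs B0; have [C C0 hC] := prod_geometric_bounded Xs B0 q01.
exists C => // x b xX bB k.
apply: le_trans (hC k); apply: le_trans (norm_prod HN _ _) _.
apply: ler_prod => i _; rewrite nge0 /=; apply: le_trans (norm_D HN _ _) _.
rewrite (norm_N HN); apply: lerD => //; apply: le_trans (norm_M HN _ _) _.
by apply: ler_pM => //; apply: norm_exp.
Qed.

Let ratio_bounded (f g : nat -> R) (C D : F) k : 0 <= C ->
  N (f k) <= C -> N (g k)^-1 <= D -> N (f k / g k) <= C * D.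
Proof. by move=> C0 fC gD; apply: le_trans (norm_M HN _ _) _; apply: ler_pM. Qed.

(** Only [hpoch] is geometric in its length, at any rate [s] above the norm of [x]; the other
    factors are bounded. *)
Lemma fcol_bounded b (X s : F) : 0 <= X < s -> inv_bounded b ->
  exists2 C, 0 <= C & forall x, N x <= X -> forall l0 l1 n0, (l1 <= n0 <= l0)%N ->
    N (fcol q x b l0 l1 n0) <= C * s ^+ (l0 - n0).
Proof.
move=> Xs [Cb hb]; have [Cq hq] := q_inv; have /andP[X0 _] := Xs.
have [C1 C10 h1] := qpoch_bounded (nge0 q); have [C2 C20 h2] := hpoch_bounded Xs (nge0 b).
have [C3 C30 h3] := qpoch_bounded X0.
have Cb0 : 0 <= Cb := le_trans (nge0 _) (hb 0%N).
have Cq0 : 0 <= Cq := le_trans (nge0 _) (hq 0%N).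
exists (C1 * Cb * (C2 * Cq) * (C3 * Cq)); first by rewrite !mulr_ge0.
move=> x xX l0 l1 n0 ok; rewrite /fcol ok.
have -> : C1 * Cb * (C2 * Cq) * (C3 * Cq) * s ^+ (l0 - n0) =
  C1 * Cb * ((C2 * s ^+ (l0 - n0)) * Cq) * (C3 * Cq) by ring.
apply: le_trans (norm_M HN _ _) _; apply: ler_pM => //.
  apply: le_trans (norm_M HN _ _) _; apply: ler_pM => //.
    apply: le_trans (norm_M HN _ _) _; apply: ler_pM => //; exact: h1.
  apply: le_trans (norm_M HN _ _) _; apply: ler_pM => //; exact: h2.
apply: le_trans (norm_M HN _ _) _; apply: ler_pM => //; exact: h3.
Qed.

(** The constant is the same for all [x] in the disc, since later [x] runs through the points chi
    q^k. *)
Lemma gcol_bounded b (X s : F) : 0 <= X < s -> inv_bounded b ->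
  exists2 C, 0 <= C & forall x, N x <= X -> forall l0 l1 m0 m1, (l1 <= m0 <= l0)%N ->
    N (gcol q x b l0 l1 m0 m1) <= C * s ^+ (l0 - m0).
Proof.
move=> Xs [Cb hb]; have [Cq hq] := q_inv; have /andP[X0 _] := Xs.
have [C1 C10 h1] := qpoch_bounded (nge0 q); have [C2 C20 h2] := hpoch_bounded Xs (nge0 1).
have [C3 C30 h3] := qpoch_bounded (mulr_ge0 (nge0 b) X0).
have Cb0 : 0 <= Cb := le_trans (nge0 _) (hb 0%N).
have Cq0 : 0 <= Cq := le_trans (nge0 _) (hq 0%N).
exists (C2 * Cq * (C3 * Cq) * (C1 * Cb)); first by rewrite !mulr_ge0.
move=> x xX l0 l1 m0 m1 ok; rewrite /gcol ok.
have -> : C2 * Cq * (C3 * Cq) * (C1 * Cb) * s ^+ (l0 - m0) =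
  ((C2 * s ^+ (l0 - m0)) * Cq) * (C3 * Cq) * (C1 * Cb) by ring.
apply: le_trans (norm_M HN _ _) _; apply: ler_pM => //.
  apply: le_trans (norm_M HN _ _) _; apply: ler_pM => //.
    apply: le_trans (norm_M HN _ _) _; apply: ler_pM => //; exact: h2.
  apply: le_trans (norm_M HN _ _) _; apply: ler_pM => //; apply: h3.
  by apply: le_trans (norm_M HN _ _) _; rewrite ler_wpM2l.
apply: le_trans (norm_M HN _ _) _; apply: ler_pM => //; exact: h1.
Qed.

Lemma fstep_bounded n A (X s : F) : 0 <= X < s -> (forall c, inv_bounded (A c)) ->
  exists2 C, 0 <= C & forall x, N x <= X -> forall la nu,
    size la = n -> (size nu <= n)%N -> interlace la nu ->
    N (fstep q x A la nu) <= C * s ^+ (sumn la - sumn nu).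
Proof.
move=> Xs; have /andP[X0 Xs'] := Xs; have s0 := le_lt_trans X0 Xs'.
elim: n A => [|n IH] A Ab.
  exists 1 => // x xX [|//] [|//] _ _ _ /=; rewrite expr0 mulr1; exact: norm_1 HN.
have [C1 C10 h1] := fcol_bounded Xs (Ab 0%N).
have [C2 C20 h2] := IH (shift_seq A) (fun c => Ab c.+1).
exists (C1 * C2) => [|x xX [|l la] // nu [sla] snu]; first exact: mulr_ge0.
rewrite [interlace _ _]/=; case/andP=> hd il /=.
have sb : (size (behead nu) <= size la)%N by rewrite size_behead; lia.
have le := interlace_sumn sb il.
have -> : (l + sumn la - sumn nu = l - head 0 nu + (sumn la - sumn (behead nu)))%N.
  by case: (nu) hd le => [|y nu'] /=; lia.
rewrite exprD mulrACA; apply: le_trans (norm_M HN _ _) _; apply: ler_pM => //.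
  exact: h1.
by apply: h2 => //; rewrite -sla.
Qed.

Lemma gstep_bounded n A (X s : F) : 0 <= X < s -> (forall c, inv_bounded (A c)) ->
  exists2 C, 0 <= C & forall x, N x <= X -> forall la nu,
    size la = n -> (size nu <= n)%N -> interlace la nu ->
    N (gstep q x A la nu) <= C * s ^+ (sumn la - sumn nu).
Proof.
move=> Xs; have /andP[X0 Xs'] := Xs; have s0 := le_lt_trans X0 Xs'.
elim: n A => [|n IH] A Ab.
  exists 1 => // x xX [|//] [|//] _ _ _ /=; rewrite expr0 mulr1; exact: norm_1 HN.
have [C1 C10 h1] := gcol_bounded Xs (Ab 0%N).
have [C2 C20 h2] := IH (shift_seq A) (fun c => Ab c.+1).
exists (C1 * C2) => [|x xX [|l la] // nu [sla] snu]; first exact: mulr_ge0.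
rewrite [interlace _ _]/=; case/andP=> hd il /=.
have sb : (size (behead nu) <= size la)%N by rewrite size_behead; lia.
have le := interlace_sumn sb il.
have -> : (l + sumn la - sumn nu = l - head 0 nu + (sumn la - sumn (behead nu)))%N.
  by case: (nu) hd le => [|y nu'] /=; lia.
rewrite exprD mulrACA; apply: le_trans (norm_M HN _ _) _; apply: ler_pM => //.
  exact: h1.
by apply: h2 => //; rewrite -sla.
Qed.

Lemma estep_bounded n A (X : F) : 0 <= X ->
  exists2 C, 0 <= C & forall u, N u <= X -> forall mu h, size mu = n ->
    N (estep q u A mu h) <= C.
Proof.
move=> X0; elim: n A => [|n IH] A.
  exists 1 => // u uX [|//] h _ /=; exact: norm_1 HN.
have [C C0 hC] := IH (shift_seq A).
pose D := (1 + N (A 0%N) * X) + 2 + X * (1 + N (A 0%N)) + (1 + X).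
have AX := mulr_ge0 (nge0 (A 0%N)) X0; have A0 := nge0 (A 0%N).
have D0 : 0 <= D by rewrite /D; nra.
exists (D * C) => [|u uX [|m mu] // h [sm]]; first exact: mulr_ge0.
apply: le_trans (norm_M HN _ _) _; apply: ler_pM => //; last exact: hC.
move: (m - _)%N => d.
have qd : N (q ^+ d) <= 1.
  by apply: le_trans (norm_exp HN _ _) _; apply: exprn_ile1 => //; apply: ltW.
have XA := mulr_ge0 X0 A0.
have bq b : N (b * q ^+ d) <= N b.
  by apply: le_trans (norm_M HN _ _) _; rewrite ler_piMr.
case: (head 0%N h) (head 0%N (behead h)) => [|?] [|?] /=.
- apply: le_trans (norm_1B_le _) _; have := bq (A 0%N * u).
  have := norm_M HN (A 0%N) u; have := ler_wpM2l A0 uX; rewrite /D; lra.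
- apply: le_trans (norm_1B_le _) _; rewrite /D; lra.
- apply: le_trans (norm_M HN _ _) _; rewrite (norm_N HN).
  apply: (@le_trans _ _ (X * (1 + N (A 0%N)))); last by rewrite /D; lra.
  apply: ler_pM => //; apply: le_trans (norm_1B_le _) _; rewrite lerD2l; exact: bq.
apply: le_trans (norm_D HN _ _) _; rewrite (norm_N HN) /D; lra.
Qed.

(** With [s] between the norm of [x] and [r], and [t = s / r], a branching step contributes s^(|la|
    - |nu|) r^|nu| = r^|la| t^(|la| - |nu|), and the powers of t have a sum over nu that is bounded
    uniformly in la. *)
Lemma fpol_bounded xs A (r : F) : 0 < r -> (forall x, x \in xs -> N x < r) ->
    (forall c, inv_bounded (A c)) ->
  exists2 C, 0 <= C & forall la, size la = size xs ->
    N (fpol q xs A la) <= C * r ^+ sumn la.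
Proof.
move=> r0; elim: xs A => [|x xs IH] A xr Ab.
  exists 1 => // -[|//] _ /=; rewrite /fpol /= mulr1; exact: norm_1 HN.
have xr0 : N x < r by apply: xr; rewrite mem_head.
have [C2 C20 h2] := IH (shift_seq A) (fun y yx => xr y (mem_behead (s := x :: xs) yx)) (fun c => Ab c.+1).
pose s := (N x + r) / 2; have xs_ : N x <= N x < s by rewrite lexx /s; lra.
have xs' : 0 <= N x < s by rewrite nge0 /s; lra.
have [C1 C10 h1] := fstep_bounded (size xs).+1 xs' Ab.
pose t := s / r; have t01 : 0 <= t < 1.
  rewrite divr_ge0 ?ltW //=; last by case/andP: xs' => a b; apply: le_lt_trans a b.
  by rewrite ltr_pdivrMr // mul1r /s; lra.
have t0 : 0 <= t by case/andP: t01. have t1 : t <= 1 by case/andP: t01 => _ /ltW.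
exists (C1 * C2 * (1 - t)^-1 ^+ size xs) => [|la sla].
  by rewrite !mulr_ge0 // exprn_ge0 // invr_ge0; case/andP: t01 => _; lra.
rewrite (fpolE q x A sla (ltnSn _)).
apply: le_trans (norm_sum HN _ _ _) _.
have sE : s = t * r by rewrite /t mulfVK ?gt_eqF.
(* [nu] is one entry shorter than [la] and is compared with the truncation of [la]; this only lowers
   the exponent of [t]. *)
pose la' := take (size xs) la.
have sla' : size la' = size xs by rewrite size_takel // sla.
apply: (@le_trans _ _ (\sum_(nu <- box (head 0 la).+1 (size la') | all2 leq nu la')
   C1 * C2 * r ^+ sumn la * t ^+ (sumn la' - sumn nu))); last first.
  rewrite -mulr_sumr [leRHS]mulrAC; apply: ler_wpM2l.
    by rewrite !mulr_ge0 // exprn_ge0 // ltW.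
  by rewrite -sla'; apply: box_dominated_sum.
rewrite sla' [leRHS]big_mkcond; rewrite big_seq [leRHS]big_seq; apply: ler_sum => nu.
rewrite mem_box => /andP[/eqP snu _].
have sz : (size nu <= size la)%N by rewrite snu sla.
have [il|/(fstep_out q x A sz) ->] := boolP (interlace la nu); last first.
  rewrite mul0r (norm_0 HN); case: ifP => // _.
  by rewrite !mulr_ge0 // exprn_ge0 // ltW.
have := interlace_dominated sz il; rewrite snu -/la' => dom; rewrite dom.
have le := interlace_sumn sz il.
apply: le_trans (norm_M HN _ _) _.
apply: (@le_trans _ _ ((C1 * s ^+ (sumn la - sumn nu)) * (C2 * r ^+ sumn nu))).
  apply: ler_pM => //; first by apply: h1 => //; rewrite snu.
  exact: h2.
rewrite sE exprMn mulrACA -[leRHS]mulrA; apply: ler_wpM2l; first exact: mulr_ge0.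
rewrite -mulrA -exprD subnK // mulrC; apply: ler_wpM2l; first by rewrite exprn_ge0 // ltW.
apply: ler_wiXn2l => //; apply: leq_sub2r; exact: sumn_take_le.
Qed.

(** At x = 1 the factor [hpoch] contains x - 1, so no entry can move; for mu = la the two remaining
    ratios of each column cancel. *)
Lemma gstep_one A la mu : (forall c k, qpoch q (A c) k \is a GRing.unit) ->
    size mu = size la ->
  gstep q 1 A la mu = ((mu == la) && sorted geq la)%:R.
Proof.
elim: la mu A => [|l la IH] [|m mu] A Au //= [sz].
rewrite IH //; last by move=> c; apply: Au.
have [->|nm] := eqVneq mu la; last by rewrite mulr0 eqseq_cons (negbTE nm) andbF.
rewrite eqseq_cons eqxx andbT /=.
have -> : path geq l la = (head 0 la <= l)%N && sorted geq la by case: (la).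
case: (sorted geq la); last by rewrite mulr0 !andbF.
rewrite mulr1 andbT /gcol mulr1.
have h0 k : (0 < k)%N -> hpoch q 1 1 k = 0.
  by case: k => // k _; rewrite /hpoch big_ord_recl expr0 mulr1 subrr mul0r.
have [->|nml] := eqVneq m l; last first.
  case: ifP => // /andP[_ ml]; rewrite h0 ?mul0r //.
  by rewrite subn_gt0 ltn_neqAle nml.
rewrite leqnn andbT /=; case: ifP => // hl.
rewrite subnn hpoch0 qpoch0 divr1 mul1r.
by rewrite -mulrA mulKr ?q_unit // divrr ?Au.
Qed.

Lemma gpol_out xs A la : ~~ sorted geq la -> gpol q xs A la = 0.
Proof.
case: xs => [|x xs] ns; last exact: gpol_unsorted.
rewrite /gpol /=; case: allP => // h; case/negP: ns.
have -> : la = nseq (size la) 0%N by apply/all_pred1P/allP.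
by elim: (size la) => [|[|k]].
Qed.

Lemma gpol_one xs A la : (forall c k, qpoch q (A c) k \is a GRing.unit) ->
  gpol q (1 :: xs) A la = gpol q xs A la.
Proof.
move=> Au; rewrite (gpolE _ _ _ _ (M := (sumn la).+1)); last first.
  by rewrite ltnS -nth0; case: (la) => //= *; rewrite leq_addr.
rewrite big_seq; under eq_bigr => mu.
  rewrite mem_box => /andP[/eqP sm _]; rewrite gstep_one // ; over.
rewrite -big_seq.
have [srt|ns] := boolP (sorted geq la); last first.
  rewrite big1 => [|mu _]; last by rewrite andbF mul0r.
  by rewrite gpol_out.
rewrite (bigD1_seq la) ?box_uniq //=; last first.
  rewrite mem_box eqxx /=; elim: (la) => //= l la' IH; rewrite ltnS leq_addr /=.
  by apply: sub_all IH => y; rewrite !ltnS => h; apply: leq_trans h (leq_addl _ _).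
rewrite eqxx mul1r big1 ?addr0 // => mu /negbTE ->; by rewrite mul0r.
Qed.

(** Kept apart from [gpol_bounded] because the bound has to be uniform over a disc in the first
    variable. *)
Lemma gpol_step_bounded (X C : F) xs A n : 0 <= X < 1 -> 0 <= C ->
    (forall c, inv_bounded (A c)) ->
    (forall la, size la = n -> N (gpol q xs A la) <= C) ->
  exists2 D, 0 <= D & forall x, N x <= X -> forall la, size la = n ->
     N (gpol q (x :: xs) A la) <= D.
Proof.
case/andP=> X0 X1 C0 Ab hC; pose s := (X + 1) / 2.
have Xs : 0 <= X < s by rewrite X0 /s; lra.
have s01 : 0 <= s < 1 by rewrite /s; apply/andP; split; lra.
have [C1 C10 h1] := gstep_bounded n Xs Ab.
have s1 : 0 <= (1 - s)^-1 by rewrite invr_ge0; case/andP: s01 => _; lra.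
exists (C1 * C * (1 - s)^-1 ^+ n) => [|x xX la sla]; first by rewrite !mulr_ge0 ?exprn_ge0.
rewrite (gpolE _ _ _ _ (ltnSn _)); apply: le_trans (norm_sum HN _ _ _) _.
apply: (@le_trans _ _ (\sum_(nu <- box (head 0 la).+1 (size la) | all2 leq nu la)
   C1 * C * s ^+ (sumn la - sumn nu))); last first.
  rewrite -mulr_sumr; apply: ler_wpM2l; first exact: mulr_ge0.
  by rewrite -sla; apply: box_dominated_sum.
rewrite [leRHS]big_mkcond; rewrite big_seq [leRHS]big_seq; apply: ler_sum => nu.
rewrite mem_box => /andP[/eqP snu _].
have sz : (size nu <= size la)%N by rewrite snu.
have [il|/(gstep_out q x A sz) ->] := boolP (interlace la nu); last first.
  rewrite mul0r (norm_0 HN); case: ifP => // _.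
  by rewrite !mulr_ge0 // exprn_ge0 //; case/andP: s01.
have := interlace_dominated sz il; rewrite snu take_size => dom; rewrite dom.
apply: le_trans (norm_M HN _ _) _; rewrite mulrAC; apply: ler_pM => //; last first.
  by apply: hC; rewrite snu.
by apply: h1 => //; rewrite snu sla.
Qed.

Lemma gpol_bounded xs A n : (forall x, x \in xs -> N x < 1) ->
    (forall c, inv_bounded (A c)) ->
  exists2 C, 0 <= C & forall la, size la = n -> N (gpol q xs A la) <= C.
Proof.
move=> + Ab; elim: xs => [|x xs IH] x1.
  exists 1 => // la _; rewrite /gpol /=; case: all => /=; first exact: norm_1 HN.
  by rewrite (norm_0 HN).
have [C C0 hC] := IH (fun y yx => x1 y (mem_behead (s := x :: xs) yx)).
have x01 : 0 <= N x < 1 by rewrite nge0 x1 ?mem_head.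
have [D D0 hD] := gpol_step_bounded x01 C0 Ab hC.
by exists D => // la sla; apply: hD.
Qed.

End Bounds.

(** * Tail and boundary estimates *)

Lemma sumn_ge_unbounded M la : ~~ all (fun j => j < M)%N la -> (M <= sumn la)%N.
Proof.
elim: la => //= l la IH; rewrite negb_and -leqNgt => /orP[h|/IH h].
  exact: leq_trans h (leq_addr _ _).
exact: leq_trans h (leq_addl _ _).
Qed.

Lemma sumn_seqD la h : size h = size la -> sumn (seqD la h) = (sumn la + sumn h)%N.
Proof. by elim: la h => [|l la IH] [|x h] //= [/IH ->]; lia. Qed.

Section Tails.
Variables (F : archiRealFieldType) (R : comNzRingType) (N : R -> F).
Hypothesis HN : complete_norm N.
Variables (n : nat) (C r : F).
Hypotheses (C0 : 0 <= C) (r01 : 0 <= r < 1).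

(** For m >= M the decay r^m is split as t^M s^m: the first factor is the gain from being outside
    the box, the second is still summable over all sequences. *)
Let s := (1 + r) / 2.
Let t := r / s.
Let s01 : 0 <= s < 1. Proof. by case/andP: r01 => ? ?; rewrite /s; apply/andP; split; lra. Qed.
Let s0 : 0 < s. Proof. by case/andP: r01 => ? ?; rewrite /s; lra. Qed.
Let t01 : 0 <= t < 1.
Proof.
case/andP: r01 => r0 r1; rewrite /t ltr_pdivrMr // mul1r divr_ge0 ?(ltW s0) //= /s; lra.
Qed.

Let expr_split M m : (M <= m)%N -> r ^+ m <= t ^+ M * s ^+ m.
Proof.
move=> le; have /andP[t0 t1] := t01; have -> : r = t * s by rewrite /t mulfVK ?gt_eqF.
rewrite exprMn; apply: ler_wpM2r; first by rewrite exprn_ge0 // ltW.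
by apply: ler_wiXn2l => //; apply: ltW.
Qed.

Let D := (1 - s)^-1 ^+ n.
Let D0 : 0 <= D.
Proof. by rewrite exprn_ge0 // invr_ge0; case/andP: s01 => ? ?; lra. Qed.

(** [S] is an arbitrary finite list, as unordered summation requires; it is enclosed in a large box
    whose size does not enter the bound. The constants are chosen before [f], which makes the
    estimate uniform in the variables. *)
Lemma tail_estimate : exists2 Kt : F * F, 0 <= Kt.2 < 1 &
  forall f : seq nat -> R, (forall la, size la = n -> N (f la) <= C * r ^+ sumn la) ->
  forall M (S : seq (seq nat)), uniq S -> all (fun la => size la == n) S ->
    N (\sum_(la <- S | ~~ all (fun j => j < M)%N la) f la) <= Kt.1 * Kt.2 ^+ M.
Proof.
exists (C * D, t) => //= f hf M S uS /allP szS.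
apply: le_trans (norm_sum HN _ _ _) _.
pose M' := (\max_(la <- S) sumn la).+1.
have sub la : la \in S -> la \in box M' n.
  move=> laS; rewrite mem_box szS //=; apply/allP => y yla; rewrite ltnS.
  apply: leq_trans (leq_bigmax_seq _ laS _) => //.
  elim: (la) yla => //= l la' IH; rewrite inE => /orP[/eqP ->|/IH h]; first exact: leq_addr.
  exact: leq_trans h (leq_addl _ _).
have t0 : 0 <= t by case/andP: t01.
apply: (@le_trans _ _ (\sum_(la <- S) C * t ^+ M * s ^+ sumn la)).
  rewrite big_mkcond big_seq [leRHS]big_seq; apply: ler_sum => la laS.
  case: ifP => [/sumn_ge_unbounded le|_]; last first.
    by rewrite !mulr_ge0 ?exprn_ge0 // ltW.
  apply: le_trans (hf _ (eqP (szS _ laS))) _; rewrite -mulrA; apply: ler_wpM2l => //.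
  exact: expr_split.
rewrite -mulr_sumr mulrAC; apply: ler_wpM2r; first by rewrite exprn_ge0.
apply: ler_wpM2l => //; apply: le_trans (box_geometric_sum M' n s01).
have -> : \sum_(la <- S) s ^+ sumn la = \sum_(la <- box M' n | la \in S) s ^+ sumn la.
  rewrite -[RHS]big_filter; apply/perm_big/uniq_perm; rewrite ?filter_uniq ?box_uniq // => la.
  by rewrite mem_filter; apply/esym/andb_idr/sub.
rewrite big_mkcond; apply: ler_sum => la _; case: ifP => // _.
by rewrite exprn_ge0 // ltW.
Qed.

(** A strip that leaves the box forces [sumn (seqD la h)] to be at least [M], so the boundary term
    of [cauchy_sum_dilate] is geometrically small. *)
Lemma boundary_estimate : exists2 Kt : F * F, 0 <= Kt.2 < 1 &
  forall f : seq nat -> seq nat -> R,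
    (forall la h, size la = n -> size h = n -> N (f la h) <= C * r ^+ sumn (seqD la h)) ->
  forall M, N (\sum_(la <- box M n) \sum_(h <- box 2 n | ~~ all (fun j => j < M)%N (seqD la h))
    f la h) <= Kt.1 * Kt.2 ^+ M.
Proof.
exists ((\sum_(h <- box 2 n) C) * D, t) => //= f hf M.
have t0 : 0 <= t by case/andP: t01. have /andP[s0' /ltW s1] := s01.
apply: le_trans (norm_sum HN _ _ _) _.
apply: (@le_trans _ _ (\sum_(la <- box M n) (\sum_(h <- box 2 n) C) * t ^+ M * s ^+ sumn la)).
  rewrite big_seq [leRHS]big_seq; apply: ler_sum => la; rewrite mem_box => /andP[/eqP sla _].
  apply: le_trans (norm_sum HN _ _ _) _; rewrite -mulrA mulr_suml.
  rewrite big_mkcond big_seq [leRHS]big_seq; apply: ler_sum => h; rewrite mem_box => /andP[/eqP sh _].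
  case: ifP => [/sumn_ge_unbounded le|_]; last first.
    by rewrite !mulr_ge0 ?exprn_ge0 // ltW.
  apply: le_trans (hf _ _ sla sh) _; apply: ler_wpM2l => //.
  apply: le_trans (expr_split le) _; apply: ler_wpM2l; first by rewrite exprn_ge0.
  by apply: ler_wiXn2l => //; rewrite sumn_seqD ?sh ?sla // leq_addr.
have S0 : 0 <= \sum_(h <- box 2 n) C by apply: sumr_ge0.
rewrite -mulr_sumr mulrAC; apply: ler_wpM2r; first by rewrite exprn_ge0.
by apply: ler_wpM2l => //; apply: box_geometric_sum.
Qed.

End Tails.

Lemma sum_box_diff (V : zmodType) (f : seq nat -> V) M M' n : (M <= M')%N ->
  \sum_(la <- box M' n) f la - \sum_(la <- box M n) f la =
  \sum_(la <- box M' n | ~~ all (fun j => j < M)%N la) f la.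
Proof.
move=> le; rewrite (bigID (fun la => all (fun j => j < M)%N la)) /=.
rewrite -[X in X + _ - _]big_filter (_ : \sum_(la <- [seq _ <- _ | _]) _ = \sum_(la <- box M n) f la).
  by rewrite addrC addKr.
apply/perm_big/uniq_perm; rewrite ?filter_uniq ?box_uniq // => la.
rewrite mem_filter !mem_box andbC -andbA; congr andb; apply: andb_idl.
by apply: sub_all => y yM; apply: leq_trans le.
Qed.

(** * The functional equation and its iteration *)

Section Cauchy.
Variables (F : archiRealFieldType) (R : idomainType) (N : R -> F).
Hypothesis HN : complete_norm N.
Variables (q : R) (A : nat -> R) (ks : seq R) (pinf : R -> R).
Hypothesis q_lt1 : N q < 1.
Hypothesis q_unit : forall k, qpoch q q k \is a GRing.unit.
Hypothesis A_unit : forall c k, qpoch q (A c) k \is a GRing.unit.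
Hypothesis q_inv : inv_bounded N q q.
Hypothesis A_inv : forall c, inv_bounded N q (A c).
Hypothesis ks_lt1 : forall k, k \in ks -> N k < 1.
Hypothesis pinfP : forall x, norm_cvg N (qpoch q x) (pinf x).
Let n := size ks.
Implicit Types (x y z : R) (xs : seq R) (la mu : seq nat).

Definition cauchy_term xs la := gpol q xs A la * fpol q ks A la.
Definition cauchy_sum xs M := \sum_(la <- box M n) cauchy_term xs la.

Lemma fpol_decay : exists2 r, 0 <= r < 1 &
  exists2 C, 0 <= C & forall la, size la = n -> N (fpol q ks A la) <= C * r ^+ sumn la.
Proof.
have [r [r0 r1 kr]] : exists r, [/\ 0 < r, r < 1 & forall k, k \in ks -> N k < r].
  elim: (ks) ks_lt1 => [|k s IH] h; first by exists 2^-1; split=> //; lra.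
  have [r [r0 r1 hr]] := IH (fun y ys => h y (mem_behead (s := k :: s) ys)).
  have k1 : N k < 1 by apply: h; rewrite mem_head.
  exists (Num.max r ((1 + N k) / 2)); split.
  - by rewrite lt_max r0.
  - by rewrite gt_max r1 /=; lra.
  move=> y; rewrite inE => /orP[/eqP ->|/hr h']; last by rewrite lt_max h'.
  by rewrite lt_max; apply/orP; right; lra.
exists r; first by rewrite ltW.
exact: (fpol_bounded HN q_lt1 q_inv r0 kr A_inv).
Qed.

(* [y] ranges over the points where the series is evaluated: a disc, and the
   point [1], at which the first variable drops out by [gpol_one]. *)
Let dom (X : F) y := N y <= X \/ y = 1.

(** The decay is that of F; the factor F* is bounded by [D'] on the disc and by [D] at the point
    1. *)
Lemma cauchy_term_decay X xs : 0 <= X < 1 -> (forall x, x \in xs -> N x < 1) ->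
  exists2 r, 0 <= r < 1 & exists2 C, 0 <= C & forall y, dom X y ->
    forall la, size la = n -> N (cauchy_term (y :: xs) la) <= C * r ^+ sumn la.
Proof.
move=> X01 xs1; have [r r01 [C C0 hC]] := fpol_decay; exists r => //.
have [D D0 hD] := gpol_bounded HN q_lt1 q_inv n xs1 A_inv.
have [D' D'0 hD'] := gpol_step_bounded HN q_lt1 q_inv X01 D0 A_inv hD.
exists ((D + D') * C) => [|y Yy la sla]; first by rewrite mulr_ge0 // addr_ge0.
rewrite /cauchy_term -mulrA; apply: le_trans (norm_M HN _ _) _.
apply: ler_pM; rewrite ?(norm_ge0 HN) ?hC //; case: Yy => [yX|->].
  by apply: le_trans (hD' _ yX _ sla) _; rewrite lerDr.
by rewrite gpol_one //; apply: le_trans (hD _ sla) _; rewrite lerDl.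
Qed.

(** The rate of convergence does not depend on [y], which allows the limits in [M] and in the
    variable to be exchanged in [cauchy_iterate]. *)
Lemma cauchy_sum_cvg X xs : 0 <= X < 1 -> (forall x, x \in xs -> N x < 1) ->
  exists2 Kt : F * F, 0 <= Kt.2 < 1 & forall y, dom X y -> exists2 Z,
    norm_cvg N (cauchy_sum (y :: xs)) Z &
    forall M, N (Z - cauchy_sum (y :: xs) M) <= Kt.1 * Kt.2 ^+ M.
Proof.
move=> X01 xs1; have [r r01 [C C0 hC]] := cauchy_term_decay X01 xs1.
have [[K t] /= t01 hK] := tail_estimate HN n C0 r01; exists (K, t) => //= y Yy.
have diff M M' : (M <= M')%N ->
    N (cauchy_sum (y :: xs) M' - cauchy_sum (y :: xs) M) <= K * t ^+ M.
  move=> le; rewrite sum_box_diff //; apply: hK (hC y Yy) _ _ (box_uniq _ _) _.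
  by apply/allP => la; rewrite mem_box => /andP[].
have [Z hZ] := norm_complete HN t01 (fun k => diff k k.+1 (leqnSn k)).
by exists Z => // M; apply: (norm_cvg_bound HN hZ (k0 := M)) => M'; apply: diff.
Qed.

Lemma cauchy_dilate X xs y Z Z' : 0 <= X < 1 -> (forall x, x \in xs -> N x < 1) ->
    dom X y -> norm_cvg N (cauchy_sum (y :: xs)) Z ->
    norm_cvg N (cauchy_sum (q * y :: xs)) Z' ->
  (\prod_(c < n) (1 - A c * y)) * Z' = (\prod_(k <- ks) (1 - k * y)) * Z.
Proof.
move=> X01 xs1 Yy hZ hZ'.
have [r r01 [C C0 hC]] := fpol_decay.
have [D D0 hD] := gpol_bounded HN q_lt1 q_inv n xs1 A_inv.
have [D' D'0 hD'] := gpol_step_bounded HN q_lt1 q_inv X01 D0 A_inv hD.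
have [D2 D20 hD2] := estep_bounded HN q_lt1 n A (ler01 : 0 <= 1 :> F).
have CC : 0 <= D2 * (D + D') * C by rewrite !mulr_ge0 // addr_ge0.
have [[K t] /= t01 hK] := boundary_estimate HN n CC r01.
have y1 : N y <= 1.
  case: Yy => [yX|->]; last exact: norm_1 HN.
  by apply: le_trans yX _; apply: ltW; case/andP: X01.
have err : norm_cvg N (fun M => \sum_(la <- box M n)
    \sum_(h <- box 2 n | ~~ all (fun j => j < M)%N (seqD la h))
     estep q y A la h * gpol q (y :: xs) A la * fpol q ks A (seqD la h)) 0.
  apply: (norm_cvg_geometric HN t01 (C := K)) => M; rewrite subr0.
  apply: hK => la h sla sh; apply: le_trans (norm_M HN _ _) _.
  rewrite -[leRHS]mulrA; apply: ler_pM; rewrite ?(norm_ge0 HN) //; last first.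
    by apply: hC; rewrite size_seqD sla sh minnn.
  apply: le_trans (norm_M HN _ _) _; apply: ler_pM; rewrite ?(norm_ge0 HN) //; first exact: hD2.
  case: Yy => [yX|->].
    by apply: le_trans (hD' _ yX _ sla) _; rewrite lerDr.
  by rewrite gpol_one //; apply: le_trans (hD _ sla) _; rewrite lerDl.
apply: (norm_cvg_unique HN (u := fun M => (\prod_(c < n) (1 - A c * y)) * cauchy_sum (q * y :: xs) M)).
  exact: norm_cvgM (norm_cvg_cst HN _) hZ'.
rewrite -[X in norm_cvg _ _ X]subr0.
apply: norm_cvg_ext (norm_cvgD HN (norm_cvgM HN (norm_cvg_cst HN _) hZ) (norm_cvgN HN err)) => M.
by rewrite /cauchy_sum /cauchy_term (cauchy_sum_dilate q_unit A_unit).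
Qed.

Lemma gpol_cvg (u : nat -> R) y xs la : norm_cvg N u y ->
  norm_cvg N (fun k => gpol q (u k :: xs) A la) (gpol q (y :: xs) A la).
Proof.
move=> uy; rewrite (gpolE _ _ _ _ (ltnSn _)).
apply: (norm_cvg_ext (u := fun k => \sum_(mu <- box (head 0 la).+1 (size la))
    gstep q (u k) A la mu * gpol q xs A mu)) => [k|].
  by rewrite (gpolE _ _ _ _ (ltnSn _)).
apply: (norm_cvg_sum HN) => mu; apply: (norm_cvgM HN) (norm_cvg_cst HN _).
elim: la mu A => [|l la IH] mu B /=; first exact: norm_cvg_cst.
apply: (norm_cvgM HN) (IH _ _); rewrite /gcol; case: ifP => _; last exact: norm_cvg_cst.
apply: (norm_cvgM HN) (norm_cvg_cst HN _); apply: (norm_cvgM HN).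
  apply: (norm_cvgM HN) (norm_cvg_cst HN _); apply: (norm_cvg_prod HN) => i.
  exact: (norm_cvgD HN) uy (norm_cvg_cst HN _).
apply: (norm_cvgM HN) (norm_cvg_cst HN _); apply: (norm_cvg_prod HN) => i.
apply: (norm_cvgD HN) (norm_cvg_cst HN _) _; apply: (norm_cvgN HN).
apply: (norm_cvgM HN) (norm_cvg_cst HN _).
exact: (norm_cvgM HN) (norm_cvg_cst HN _) uy.
Qed.

(** After k dilations both sides carry finite q-Pochhammer symbols and the variable is y q^k, which
    tends to 0. The identity stays free of quotients, so no infinite product has to be
    invertible. *)
Lemma cauchy_iterate X xs y Z Z0 : 0 <= X < 1 -> N q <= X ->
    (forall x, x \in xs -> N x < 1) -> dom X y ->
    norm_cvg N (cauchy_sum (y :: xs)) Z -> norm_cvg N (cauchy_sum (0 :: xs)) Z0 ->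
  (\prod_(c < n) pinf (A c * y)) * Z0 = (\prod_(k <- ks) pinf (k * y)) * Z.
Proof.
move=> X01 qX xs1 Yy hZ hZ0.
have [[K t] /= t01 hK] := cauchy_sum_cvg X01 xs1.
have q0 := norm_ge0 HN q; have [X0 X1] := andP X01.
(* For [y = 1] the first dilation already enters the disc, since [N q <= X]. *)
have yq k : dom X (y * q ^+ k).
  case: k => [|k]; first by rewrite expr0 mulr1.
  left; apply: le_trans (norm_M HN _ _) _; apply: (@le_trans _ _ (1 * X)); last by rewrite mul1r.
  apply: ler_pM; rewrite ?(norm_ge0 HN) //.
    by case: Yy => [yX|->]; [apply: le_trans yX (ltW X1)|exact: norm_1 HN].
  apply: le_trans (norm_exp HN _ _) _; rewrite exprS; apply: le_trans qX.
  by rewrite ler_piMr // exprn_ile1 // ltW.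
have /choice[Zs hZs] k : exists z, norm_cvg N (cauchy_sum (y * q ^+ k :: xs)) z /\
    forall M, N (z - cauchy_sum (y * q ^+ k :: xs) M) <= K * t ^+ M.
  by have [z ? ?] := hK _ (yq k); exists z.
have fe k : (\prod_(c < n) qpoch q (A c * y) k) * Zs k = (\prod_(x <- ks) qpoch q (x * y) k) * Z.
  elim: k => [|k IH].
    rewrite !big1 => [|x _|c _]; rewrite ?qpoch0 // !mul1r.
    apply: (norm_cvg_unique HN (u := cauchy_sum (y :: xs))) => //.
    by have [] := hZs 0%N; rewrite expr0 mulr1.
  have -> : \prod_(c < n) qpoch q (A c * y) k.+1 =
      (\prod_(c < n) qpoch q (A c * y) k) * \prod_(c < n) (1 - A c * (y * q ^+ k)).
    by rewrite -big_split; apply: eq_bigr => c _; rewrite qpochS mulrA.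
  have -> : \prod_(x <- ks) qpoch q (x * y) k.+1 =
      (\prod_(x <- ks) qpoch q (x * y) k) * \prod_(x <- ks) (1 - x * (y * q ^+ k)).
    by rewrite -big_split; apply: eq_bigr => c _; rewrite qpochS mulrA.
  have := cauchy_dilate X01 xs1 (yq k) (hZs k).1.
  rewrite mulrCA -exprS => /(_ _ (hZs k.+1).1) h.
  by rewrite -mulrA h mulrCA IH mulrCA mulrA.
have q01 : 0 <= N q < 1 by rewrite q0.
have yq0 : norm_cvg N (fun k => y * q ^+ k) 0.
  apply: (norm_cvg_geometric HN q01 (C := N y)) => k; rewrite subr0.
  apply: le_trans (norm_M HN _ _) _; apply: ler_wpM2l; first exact: norm_ge0.
  exact: norm_exp.
(* An argument with three error terms: the tails outside a box are small uniformly in k, and the sum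
   over the box is finite and continuous in the variable. *)
have Zs0 : norm_cvg N Zs Z0.
  have d0 : dom X 0 by left; rewrite (norm_0 HN).
  have [z hz hzM] := hK 0 d0; have {hz}zZ0 := norm_cvg_unique HN hz hZ0; subst z.
  move=> e e0; have K0 : 0 <= K.
    by have := hzM 0%N; rewrite expr0 mulr1; apply: le_trans (norm_ge0 HN _).
  have e3 : 0 < e / 3 / (K + 1) by rewrite !divr_gt0 //; lra.
  have [M /(_ M (leqnn M)) hM] := expr_eventually_lt t01 e3.
  have KM : K * t ^+ M < e / 3.
    move: hM; rewrite ltr_pdivlMr; last by lra.
    by have /andP[t0 _] := t01; have := exprn_ge0 M t0; nra.
  have cM : norm_cvg N (fun k => cauchy_sum (y * q ^+ k :: xs) M) (cauchy_sum (0 :: xs) M).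
    apply: (norm_cvg_sum HN) => la; apply: (norm_cvgM HN) (norm_cvg_cst HN _).
    exact: gpol_cvg yq0.
  have e4 : 0 < e / 3 by lra.
  have [k0 hk0] := cM _ e4; exists k0 => k /hk0 h.
  have h1 := (hZs k).2 M; have h2 := hzM M; rewrite (norm_distC HN) in h2.
  set a := cauchy_sum (y * q ^+ k :: xs) M in h h1; set b := cauchy_sum (0 :: xs) M in h h2.
  have -> : Zs k - Z0 = (Zs k - a) + ((a - b) + (b - Z0)) by ring.
  have := norm_D HN (Zs k - a) ((a - b) + (b - Z0)); have := norm_D HN (a - b) (b - Z0).
  lra.
apply: (norm_cvg_unique HN (u := fun k => (\prod_(c < n) qpoch q (A c * y) k) * Zs k)).
  by apply: (norm_cvgM HN) Zs0; apply: (norm_cvg_prod HN) => c; apply: pinfP.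
apply: (norm_cvg_ext (fun k => esym (fe k))); apply: (norm_cvgM HN) (norm_cvg_cst HN _).
by apply: (norm_cvg_prod HN) => c; apply: pinfP.
Qed.

Lemma fpol_zero : fpol q ks A (nseq n 0%N) = 1.
Proof.
rewrite /n; elim: (ks) (A) A_unit => [|k s IH] B Bu /=; first by rewrite /fpol.
have b1 : box 1 (size s) = [:: nseq (size s) 0%N].
  elim: (size s) => // m IHm.
  have -> : box 1 m.+1 = [seq l :: t | l <- [:: 0%N], t <- box 1 m] by [].
  by rewrite IHm.
rewrite (@fpolE _ _ _ _ _ _ 1) /= ?size_nseq // b1 big_seq1 IH ?mulr1; last by move=> c; apply: Bu.
elim: {IH b1} s B Bu => [|k' s IH] B Bu /=.
  by rewrite mulr1 /fcol /= !subnn hpoch0 !qpoch0 !divr1 !mulr1.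
rewrite IH; last by move=> c; apply: Bu.
by rewrite mulr1 /fcol /= !subnn hpoch0 !qpoch0 !divr1 !mulr1.
Qed.

(** Iteration from x and from 1 leads to the same value at 0, and at 1 the sum is the one for [xs].
    The value at 0 is eliminated by multiplications alone. *)
Theorem cauchy_normed xs : (forall x, x \in xs -> N x < 1) ->
  exists2 Z, norm_cvg N (cauchy_sum xs) Z &
    Z * \prod_(i < n) \prod_(x <- xs) (pinf (A i) * pinf (nth 0 ks i * x)) =
    \prod_(i < n) \prod_(x <- xs) (pinf (nth 0 ks i) * pinf (A i * x)).
Proof.
elim: xs => [|x xs IH] xs1.
  (* Without variables F* is supported on the zero sequence, where F equals 1. *)
  exists 1; last first.
    by rewrite mul1r; apply: eq_bigr => i _; rewrite !big_nil.
  move=> e e0; exists 1%N => M M1; suff -> : cauchy_sum [::] M = 1 by rewrite subrr (norm_0 HN).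
  rewrite /cauchy_sum (bigD1_seq (nseq n 0%N)) ?box_uniq //=; last first.
    by rewrite mem_box size_nseq eqxx all_nseq M1 orbT.
  rewrite /cauchy_term fpol_zero /gpol /= all_pred1_nseq ?eqxx ?orbT mulr1.
  rewrite big_seq_cond big1 ?addr0 // => la; rewrite mem_box => /andP[/andP[/eqP sla _] ne].
  have [/all_pred1P h|] := boolP (all (pred1 0%N) la); last by rewrite mul0r.
  by case/eqP: ne; rewrite h sla.
have xs1' y : y \in xs -> N y < 1 by move=> yx; apply: xs1; rewrite inE yx orbT.
have [Z' hZ' E'] := IH xs1'; have x1 : N x < 1 by apply: xs1; rewrite mem_head.
pose X := Num.max (N x) (N q).
have X01 : 0 <= X < 1 by rewrite le_max norm_ge0 // gt_max x1 q_lt1.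
have xX : N x <= X by rewrite le_max lexx. have qX : N q <= X by rewrite le_max lexx orbT.
have [Kt t01 hK] := cauchy_sum_cvg X01 xs1'.
have [Z hZ _] := hK x (or_introl xX).
have d0 : dom X 0 by left; rewrite (norm_0 HN); case/andP: X01.
have [Z0 hZ0 _] := hK 0 d0; exists Z => //.
have hZ1 : norm_cvg N (cauchy_sum (1 :: xs)) Z'.
  apply: norm_cvg_ext hZ' => M; apply: eq_bigr => la _.
  by rewrite /cauchy_term gpol_one.
have ex := cauchy_iterate X01 qX xs1' (or_introl xX) hZ hZ0.
have e1 : (\prod_(c < n) pinf (A c)) * Z0 = (\prod_(i < n) pinf (nth 0 ks i)) * Z'.
  have h := cauchy_iterate X01 qX xs1' (or_intror erefl) hZ1 hZ0.
  rewrite (eq_bigr (fun c : 'I_n => pinf (A c * 1))) => [|c _]; last by rewrite mulr1.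
  by rewrite h (big_nth 0) big_mkord; congr (_ * _); apply: eq_bigr => i _; rewrite mulr1.
rewrite (big_nth 0) big_mkord -/n in ex.
rewrite (eq_bigr _ (fun i _ => big_cons _ _ _ _ _ _)) /=.
rewrite [RHS](eq_bigr _ (fun i _ => big_cons _ _ _ _ _ _)) /=.
rewrite !big_split /=.
move: E' e1 ex; set a := \prod_(i < n) pinf (A i); set b := \prod_(i < n) pinf (nth 0 ks i).
set c := \prod_(i < n) pinf (A i * x); set d := \prod_(i < n) pinf (nth 0 ks i * x).
set P := \prod_(i < n) \prod_(y <- xs) _; set Q := \prod_(i < n) \prod_(y <- xs) _.
move=> E2 e1' ex'.
have -> : Z * (a * d * P) = a * P * (d * Z) by ring.
rewrite -ex' -E2; have -> : a * P * (c * Z0) = c * P * (a * Z0) by ring.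
by rewrite e1'; ring.
Qed.

(** Unsorted sequences contribute 0, so the sum over [S] differs from a box sum by a tail only. One
    [K] pays for this tail, the other for the distance from the box sum to the limit. *)
Theorem cauchy_summation xs : (forall x, x \in xs -> N x < 1) ->
  exists2 Z, exists2 Kt : F * F, 0 <= Kt.2 < 1 &
    forall M S, uniq S -> all (fun la => size la == n) S ->
      (forall la, la \in box M n -> sorted geq la -> la \in S) ->
      N (\sum_(la <- S) cauchy_term xs la - Z) <= Kt.1 * Kt.2 ^+ M &
    Z * \prod_(i < n) \prod_(x <- xs) (pinf (A i) * pinf (nth 0 ks i * x)) =
    \prod_(i < n) \prod_(x <- xs) (pinf (nth 0 ks i) * pinf (A i * x)).
Proof.
move=> xs1; have [Z hZ EZ] := cauchy_normed xs1; exists Z => //.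
have [r r01 [C C0 hC]] := fpol_decay.
have [D D0 hD] := gpol_bounded HN q_lt1 q_inv n xs1 A_inv.
have hT la : size la = n -> N (cauchy_term xs la) <= D * C * r ^+ sumn la.
  move=> sla; apply: le_trans (norm_M HN _ _) _; rewrite -mulrA.
  by apply: ler_pM; rewrite ?(norm_ge0 HN) ?hC ?hD.
have [[K t] /= t01 hK] := tail_estimate HN n (mulr_ge0 D0 C0) r01.
exists (K + K, t) => //= M S uS szS subS.
have hM : N (Z - cauchy_sum xs M) <= K * t ^+ M.
  apply: (norm_cvg_bound HN hZ (k0 := M)) => M' le.
  rewrite sum_box_diff //; apply: hK hT _ _ (box_uniq _ _) _.
  by apply/allP => la; rewrite mem_box => /andP[].
rewrite (bigID (fun la => all (fun j => j < M)%N la)) /=.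
rewrite [X in X + _ - _](_ : _ = cauchy_sum xs M); last first.
  rewrite /cauchy_sum (bigID (sorted geq)) [RHS](bigID (sorted geq)) /=.
  rewrite [X in _ + X]big1 ?[X in _ = _ + X]big1 ?addr0; last first.
  - by move=> la /andP[_ ns]; rewrite /cauchy_term gpol_out ?mul0r.
  - by move=> la ns; rewrite /cauchy_term gpol_out ?mul0r.
  rewrite -big_filter -[RHS]big_filter.
  apply/perm_big/uniq_perm; rewrite ?filter_uniq ?box_uniq // => la.
  rewrite !mem_filter; apply/andP/andP => [[/andP[aM srt] laS]|[srt lab]].
    by split=> //; rewrite mem_box aM andbT; exact: (allP szS).
  split; last exact: subS lab srt.
  by rewrite srt andbT; move: lab; rewrite mem_box => /andP[].
rewrite addrAC mulrDl; apply: le_trans (norm_D HN _ _) _; apply: lerD.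
  by rewrite (norm_distC HN).
exact: hK hT _ _ uS szS.
Qed.
End Cauchy.

(** * The order norm on power series *)

Section PowerSeriesNorm.
Import mpoly.
Variables (n : nat) (K : fieldType).
Local Notation fps := (fps n K).
Implicit Types (f g : fps) (m : 'X_{1..n}) (d : nat).

Definition order_ge d f : Prop := forall m, (mdeg m < d)%N -> fps_coef f m = 0.

Lemma fps_coef0 m : fps_coef (0 : fps) m = 0.
Proof. by rewrite /= if_same. Qed.

Lemma fps_neq0_order f : f != 0 -> exists d, ~~ `[< order_ge d f >].
Proof.
move=> f0; apply/not_existsP => h; case/eqP: f0; apply/fpsP => m; rewrite fps_coef0.
by have /negP := h (mdeg m).+1; rewrite negbK => /asboolP; apply.
Qed.

(* [ex_minn] returns the least [d] such that the order of [f] is below [d], which is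
   the order of [f] plus one. *)
Definition fps_norm f : rat :=
  if @idP (f != 0) is ReflectT f0 then 2^-1 ^+ (ex_minn (fps_neq0_order f0)).-1 else 0.

Lemma order_ge_le d d' f : (d <= d')%N -> order_ge d' f -> order_ge d f.
Proof. by move=> le h m md; apply: h; apply: leq_trans le. Qed.

Lemma fps_norm_le d f : (fps_norm f <= 2^-1 ^+ d) <-> order_ge d f.
Proof.
rewrite /fps_norm; case: {-}_ / idP => [f0|]; last first.
  move/negP; rewrite negbK => /eqP ->; split=> [_ m _|_]; first exact: fps_coef0.
  by rewrite exprn_ge0.
case: ex_minnP => -[|o] /asboolPn no min; first by case: no.
rewrite /= ler_iXn2l //; split=> [le|lo].
  apply: order_ge_le le _; apply/asboolP; rewrite -[asbool _]negbK; apply/negP => /min.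
  by rewrite ltnn.
by rewrite leqNgt; apply/negP => lt; apply: no; apply: order_ge_le lo.
Qed.

Lemma fps_norm_expE f : f != 0 -> exists d, fps_norm f = 2^-1 ^+ d.
Proof.
by move=> f0; rewrite /fps_norm; case: {-}_ / idP => [f0'|] //; eexists.
Qed.

Lemma fps_norm0 : fps_norm 0 = 0.
Proof.
rewrite /fps_norm; case: {-}_ / idP => // h; by have := h; rewrite eqxx.
Qed.

Lemma fps_norm_ge0 f : 0 <= fps_norm f.
Proof.
have [->|/fps_norm_expE[d ->]] := eqVneq f 0; first by rewrite fps_norm0.
by rewrite exprn_ge0.
Qed.

Lemma fps_norm_mono f g : (forall d, order_ge d g -> order_ge d f) -> fps_norm f <= fps_norm g.
Proof.
move=> h; have [g0|/fps_norm_expE[d gd]] := eqVneq g 0.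
  suff -> : f = 0 by rewrite fps_norm0 fps_norm_ge0.
  apply/fpsP => m; rewrite fps_coef0; apply: (h (mdeg m).+1) (ltnSn _) => k _.
  by rewrite g0 fps_coef0.
by rewrite gd; apply/fps_norm_le/h/fps_norm_le; rewrite gd.
Qed.

Lemma fps_norm_le1 f : fps_norm f <= 1.
Proof. by rewrite -(expr0 2^-1); apply/fps_norm_le. Qed.

Lemma fps_coefD f g m : fps_coef (f + g) m = fps_coef f m + fps_coef g m.
Proof. by []. Qed.

Lemma fps_coefN f m : fps_coef (- f) m = - fps_coef f m.
Proof. by []. Qed.

Lemma order_ge_mul d d' f g : order_ge d f -> order_ge d' g -> order_ge (d + d') (f * g).
Proof.
move=> lf lg m md; apply: big1 => k km; have := congr1 (@mdeg n) (submK km).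
rewrite mdegD => e; have [kd|dk] := ltnP (mdeg k) d; first by rewrite lf ?mul0r.
rewrite (lg (m - k)%MM) ?mulr0 //; move: md dk e; lia.
Qed.

Lemma fps_coefM0 f g : fps_coef (f * g) 0%MM = fps_coef f 0%MM * fps_coef g 0%MM.
Proof.
have lt : (mdeg (0%MM : 'X_{1..n}) < (mdeg (0%MM : 'X_{1..n})).+1)%N by [].
rewrite /= (bigD1 (BMultinom lt)) /=; last by apply/mnm_lepP.
rewrite big1 ?addr0 ?subm0 // => k /andP[_]; rewrite bmeqP /= -mdeg_eq0.
have kd : (mdeg k <= mdeg (0%MM : 'X_{1..n}))%N by rewrite -ltnS; exact: bmdeg.
by move=> /negP[]; rewrite -leqn0; apply: leq_trans kd _; rewrite mdeg0.
Qed.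

Lemma fps_complete_norm : complete_norm fps_norm.
Proof.
split.
- move=> f f0; apply/eqP; apply/negP => /negP /fps_norm_expE[d]; rewrite f0 => /eqP.
  by rewrite eq_sym expf_eq0 invr_eq0 pnatr_eq0 andbF.
- exact: fps_norm0.
- exact: fps_norm_le1.
- by move=> f; apply/eqP; rewrite eq_le; apply/andP; split; apply: fps_norm_mono => d lf m md;
    have := lf m md; rewrite ?fps_coefN; [move=> ->; rewrite oppr0|move/eqP; rewrite oppr_eq0 => /eqP].
- move=> f g; have [le|/ltW le] := leP (fps_norm g) (fps_norm f).
    have [f0|/fps_norm_expE[d fd]] := eqVneq f 0.
      by rewrite f0 add0r fps_norm0 add0r.
    apply: (@le_trans _ _ (fps_norm f)); last by rewrite lerDl fps_norm_ge0.
    rewrite fd in le *; apply/fps_norm_le => m md; rewrite fps_coefD.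
    have /fps_norm_le/(_ m md) -> : fps_norm f <= 2^-1 ^+ d by rewrite fd.
    by rewrite add0r; move/fps_norm_le: le; apply.
  have [g0|/fps_norm_expE[d gd]] := eqVneq g 0.
    by rewrite g0 addr0 fps_norm0 addr0.
  apply: (@le_trans _ _ (fps_norm g)); last by rewrite lerDr fps_norm_ge0.
  rewrite gd in le *; apply/fps_norm_le => m md; rewrite fps_coefD.
  have /fps_norm_le/(_ m md) -> : fps_norm g <= 2^-1 ^+ d by rewrite gd.
  by rewrite addr0; move/fps_norm_le: le; apply.
- move=> f g; have [->|/fps_norm_expE[d fd]] := eqVneq f 0.
    by rewrite mul0r fps_norm0 mul0r.
  have [->|/fps_norm_expE[d' gd]] := eqVneq g 0.
    by rewrite mulr0 fps_norm0 mulr0.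
  rewrite fd gd -exprD; apply/fps_norm_le/order_ge_mul; apply/fps_norm_le.
    by rewrite fd.
  by rewrite gd.
move=> u C r r01 h.
(* From index [k0 d] on, the increments have norm at most 2^-d, so every coefficient of degree below
   [d] is stationary; the limit reads it off there. *)
have /choice[k0 hk0] d : exists k0, forall k, (k0 <= k)%N -> order_ge d (u k.+1 - u k).
  have e0 : 0 < 2^-1 ^+ d / (`|C| + 1) :> rat by rewrite divr_gt0 ?exprn_gt0 // ltr_wpDl.
  have [k0 hk0] := expr_eventually_lt r01 e0; exists k0 => k /hk0.
  rewrite ltr_pdivlMr; last by rewrite ltr_wpDl.
  move=> lt; apply/fps_norm_le; apply: le_trans (h k) _; apply: le_trans (ltW lt).
  rewrite mulrC; apply: ler_wpM2l; first by case/andP: r01 => r0 _; rewrite exprn_ge0.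
  by apply: le_trans (ler_norm C) _; rewrite lerDl.
have stable d m j k : (mdeg m < d)%N -> (k0 d <= j)%N -> (j <= k)%N ->
    fps_coef (u k) m = fps_coef (u j) m.
  move=> md dj; elim: k => [|k IH] jk; first by rewrite (_ : j = 0%N) //; lia.
  have [jk'|kj] := leqP j k; last by rewrite (_ : j = k.+1) //; lia.
  rewrite -IH //; apply/eqP; rewrite -subr_eq0; apply/eqP.
  exact: hk0 (leq_trans dj jk') _ md.
pose l : fps := FPS (fun m => fps_coef (u (k0 (mdeg m).+1)) m).
exists l => e e0; have half01 : 0 <= (2^-1 : rat) < 1 by [].
have [d /(_ d (leqnn d)) hd] := expr_eventually_lt half01 e0.
exists (k0 d) => k dk; apply: le_lt_trans hd; apply/fps_norm_le => m md.
rewrite fps_coefD fps_coefN /l /=; set j := k0 (mdeg m).+1.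
rewrite -(stable d m k (maxn k j)) ?leq_maxl // -(stable (mdeg m).+1 m j (maxn k j)) ?leq_maxr //.
by rewrite subrr.
Qed.

Lemma fps_norm_lt1 f : fps_coef f 0%MM = 0 -> fps_norm f < 1.
Proof.
move=> f0; apply: (@le_lt_trans _ _ (2^-1 ^+ 1)) => //; apply/fps_norm_le => m.
by rewrite ltnS leqn0 mdeg_eq0 => /eqP ->.
Qed.

Lemma fps_norm_lt1P f : fps_norm f < 1 -> fps_coef f 0%MM = 0.
Proof.
have [->|/fps_norm_expE[[|d] fd]] := eqVneq f 0; first by rewrite fps_coef0.
  by rewrite fd expr0 ltxx.
have /fps_norm_le lf : fps_norm f <= 2^-1 ^+ d.+1 by rewrite fd.
by move=> _; apply: lf; rewrite mdeg0.
Qed.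

Lemma fps_norm_lt_coef f d m : fps_norm f < 2^-1 ^+ d -> (mdeg m < d)%N -> fps_coef f m = 0.
Proof. by move/ltW/fps_norm_le; apply. Qed.

Lemma fps_inv_bounded (q b : fps) : inv_bounded fps_norm q b.
Proof. exists 1 => k; exact: fps_norm_le1. Qed.

(** As q has zero constant term, only the factor with i = 0 sees the constant term of [b]; the
    others have constant term 1. *)
Lemma fps_qpoch_unit (q b : fps) k : fps_norm q < 1 -> fps_coef b 0%MM != 1 ->
  qpoch q b k \is a GRing.unit.
Proof.
move=> q1 b1; rewrite /qpoch; elim/big_rec: _ => [|i x _ xu]; first exact: unitr1.
rewrite unitrM xu andbT fps_unitE fps_coefD fps_coefN.
have -> : fps_coef (1 : fps) 0%MM = 1 by rewrite /= eqxx.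
case: (nat_of_ord i) => [|j]; first by rewrite expr0 mulr1 subr_eq0 eq_sym.
by rewrite exprS mulrCA fps_coefM0 (fps_norm_lt1P q1) mul0r subr0 oner_eq0.
Qed.

Lemma fps_norm_X i : fps_norm (fpsX K i) < 1.
Proof. by apply: fps_norm_lt1 => /=; rewrite eq_sym mnm1_eq0. Qed.
End PowerSeriesNorm.

(** * The parameters as elements of the coefficient field *)

Section Indeterminates.
Import finmap monalg.

Lemma infpolyX_coef (i : nat) : mcoeff (ucm i) (infpolyX rat i) = 1.
Proof. by rewrite /infpolyX mcoeffUU. Qed.

Lemma infpoly1_coef (i : nat) : mcoeff (ucm i) (1 : infpoly rat) = 0.
Proof.
rewrite mcoeff1; case: eqP => // /(congr1 (fun m : cmonom nat => m i)).
by rewrite cmUU cm1.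
Qed.

Lemma indetS_neq0 i : indetS i != 0.
Proof.
rewrite tofrac_eq0; apply: contra_eq_neq (infpolyX_coef i) => ->.
by rewrite mcoeff0 eq_sym oner_eq0.
Qed.

(** The coefficient of s_i separates s_i from 1 and from -1. This makes the q-Pochhammer symbols of
    s_i^2 invertible power series. *)
Lemma indetS_sqr_neq1 i : indetS i ^+ 2 != 1.
Proof.
rewrite sqrf_eq1 negb_or -[X in _ == X]tofrac1 tofrac_eq -[X in - X]tofrac1 -tofracN tofrac_eq.
apply/andP; split; apply: contra_eq_neq (infpolyX_coef i) => ->.
  by rewrite infpoly1_coef eq_sym oner_eq0.
by rewrite mcoeffN infpoly1_coef oppr0 eq_sym oner_eq0.
Qed.
End Indeterminates.

From mathcomp Require Import finmap.
From mathcomp Require Import all_classical all_reals all_analysis.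
From mathcomp Require Import complex.
From mathcomp.analysis.showcase Require Import summability.
Import numFieldNormedType.Exports.
Local Open Scope classical_set_scope.

(** * Vertex models as sums over chains of partitions *)

(* [nx] gives the length of each sequence from that of the previous one: [predn] for
   Xi = S and [id] for Xi = S-bar. *)
Fixpoint chains (nx : nat -> nat) (M k : nat) (s : seq nat) : seq (seq (seq nat)) :=
  if k is k'.+1 then
    [seq s :: p | nu <- box M (nx (size s)), p <- chains nx M k' nu]
  else if all (pred1 0%N) s then [:: [:: s]] else [::].

Definition entry_of (p : seq (seq nat)) (r c : nat) : nat := nth 0%N (nth [::] p r) c.

Lemma mem_chainsP nx M k s p : reflect
  [/\ size p = k.+1, nth [::] p 0 = s, all (pred1 0%N) (nth [::] p k)
    & forall r, (r < k)%N -> nth [::] p r.+1 \in box M (nx (size (nth [::] p r)))]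
  (p \in chains nx M k s).
Proof.
elim: k s p => [|k IH] s p /=.
  apply: (iffP idP) => [|[]].
    by case: ifP => // s0; rewrite inE => /eqP ->.
  by case: p => [|t [|? ?]] //= _ -> ->; rewrite inE.
apply: (iffP allpairsPdep) => [[nu [p' [nub /IH[sp p0 pk pr] ->]]]|[sp p0 pk pr]].
  split=> //=; first by rewrite sp.
  by case=> [|r] rk //=; [rewrite p0|apply: pr].
case: p sp p0 pk pr => [|t p] // [sp] /= -> pk pr.
exists (nth [::] p 0), p; split=> //; first exact: (pr 0%N).
by apply/IH; split=> // r rk; apply: (pr r.+1).
Qed.

Lemma chains_uniq nx M k s : uniq (chains nx M k s).
Proof.
elim: k s => [|k IH] s /=; first by case: ifP.
apply: allpairs_uniq_dep => [|nu _|]; [exact: box_uniq|exact: IH|].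
move=> u v /allpairsPdep[x [y [_ /mem_chainsP[_ yx _ _] eu]]].
case/allpairsPdep=> x' [y' [_ /mem_chainsP[_ yx' _ _] ev]]; subst u v => /= -[ey].
by rewrite -yx -yx' ey.
Qed.

Lemma backward_ind L (Q : nat -> Prop) : (forall c, (L <= c)%N -> Q c) ->
  (forall c, (c < L)%N -> Q c.+1 -> Q c) -> forall c, Q c.
Proof.
move=> Q1 Q2 c; have [/Q1 //|cL] := leqP L c.
rewrite -(subKn (ltnW cL)); elim: (L - c)%N (leq_subr c L) => [|d IH] dL.
  by apply: Q1; rewrite subn0.
by apply: Q2; [lia|rewrite (_ : (L - d.+1).+1 = L - d)%N; [apply: IH; lia|lia]].
Qed.

Section ChainSum.
Variables (E : fieldType) (q : E) (n : nat) (kappa : 'I_n -> E) (Xi S : nat -> E).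
Variables (tau : nat -> nat -> E) (la : intpart) (L M : nat) (nx : nat -> nat) (s0 : seq nat).
Hypothesis s0E : forall c, nth 0%N s0 c = part la c.+1.
Hypothesis laL : (size la < L)%N.
Hypothesis s0M : (head 0 s0 < M)%N.
Hypothesis nx_le : forall k, (nx k <= k)%N.
(** Lists of the lengths prescribed by [nx] must hold every interlacing array that ends in 0. For
    [predn] this expresses that a partition with n - r steps left has at most n - r nonzero
    parts. *)
Hypothesis fits : forall P : nat -> nat -> nat, (forall c, P 0%N c = nth 0%N s0 c) ->
  (forall r c, (r < n)%N -> (P r c.+1 <= P r.+1 c <= P r c)%N) ->
  (forall c, P n c = 0%N) -> forall r c, (r <= n)%N -> (iter r nx (size s0) <= c)%N -> P r c = 0%N.

(** Vertical labels are the gaps within a partition, horizontal labels the differences between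
    successive partitions. Conservation at a vertex is then automatic, and the condition i >= l
    becomes one half of interlacing. *)
Definition mult_mx (p : seq (seq nat)) : 'M[nat]_(n.+1, L) :=
  \matrix_(r, c) (entry_of p r c - entry_of p r c.+1)%N.
Definition diff_mx (p : seq (seq nat)) : 'M[nat]_(n, L.+1) :=
  \matrix_(r, c) (entry_of p r c - entry_of p r.+1 c)%N.

Let valid p := (p \in chains nx M n s0) && sorted interlace p.

Let la0 c : (L <= c.+1)%N -> nth 0%N s0 c = 0%N.
Proof. by move=> Lc; rewrite s0E /part nth_default //=; lia. Qed.

Lemma chain_facts p : valid p ->
  [/\ forall r, (r <= n)%N -> size (nth [::] p r) = iter r nx (size s0),
      forall c, entry_of p 0 c = nth 0%N s0 c,
      forall r c, (r < n)%N -> (entry_of p r c.+1 <= entry_of p r.+1 c <= entry_of p r c)%N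
    & forall c, entry_of p n c = 0%N].
Proof.
case/andP=> /mem_chainsP[sp p0 pn pr] srt.
have szs r : (r <= n)%N -> size (nth [::] p r) = iter r nx (size s0).
  elim: r => [|r IH] rn; first by rewrite p0.
  by have := pr r rn; rewrite mem_box IH ?(ltnW rn) // => /andP[/eqP ->].
split=> // [c|r c rn|c]; rewrite /entry_of ?p0 //.
  have /interlaceP -> // : interlace (nth [::] p r) (nth [::] p r.+1).
    by apply: (sortedP [::] srt); rewrite sp.
  by rewrite !szs ?(ltnW rn) //= nx_le.
have [cs|cs] := ltnP c (size (nth [::] p n)); last by rewrite nth_default.
by apply/eqP; apply: (all_nthP 0%N pn).
Qed.

Lemma chain_entry_le p r c : valid p -> (r <= n)%N -> (entry_of p r c <= nth 0 s0 c)%N.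
Proof.
case/chain_facts=> _ p0 il _; elim: r => [|r IH] rn; first by rewrite p0.
by have /andP[_ h] := il r c rn; apply: leq_trans h (IH (ltnW rn)).
Qed.

Lemma chain_boundary p : valid p ->
  boundary la empty_intpart (fun i => entry_of p i 0 - entry_of p i.+1 0)%N
    (mult_mx p) (diff_mx p).
Proof.
move=> vp; have [_ p0 il pn] := chain_facts vp; split=> [c|c|r|r]; rewrite !mxE.
- by rewrite multiplicity_conj //= !p0 !s0E.
- by rewrite multiplicity_conj //= !pn /part !nth_nil.
- by [].
- by have := chain_entry_le L vp (ltnW (ltn_ord r)); rewrite la0 //= leqn0 => /eqP ->.
Qed.

Lemma diff_mx_inj p p' : valid p -> valid p' -> diff_mx p = diff_mx p' -> p = p'.
Proof.
move=> vp vp' eqh; have [szp p0 il pn] := chain_facts vp; have [szp' p0' il' pn'] := chain_facts vp'.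
have /andP[/mem_chainsP[sp _ _ _] _] := vp; have /andP[/mem_chainsP[sp' _ _ _] _] := vp'.
have key r c : (r <= n)%N -> entry_of p r c = entry_of p' r c.
  elim: r => [|r IH] rn; first by rewrite p0 p0'.
  have [cL|Lc] := ltnP c L.+1; last first.
    have := chain_entry_le c vp rn; have := chain_entry_le c vp' rn; rewrite la0; lia.
  have := congr1 (fun h : 'M[nat]_(n, L.+1) => h (Ordinal rn) (Ordinal cL)) eqh; rewrite !mxE /=.
  have := il r c rn; have := il' r c rn; rewrite IH ?(ltnW rn) //; lia.
apply: (@eq_from_nth _ [::]) => [|r]; first by rewrite sp.
rewrite sp ltnS => rn; apply: (@eq_from_nth _ 0%N) => [|c _]; first by rewrite szp // szp'.
exact: key.
Qed.

(** Extension by 0 to all natural indices, so that labels can be summed and shifted without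
    ordinals. *)
Definition mx_entry m k (A : 'M[nat]_(m, k)) (i j : nat) : nat :=
  match @idP (i < m)%N, @idP (j < k)%N with
  | ReflectT hi, ReflectT hj => A (Ordinal hi) (Ordinal hj)
  | _, _ => 0%N
  end.

Lemma mx_entryE m k (A : 'M[nat]_(m, k)) (i : 'I_m) (j : 'I_k) : mx_entry A i j = A i j.
Proof.
rewrite /mx_entry; case: {-}_ / idP => [hi|]; last by rewrite ltn_ord.
case: {-}_ / idP => [hj|]; last by rewrite ltn_ord.
by congr (A _ _); apply: val_inj.
Qed.

(** Entry c of partition r is recovered as [P r c], the sum of the vertical labels from column c on.
    Conservation, started from the zero label at the right edge, then identifies the horizontal
    labels with differences of successive partitions. *)
Lemma boundary_chain a (v : 'M[nat]_(n.+1, L)) (h : 'M[nat]_(n, L.+1)) :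
    boundary la empty_intpart a v h ->
    (forall (r : 'I_n) (c : 'I_L),
       (v (lift ord0 r) c + h r (widen_ord (leqnSn L) c) ==
        v (widen_ord (leqnSn n) r) c + h r (lift ord0 c))%N &&
       (h r (lift ord0 c) <= v (lift ord0 r) c)%N) ->
  exists2 p, valid p & mult_mx p = v /\ diff_mx p = h.
Proof.
move=> [v0 vn h0 hL] loc.
have locE r c : (r < n)%N -> (c < L)%N ->
   (mx_entry v r.+1 c + mx_entry h r c = mx_entry v r c + mx_entry h r c.+1)%N /\
   (mx_entry h r c.+1 <= mx_entry v r.+1 c)%N.
  move=> rn cL; have := loc (Ordinal rn) (Ordinal cL).
  by rewrite -!mx_entryE /= /bump /= !add1n => /andP[/eqP].
have hLE r : (r < n)%N -> mx_entry h r L = 0%N.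
  by move=> rn; have := hL (Ordinal rn); rewrite -mx_entryE.
pose P r c := (\sum_(c <= j < L) mx_entry v r j)%N.
have PS r c : (c < L)%N -> P r c = (mx_entry v r c + P r c.+1)%N.
  by move=> cL; rewrite /P big_ltn.
have Pge r c : (L <= c)%N -> P r c = 0%N by move=> Lc; rewrite /P big_geq.
have P0 c : P 0%N c = nth 0%N s0 c.
  elim/(@backward_ind L): c => [c Lc|c cL IH]; first by rewrite Pge // la0 // leqW.
  rewrite PS // IH; have := v0 (Ordinal cL); rewrite -mx_entryE /= => ->.
  by rewrite multiplicity_conj // !s0E subnK // part_leq.
have Pn c : P n c = 0%N.
  elim/(@backward_ind L): c => [c Lc|c cL IH]; first by rewrite Pge.
  rewrite PS // IH addn0; have -> : mx_entry v n c = v ord_max (Ordinal cL) by rewrite -mx_entryE.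
  by rewrite vn multiplicity_conj // /part !nth_nil.
have Ph r c : (r < n)%N -> (c <= L)%N -> P r c = (P r.+1 c + mx_entry h r c)%N.
  move=> rn; elim/(@backward_ind L): c => [c Lc cL|c cL IH _].
    have -> : c = L by apply/eqP; rewrite eqn_leq cL.
    by rewrite !Pge // hLE.
  by rewrite (PS r c) // (PS r.+1 c) // IH // addnCA -(locE r c rn cL).1 addnC addnAC.
have il r c : (r < n)%N -> (P r c.+1 <= P r.+1 c <= P r c)%N.
  move=> rn; have [cL|Lc] := ltnP c L; last by rewrite !Pge // leqW.
  rewrite (Ph r c) ?(ltnW cL) // leq_addr andbT (Ph r c.+1) // (PS r.+1 c) //.
  by rewrite addnC leq_add2r (locE r c rn cL).2.
have Pfit := fits P0 il Pn.
pose p := [seq mkseq (P r) (iter r nx (size s0)) | r <- iota 0 n.+1].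
have pE r : (r <= n)%N -> nth [::] p r = mkseq (P r) (iter r nx (size s0)).
  by move=> rn; rewrite (nth_map 0%N) ?size_iota // nth_iota // add0n.
have peE r c : (r <= n)%N -> entry_of p r c = P r c.
  move=> rn; rewrite /entry_of pE //.
  have [cs|sc] := ltnP c (iter r nx (size s0)); first by rewrite nth_mkseq.
  by rewrite nth_default ?size_mkseq // Pfit.
have Pmon r c : (r <= n)%N -> (P r c <= nth 0 s0 c)%N.
  elim: r => [|r IH] rn; first by rewrite P0.
  by have /andP[_ h1] := il r c rn; apply: leq_trans h1 (IH (ltnW rn)).
have PM r c : (r <= n)%N -> (P r c < M)%N.
  move=> rn; apply: leq_ltn_trans s0M; apply: leq_trans (Pmon r c rn) _.
  by rewrite -nth0 !s0E; apply: part_leq.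
exists p; last split.
- apply/andP; split.
    apply/mem_chainsP; split.
    + by rewrite size_map size_iota.
    + rewrite pE //=; apply: (@eq_from_nth _ 0%N); rewrite size_mkseq // => c cs.
      by rewrite nth_mkseq.
    + rewrite pE //; apply/(all_nthP 0%N) => c; rewrite size_mkseq => cs.
      by rewrite nth_mkseq //= Pn.
    move=> r rn; rewrite !pE ?(ltnW rn) // mem_box !size_mkseq /= eqxx /=.
    by apply/(all_nthP 0%N) => c; rewrite size_mkseq => cs; rewrite nth_mkseq // PM.
  apply/(sortedP [::]) => r; rewrite size_map size_iota ltnS => rn.
  apply/interlaceP; first by rewrite !pE ?(ltnW rn) // !size_mkseq /= nx_le.
  move=> c; have := il r c rn; rewrite -!peE ?(ltnW rn) //.
- apply/matrixP => r c; have rn : (r <= n)%N by rewrite -ltnS.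
  by rewrite mxE !(peE r) // (PS r c) // addnK mx_entryE.
apply/matrixP => r c; have rn := ltn_ord r; have cL : (c <= L)%N by rewrite -ltnS.
by rewrite mxE (peE r) ?(ltnW rn) // (peE r.+1) // (Ph r c) // addKn mx_entryE.
Qed.

(** An array that violates the vertex condition anywhere has weight 0; all others come from exactly
    one chain, so the sum over an infinite index set becomes finite. *)
Lemma ZW_chains (a : 'I_n -> nat) :
  ZW q kappa Xi S tau la empty_intpart L a =
  \sum_(p <- chains nx M n s0 | sorted interlace p &&
          [forall i : 'I_n, (entry_of p i 0 - entry_of p i.+1 0)%N == a i])
     \prod_(r < n) \prod_(c < L) row_weight q kappa Xi S tau (mult_mx p) (diff_mx p) r c.
Proof.
pose A : set ('M[nat]_(n.+1, L) * 'M[nat]_(n, L.+1)) :=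
  [set vh | boundary la empty_intpart a vh.1 vh.2].
pose cs := [seq p <- chains nx M n s0 | sorted interlace p &&
          [forall i : 'I_n, (entry_of p i 0 - entry_of p i.+1 0)%N == a i]].
have csP p : p \in cs -> valid p /\ forall i : 'I_n, (entry_of p i 0 - entry_of p i.+1 0)%N = a i.
  rewrite mem_filter => /andP[/andP[srt /forallP h] pc].
  by split=> [|i]; [rewrite /valid pc|exact/eqP].
rewrite -big_filter -/cs /ZW -/A.
rewrite (@fsbigE _ _ _ _ A [seq (mult_mx p, diff_mx p) | p <- cs]); first last.
- move=> [v h] /= bd nin; apply/eqP; apply: contraNT nin => nz.
  have [p vp [pv ph]] : exists2 p, valid p & mult_mx p = v /\ diff_mx p = h.
    apply: (boundary_chain bd) => r c; move: nz; apply: contraNT => loc.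
    rewrite (bigD1 r) //= (bigD1 c) //= /row_weight /vertex_weight /=.
    by rewrite (negbTE loc) !mul0r.
  apply/mapP; exists p; last by rewrite pv ph.
  have /andP[pc srt] := vp; rewrite mem_filter pc srt andbT /=; apply/forallP => i.
  have [_ _ h0 _] := bd; rewrite /= -ph in h0.
  by rewrite -(h0 i) mxE.
- move=> [v h] /= /mapP[p /csP[vp pa] [-> ->]].
  have [b1 b2 b3 b4] := chain_boundary vp; split=> // r; by rewrite b3.
- rewrite map_inj_in_uniq ?filter_uniq ?chains_uniq // => p p' /csP[vp _] /csP[vp' _] [_].
  exact: diff_mx_inj.
rewrite big_map big_seq_cond [RHS]big_seq; apply: eq_bigl => p.
case pcs: (p \in cs) => //=; apply: mem_set => /=.
by have [vp pa] := csP p pcs; have [b1 b2 b3 b4] := chain_boundary vp; split=> // r; rewrite b3.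
Qed.

(** A chain determines its left labels as the drops of the first part, and these telescope to la_1;
    so the sums over [a] and over chains merge into one. *)
Lemma boundary_sum_chains (bd : 'I_n -> nat -> E) :
  \sum_(a : {ffun 'I_n -> 'I_(part la 1).+1} |
        (\sum_i a i + part empty_intpart 1 == part la 1)%N)
     (\prod_(i < n) bd i (a i)) *
     ZW q kappa Xi S tau la empty_intpart L (fun i => a i : nat) =
  \sum_(p <- chains nx M n s0 | sorted interlace p) \prod_(r < n)
     (bd r (entry_of p r 0 - entry_of p r.+1 0)%N *
      \prod_(c < L) row_weight q kappa Xi S tau (mult_mx p) (diff_mx p) r c).
Proof.
under eq_bigr => a _ do rewrite ZW_chains big_distrr /=.
rewrite (exchange_big_dep (fun p => sorted interlace p)) /=; last by move=> a p _ /andP[].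
rewrite big_seq_cond [RHS]big_seq_cond; apply: eq_bigr => p /andP[pc srt].
have vp : valid p by rewrite /valid pc.
have [szp p0 il pn] := chain_facts vp.
have dle (i : 'I_n) : (entry_of p i 0 - entry_of p i.+1 0 < (part la 1).+1)%N.
  rewrite ltnS; apply: leq_trans (leq_subr _ _) _; rewrite -(s0E 0).
  exact: chain_entry_le vp (ltnW (ltn_ord i)).
pose a0 : {ffun 'I_n -> 'I_(part la 1).+1} := [ffun i => Ordinal (dle i)].
have suma0 : (\sum_i a0 i = part la 1)%N.
  have tel k : (k <= n)%N -> (\sum_(i < k) (entry_of p i 0 - entry_of p i.+1 0) + entry_of p k 0 =
      part la 1)%N.
    elim: k => [|k IH] kn; first by rewrite big_ord0 add0n p0 s0E.
    rewrite -IH ?(ltnW kn) // big_ord_recr /=; have := il k 0%N kn; lia.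
  have e := tel n (leqnn n); rewrite pn addn0 in e.
  by apply: etrans e; apply: eq_bigr => i _; rewrite ffunE.
rewrite (big_pred1 a0) => [|a].
  by rewrite big_split /=; congr (_ * _); apply: eq_bigr => i _; rewrite ffunE.
rewrite srt /= addn0; apply/andP/eqP => [[_ /forallP h]|->].
  by apply/ffunP => i; apply: val_inj; rewrite ffunE /=; apply/esym/eqP/h.
by rewrite suma0 eqxx; split=> //; apply/forallP => i; rewrite ffunE.
Qed.
End ChainSum.

(** * From vertex weights to branching weights *)

Section StepProducts.
Variables (R : comUnitRingType) (q : R).
Hypothesis q_unit : forall k, qpoch q q k \is a GRing.unit.
Implicit Types (x b : R) (A : nat -> R) (la nu : seq nat).

Lemma fstep_prod x A la nu K : (size nu <= size la)%N ->
    (forall c, (K <= c)%N -> nth 0%N la c = 0%N) ->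
    (forall c, (K <= c)%N -> nth 0%N nu c = 0%N) ->
  fstep q x A la nu =
  \prod_(c < K) fcol q x (A c) (nth 0 la c) (nth 0 la c.+1) (nth 0 nu c).
Proof.
have f1 b : fcol q x b 0 0 0 = 1.
  by rewrite /fcol /= !subnn hpoch0 !qpoch0 !divr1 !mulr1.
elim: la K A nu => [|l la IH] K A nu /=.
  case: nu => // _ _ _; rewrite big1 // => c _; by rewrite !nth_nil f1.
move=> sz l0 n0; have sz' : (size (behead nu) <= size la)%N by rewrite size_behead; lia.
case: K l0 n0 => [|K] l0 n0.
  rewrite big_ord0 (IH 0%N) // ?big_ord0 => [|c _|c _]; [|exact: (l0 c.+1)|].
    have [e0 e1] : l = 0%N /\ nth 0%N la 0 = 0%N by split; [apply: (l0 0%N)|apply: (l0 1%N)].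
    by rewrite -!nth0 (n0 0%N) // e0 e1 f1 mulr1.
  by rewrite nth_behead n0.
rewrite big_ord_recl /= -!nth0 (IH K) => [|//|c Kc|c Kc]; [|exact: (l0 c.+1)|].
  by congr (_ * _); apply: eq_bigr => c _; rewrite nth_behead.
by rewrite nth_behead n0.
Qed.

Lemma gstep_prod x A la nu K : (size nu <= size la)%N ->
    (forall c, (K <= c)%N -> nth 0%N la c = 0%N) ->
    (forall c, (K <= c)%N -> nth 0%N nu c = 0%N) ->
  gstep q x A la nu =
  \prod_(c < K) gcol q x (A c) (nth 0 la c) (nth 0 la c.+1) (nth 0 nu c) (nth 0 nu c.+1).
Proof.
have f1 b : gcol q x b 0 0 0 0 = 1.
  by rewrite /gcol /= !subnn hpoch0 !qpoch0 !divr1 !mulr1.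
elim: la K A nu => [|l la IH] K A nu /=.
  case: nu => // _ _ _; rewrite big1 // => c _; by rewrite !nth_nil f1.
move=> sz l0 n0; have sz' : (size (behead nu) <= size la)%N by rewrite size_behead; lia.
case: K l0 n0 => [|K] l0 n0.
  rewrite big_ord0 (IH 0%N) // ?big_ord0 => [|c _|c _]; [|exact: (l0 c.+1)|].
    have [e0 e1] : l = 0%N /\ nth 0%N la 0 = 0%N by split; [apply: (l0 0%N)|apply: (l0 1%N)].
    by rewrite -!nth0 nth_behead (n0 0%N) // (n0 1%N) // e0 e1 f1 mulr1.
  by rewrite nth_behead n0.
rewrite big_ord_recl /= -!nth0 (IH K) => [|//|c Kc|c Kc]; [|exact: (l0 c.+1)|].
  by rewrite nth_behead; congr (_ * _); apply: eq_bigr => c _; rewrite !nth_behead.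
by rewrite nth_behead n0.
Qed.

End StepProducts.

Lemma iter_shift (T : Type) (A : nat -> T) r c : iter r (@shift_seq T) A c = A (r + c)%N.
Proof. by elim: r c => [|r IH] c //=; rewrite /shift_seq IH addnS. Qed.

Section ChainPolynomials.
Variables (E : fieldType) (q : E) (A : nat -> E) (n M L : nat) (x : nat -> E).
Implicit Types (s nu : seq nat) (cn : nat -> seq nat -> E).

(** A row weight differs from [fstep] by a ratio of gauge factors, which telescopes along the chain.
    The gauge depends on the level [r] because the parameters shift with each row. *)
Lemma chains_fpol (step : nat -> seq nat -> seq nat -> E) cn :
    (forall r s, cn r s != 0) -> (forall r, cn r [::] = 1) ->
    (forall r s nu, (r < n)%N -> (size nu <= size s)%N -> interlace s nu ->
      (forall c, (L <= c.+1)%N -> nth 0%N s c = 0%N) ->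
      step r s nu = cn r s / cn r.+1 nu * fstep q (x r) (iter r (@shift_seq E) A) s nu) ->
  forall k r s, (r + k)%N = n -> size s = k -> (head 0 s < M)%N ->
    (forall c, (L <= c.+1)%N -> nth 0%N s c = 0%N) ->
  \sum_(p <- chains predn M k s | sorted interlace p)
     \prod_(i < k) step (r + i)%N (nth [::] p i) (nth [::] p i.+1) =
  cn r s * fpol q [seq x j | j <- iota r k] (iter r (@shift_seq E) A) s.
Proof.
move=> cn0 cn1 stepE; elim=> [|k IH] r s rk sk sM sL.
  case: s sk {sM sL} => //= _; rewrite big_mkcond /= big_seq1 /= big_ord0 cn1.
  by rewrite /fpol /= mulr1.
have szk : size [seq x j | j <- iota r.+1 k] = k by rewrite size_map size_iota.
rewrite /= big_mkcond big_allpairs_dep /=.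
rewrite (@fpolE _ _ _ _ _ _ M) ?szk // big_distrr sk /=.
apply: eq_big_seq => nu; rewrite mem_box => /andP[/eqP snu nuM].
have sz : (size nu <= size s)%N by rewrite snu sk.
rewrite -big_mkcond /=.
transitivity (\sum_(p <- chains predn M k nu | sorted interlace p) if interlace s nu then
   step r s nu * \prod_(i < k) step (r.+1 + i)%N (nth [::] p i) (nth [::] p i.+1) else 0).
  rewrite big_mkcond [RHS]big_mkcond; apply: eq_big_seq => p /mem_chainsP[sp p0 _ _].
  case: p sp p0 => // t p _ /= ->; case: ifP => [/andP[-> ->]|].
    rewrite big_ord_recl addn0 /=; congr (_ * _); apply: eq_bigr => i _.
    by rewrite /bump /= add1n addSnnS.
  by case: (interlace s nu) => /= [->|_]; rewrite ?if_same.
have [il|nil] := boolP (interlace s nu); last first.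
  by rewrite big1 // fstep_out // mul0r mulr0.
rewrite -big_distrr /= IH; last first.
- by move=> c Lc; have /(_ c)/andP[_] := interlaceP sz il; rewrite sL // leqn0 => /eqP.
- by rewrite -nth0; apply: leq_ltn_trans sM; apply: interlace_head.
- by rewrite snu.
- by rewrite addSnnS.
by rewrite stepE //; [field; exact: cn0|lia].
Qed.

Lemma chains_gpol (step : nat -> seq nat -> seq nat -> E) (cn : seq nat -> E) :
    (forall s, cn s != 0) -> (forall s, all (pred1 0%N) s -> cn s = 1) ->
    (forall r s nu, (r < n)%N -> (size nu <= size s)%N -> interlace s nu ->
      (forall c, (L <= c.+1)%N -> nth 0%N s c = 0%N) ->
      step r s nu = cn s / cn nu * gstep q (x r) A s nu) ->
  forall k r s, (r + k)%N = n -> (head 0 s < M)%N ->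
    (forall c, (L <= c.+1)%N -> nth 0%N s c = 0%N) ->
  \sum_(p <- chains id M k s | sorted interlace p)
     \prod_(i < k) step (r + i)%N (nth [::] p i) (nth [::] p i.+1) =
  cn s * gpol q [seq x j | j <- iota r k] A s.
Proof.
move=> cn0 cn1 stepE; elim=> [|k IH] r s rk sM sL.
  rewrite /gpol /=; case: ifP => [s0|_]; last by rewrite big_nil mulr0.
  by rewrite big_mkcond /= big_seq1 /= big_ord0 cn1 // mulr1.
rewrite /= big_mkcond big_allpairs_dep /=.
rewrite (gpolE _ _ _ _ sM) big_distrr /=.
apply: eq_big_seq => nu; rewrite mem_box => /andP[/eqP snu nuM].
have sz : (size nu <= size s)%N by rewrite snu.
rewrite -big_mkcond /=.
transitivity (\sum_(p <- chains id M k nu | sorted interlace p) if interlace s nu then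
   step r s nu * \prod_(i < k) step (r.+1 + i)%N (nth [::] p i) (nth [::] p i.+1) else 0).
  rewrite big_mkcond [RHS]big_mkcond; apply: eq_big_seq => p /mem_chainsP[sp p0 _ _].
  case: p sp p0 => // t p _ /= ->; case: ifP => [/andP[-> ->]|].
    rewrite big_ord_recl addn0 /=; congr (_ * _); apply: eq_bigr => i _.
    by rewrite /bump /= add1n addSnnS.
  by case: (interlace s nu) => /= [->|_]; rewrite ?if_same.
have [il|nil] := boolP (interlace s nu); last first.
  by rewrite big1 // gstep_out // mul0r mulr0.
rewrite -big_distrr /= IH; last first.
- by move=> c Lc; have /(_ c)/andP[_] := interlaceP sz il; rewrite sL // leqn0 => /eqP.
- by rewrite -nth0; apply: leq_ltn_trans sM; apply: interlace_head.
- by rewrite addSnnS.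
by rewrite stepE //; [field; exact: cn0|lia].
Qed.
End ChainPolynomials.

Lemma hpoch_scale (E : fieldType) (q y b : E) k : y != 0 ->
  y ^+ k * qpoch q (b / y) k = hpoch q y b k.
Proof.
move=> y0; rewrite /qpoch /hpoch -{1}[k]card_ord -prodr_const -big_split /=.
by apply: eq_bigr => i _; field.
Qed.

Lemma lower_entry (P : nat -> nat -> nat) n :
    (forall r c, (r < n)%N -> (P r c.+1 <= P r.+1 c <= P r c)%N) ->
  forall j r c, (r + j <= n)%N -> (P r (c + j) <= P (r + j) c)%N.
Proof.
move=> il; elim=> [|j IH] r c rj; first by rewrite !addn0.
have rn : (r < n)%N by lia.
rewrite addnS; have /andP[h _] := il r (c + j)%N rn; apply: leq_trans h _.
by rewrite addnS -addSn; apply: IH; rewrite addSn -addnS.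
Qed.

Lemma fits_predn (s0 : seq nat) n (P : nat -> nat -> nat) : (size s0 <= n)%N ->
    (forall r c, (r < n)%N -> (P r c.+1 <= P r.+1 c <= P r c)%N) ->
    (forall c, P n c = 0%N) ->
  forall r c, (r <= n)%N -> (n - r <= c)%N -> P r c = 0%N.
Proof.
move=> sn il Pn r c rn nc; apply/eqP; rewrite -leqn0.
have := lower_entry il (j := n - r) (r := r) (c - (n - r)).
by rewrite subnKC // subnK // Pn; apply.
Qed.

Lemma fits_id (s0 : seq nat) n (P : nat -> nat -> nat) :
    (forall c, P 0%N c = nth 0%N s0 c) ->
    (forall r c, (r < n)%N -> (P r c.+1 <= P r.+1 c <= P r c)%N) ->
    (forall c, P n c = 0%N) ->
  forall r c, (r <= n)%N -> (iter r id (size s0) <= c)%N -> P r c = 0%N.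
Proof.
move=> P0 il _ r c rn; rewrite iter_fix // => sc; apply/eqP; rewrite -leqn0.
suff : (P r c <= P 0%N c)%N by rewrite P0 nth_default.
elim: r rn => // r IH rn; have /andP[_ h] := il r c rn.
exact: leq_trans h (IH (ltnW rn)).
Qed.

Definition column_params (R : pzRingType) (S : nat -> R) (c : nat) : R := S c.+1 ^+ 2.

Definition padded (n : nat) (la : intpart) : seq nat := la ++ nseq (n - size la) 0%N.

Lemma nth_padded n (la : intpart) c : nth 0%N (padded n la) c = part la c.+1.
Proof. by rewrite nth_cat nth_nseq if_same /part /=; case: ltnP => // h; rewrite nth_default. Qed.

Lemma size_padded n (la : intpart) : (size la <= n)%N -> size (padded n la) = n.
Proof. by move=> h; rewrite size_cat size_nseq subnKC. Qed.

Section Diagonal.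
Variables (E : fieldType) (q : E) (S : nat -> E).
Hypothesis q_reg : forall k, qpoch q q k != 0.
Hypothesis S_reg : forall c k, qpoch q (S c.+1 ^+ 2) k != 0.
Hypothesis S_neq0 : forall i, S i != 0.
Local Notation A := (column_params S).

Section Steps.
Variables (L : nat) (y : E) (r : nat) (s nu : seq nat).
Hypothesis y0 : y != 0.
Hypothesis sz : (size nu <= size s)%N.
Hypothesis il : forall c, (nth 0 s c.+1 <= nth 0 nu c <= nth 0 s c)%N.
Hypothesis sL : forall c, (L <= c.+1)%N -> nth 0%N s c = 0%N.

(** This is c_S with the parameters shifted by the level; at level 0 it cancels the c_S(la) in the
    denominator of F. *)
Definition diag_gauge (L r : nat) (s : seq nat) : E :=
  \prod_(c < L) (qpoch q (A (r + c)%N) (nth 0 s c - nth 0 s c.+1) /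
                 qpoch q q (nth 0 s c - nth 0 s c.+1)).

Lemma diag_gauge_neq0 L' r' s' : diag_gauge L' r' s' != 0.
Proof.
apply/prodf_neq0 => c _; rewrite mulf_neq0 ?invr_eq0 //; exact: S_reg.
Qed.

Lemma vertex_weightE t2 z (l0 l1 n0 n1 : nat) :
    (l1 <= n0 <= l0)%N -> (n1 <= l1)%N ->
  vertex_weight q t2 z (n0 - n1) (l0 - n0) (l0 - l1) (l1 - n1) =
  (z ^+ 2 / t2) ^+ (l1 - n1) *
    (qpoch q (z ^+ 2 / t2) (n0 - l1) * qpoch q t2 (l1 - n1) / qpoch q (z ^+ 2) (n0 - n1)) *
    (qpoch q q (n0 - n1) / (qpoch q q (n0 - l1) * qpoch q q (l1 - n1))).
Proof.
move=> h1 h2; rewrite /vertex_weight.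
have -> : (n0 - n1 + (l0 - n0) == l0 - l1 + (l1 - n1))%N && (l1 - n1 <= n0 - n1)%N by lia.
by rewrite (_ : (n0 - n1 - (l1 - n1) = n0 - l1)%N) //; lia.
Qed.

(** A vertex gives the factor [T] of its own column and the factor [G] of the next one. The boundary
    weight supplies [G 0] and [G L] is 1, so after a shift by one column the [G] and [T] of each
    column recombine into [fcol]. *)
Lemma diag_step :
  (y * S 0%N / S 0%N) ^+ (nth 0 s 0 - nth 0 nu 0) *
    (qpoch q (y^-1 * S r.+1 * S r.+1) (nth 0 s 0 - nth 0 nu 0) / qpoch q q (nth 0 s 0 - nth 0 nu 0)) *
  \prod_(c < L) vertex_weight q (S (r.+1 + c.+1)%N * S (r.+1 + c.+1)%N / y) (S (c.+1 + r.+1)%N)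
     (nth 0 nu c - nth 0 nu c.+1) (nth 0 s c - nth 0 nu c)
     (nth 0 s c - nth 0 s c.+1) (nth 0 s c.+1 - nth 0 nu c.+1) =
  diag_gauge L r s / diag_gauge L r.+1 nu * fstep q y (iter r (@shift_seq E) A) s nu.
Proof.
have nuL c : (L <= c.+1)%N -> nth 0%N nu c = 0%N.
  by move=> Lc; have := il c; rewrite (sL Lc); lia.
rewrite (fstep_prod q y _ sz (K := L)) => [|c Lc|c Lc]; [|exact/sL/leqW|exact/nuL/leqW].
pose G c := hpoch q y (A (r + c)%N) (nth 0 s c - nth 0 nu c) / qpoch q q (nth 0 s c - nth 0 nu c).
have GL : G L = 1 by rewrite /G sL // nuL // hpoch0 qpoch0 divr1.
have -> : (y * S 0%N / S 0%N) ^+ (nth 0 s 0 - nth 0 nu 0) *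
    (qpoch q (y^-1 * S r.+1 * S r.+1) (nth 0 s 0 - nth 0 nu 0) / qpoch q q (nth 0 s 0 - nth 0 nu 0))
    = G 0%N.
  have -> : y^-1 * S r.+1 * S r.+1 = A (r + 0)%N / y by rewrite /column_params addn0; field.
  by rewrite mulfK // mulrA hpoch_scale.
pose T c := qpoch q y (nth 0 nu c - nth 0 s c.+1) / qpoch q q (nth 0 nu c - nth 0 s c.+1).
rewrite (eq_bigr (fun c : 'I_L => G c.+1 * (T c * (qpoch q (A (r.+1 + c)%N) (nth 0 nu c - nth 0 nu c.+1) /
                 qpoch q q (nth 0 nu c - nth 0 nu c.+1))^-1))) => [|c _]; last first.
  have := il c; have := il c.+1 => /andP[_ i2] i1; rewrite vertex_weightE //.
  have -> : S (c.+1 + r.+1)%N = S (r.+1 + c.+1)%N by rewrite addnC.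
  set z := S (r.+1 + c.+1)%N; have z0 : z != 0 := S_neq0 _.
  have -> : z ^+ 2 / (z * z / y) = y by field; rewrite z0 y0.
  rewrite /G /T addSnnS -(hpoch_scale q _ _ y0) /column_params -addSn -/z -expr2.
  have := S_reg (r + c.+1)%N (nth 0 nu c - nth 0 nu c.+1); rewrite -addSn -/z.
  move: (q_reg (nth 0 nu c - nth 0 nu c.+1)) (q_reg (nth 0 nu c - nth 0 s c.+1))
   (q_reg (nth 0 s c.+1 - nth 0 nu c.+1)) => q1 q2 q3 q4.
  by field; rewrite q1 q2 q3 q4 ?y0.
rewrite big_split /= mulrA.
have -> : G 0%N * \prod_(c < L) G c.+1 = \prod_(c < L) G c.
  transitivity (\prod_(c < L.+1) G c); first by rewrite big_ord_recl.
  by rewrite big_ord_recr /= GL mulr1.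
have -> : \prod_(c < L) (T c * (qpoch q (A (r.+1 + c)) (nth 0%N nu c - nth 0%N nu c.+1) /
    qpoch q q (nth 0%N nu c - nth 0%N nu c.+1))^-1) = (\prod_(c < L) T c) / diag_gauge L r.+1 nu.
  by rewrite [LHS]big_split /= prodfV.
have -> : \prod_(c < L) fcol q y (iter r (@shift_seq E) A c) (nth 0%N s c) (nth 0%N s c.+1) (nth 0%N nu c) =
    (\prod_(c < L) G c) * (\prod_(c < L) T c) / diag_gauge L r s.
  rewrite /diag_gauge -prodfV -!big_split /=; apply: eq_bigr => c _ /=.
  rewrite iter_shift /fcol il /G /T.
  have q1 : qpoch q (A (r + c)) (nth 0%N s c - nth 0%N s c.+1) != 0 := S_reg _ _.
  move: (q_reg (nth 0%N s c - nth 0%N s c.+1)) (q_reg (nth 0%N s c - nth 0%N nu c))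
    (q_reg (nth 0%N nu c - nth 0%N s c.+1)) => q2 q3 q4.
  by field; rewrite ?oner_neq0 q1 q2 q3 q4.
by field; rewrite !diag_gauge_neq0.
Qed.

(** This is the square of (-S)^la. The normalisation of F* removes one of the two factors, and the
    other cancels against F. *)
Definition inv_gauge (L : nat) (s : seq nat) : E := \prod_(c < L) (S c ^+ 2) ^+ nth 0%N s c.

Lemma inv_gauge_neq0 L' s' : inv_gauge L' s' != 0.
Proof. by apply/prodf_neq0 => c _; rewrite !expf_neq0. Qed.

(** The same shift by one column as in [diag_step]. Here s^2/t^2 is S^2 y, and the powers of S^2
    assemble into the gauge. *)
Lemma inv_step :
  (y * S 0%N / (S 0%N)^-1) ^+ (nth 0 s 0 - nth 0 nu 0) *
    (qpoch q (y^-1 * S r.+1 * (S r.+1)^-1) (nth 0 s 0 - nth 0 nu 0) / qpoch q q (nth 0 s 0 - nth 0 nu 0)) *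
  \prod_(c < L) vertex_weight q ((S (r.+1 + c.+1)%N)^-1 * S (r.+1 + c.+1)%N / y) (S c.+1)
     (nth 0 nu c - nth 0 nu c.+1) (nth 0 s c - nth 0 nu c)
     (nth 0 s c - nth 0 s c.+1) (nth 0 s c.+1 - nth 0 nu c.+1) =
  inv_gauge L s / inv_gauge L nu * gstep q y A s nu.
Proof.
have nuL c : (L <= c.+1)%N -> nth 0%N nu c = 0%N.
  by move=> Lc; have := il c; rewrite (sL Lc); lia.
rewrite (gstep_prod q y _ sz (K := L)) => [|c Lc|c Lc]; [|exact/sL/leqW|exact/nuL/leqW].
pose G c := (S c ^+ 2) ^+ (nth 0 s c - nth 0 nu c) *
  (hpoch q y 1 (nth 0 s c - nth 0 nu c) / qpoch q q (nth 0 s c - nth 0 nu c)).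
have GL : G L = 1 by rewrite /G sL // nuL // hpoch0 qpoch0 divr1 expr0 mulr1.
have G0E : (y * S 0%N / (S 0%N)^-1) ^+ (nth 0 s 0 - nth 0 nu 0) *
    (qpoch q (y^-1 * S r.+1 * (S r.+1)^-1) (nth 0 s 0 - nth 0 nu 0) / qpoch q q (nth 0 s 0 - nth 0 nu 0))
    = G 0%N.
  have -> : y^-1 * S r.+1 * (S r.+1)^-1 = 1 / y by rewrite mulfK // div1r.
  have -> : y * S 0%N / (S 0%N)^-1 = S 0%N ^+ 2 * y by rewrite invrK; ring.
  by rewrite exprMn /G -(hpoch_scale q _ _ y0) !mulrA.
rewrite G0E {G0E}.
pose T c := qpoch q (A c * y) (nth 0 nu c - nth 0 s c.+1) / qpoch q q (nth 0 nu c - nth 0 s c.+1) *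
  (qpoch q q (nth 0 nu c - nth 0 nu c.+1) / qpoch q (A c) (nth 0 nu c - nth 0 nu c.+1)).
rewrite (eq_bigr (fun c : 'I_L => G c.+1 * T c)) => [|c _]; last first.
  have := il c; have := il c.+1 => /andP[_ i2] i1; rewrite vertex_weightE //.
  have -> : (S (r.+1 + c.+1)%N)^-1 * S (r.+1 + c.+1)%N / y = 1 / y by rewrite mulVf.
  have -> : S c.+1 ^+ 2 / (1 / y) = S c.+1 ^+ 2 * y by rewrite div1r invrK.
  rewrite /G /T /column_params -(hpoch_scale q _ _ y0) exprMn.
  have := S_reg c (nth 0 nu c - nth 0 nu c.+1).
  move: (q_reg (nth 0 nu c - nth 0 nu c.+1)) (q_reg (nth 0 nu c - nth 0 s c.+1))
   (q_reg (nth 0 s c.+1 - nth 0 nu c.+1)) => q1 q2 q3 q4.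
  by field; rewrite ?q1 ?q2 ?q3 ?q4 ?y0 ?oner_neq0.
rewrite big_split /= mulrA.
have -> : G 0%N * \prod_(c < L) G c.+1 = \prod_(c < L) G c.
  transitivity (\prod_(c < L.+1) G c); first by rewrite big_ord_recl.
  by rewrite big_ord_recr /= GL mulr1.
rewrite -big_split /inv_gauge -prodfV -!big_split /=; apply: eq_bigr => c _.
rewrite /G /T /gcol il.
have /andP[i1 i2] := il c.
have -> : (S c ^+ 2) ^+ (nth 0 s c - nth 0 nu c) = (S c ^+ 2) ^+ nth 0%N s c / (S c ^+ 2) ^+ nth 0%N nu c.
  by rewrite expfB_cond // expf_eq0 /= (negbTE (S_neq0 c)) (leq_trans i2).
by rewrite !mulrA.
Qed.
End Steps.

Let part_out (la : intpart) c : ((size la).+1 <= c.+1)%N -> part la c.+1 = 0%N.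
Proof. by move=> h; rewrite /part nth_default. Qed.

Lemma negS_empty (T : nat -> E) : negS T empty_intpart = 1.
Proof. by rewrite /negS big_geq. Qed.

Lemma cS_empty (T : nat -> E) : cS q T empty_intpart = 1.
Proof. by rewrite /cS big_geq. Qed.

Lemma cS_neq0 la : cS q S la != 0.
Proof.
rewrite /cS big_add1 /= big_mkord; apply/prodf_neq0 => i _.
by rewrite mulf_neq0 ?invr_eq0.
Qed.

Lemma negS_neq0 la : negS S la != 0.
Proof.
rewrite /negS big_add1 /= big_mkord; apply/prodf_neq0 => i _.
by rewrite expf_neq0 // oppr_eq0.
Qed.

Lemma diag_gauge_cS s la : (forall c, nth 0%N s c = part la c.+1) ->
  diag_gauge (size la).+1 0 s = cS q S la.
Proof.
move=> sE; rewrite /diag_gauge big_ord_recr /= !sE !part_out // !qpoch0 divr1 mulr1.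
by rewrite /cS big_add1 /= big_mkord; apply: eq_bigr => i _; rewrite !sE.
Qed.

Lemma inv_gauge_negS s la : (forall c, nth 0%N s c = part la c.+1) ->
  inv_gauge (size la).+1 s = negS S la ^+ 2.
Proof.
move=> sE; rewrite /inv_gauge big_ord_recr /= !sE !part_out // expr0 mulr1.
rewrite /negS big_add1 /= big_mkord -prodrXl; apply: eq_bigr => i _.
by rewrite !sE [RHS]exprAC sqrrN.
Qed.

Lemma bbF_diagE n (kappa : 'I_n -> E) la : (forall i, kappa i != 0) ->
  bbF_diag q kappa S la = if (size la <= n)%N then
    (negS S la)^-1 * fpol q [seq kappa i | i <- enum 'I_n] A (padded n la) else 0.
Proof.
move=> k0; rewrite /bbF_diag /bbF negS_empty cS_empty !div1r maxn0.
pose x j := nth 0 [seq kappa i | i <- enum 'I_n] j.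
have xE (i : 'I_n) : x i = kappa i.
  by rewrite /x (nth_map i) ?size_enum_ord // nth_ord_enum.
have x0 r : (r < n)%N -> x r != 0 by move=> rm; rewrite (xE (Ordinal rm)).
have xs : [seq kappa i | i <- enum 'I_n] = [seq x j | j <- iota 0 n].
  by have := mkseq_nth 0 [seq kappa i | i <- enum 'I_n]; rewrite size_map size_enum_ord => /esym.
pose step r (s nu : seq nat) := (x r * S 0%N / S 0%N) ^+ (nth 0%N s 0 - nth 0%N nu 0) *
    (qpoch q ((x r)^-1 * S r.+1 * S r.+1) (nth 0%N s 0 - nth 0%N nu 0) / qpoch q q (nth 0%N s 0 - nth 0%N nu 0)) *
  \prod_(c < (size la).+1) vertex_weight q (S (r.+1 + c.+1)%N * S (r.+1 + c.+1)%N / x r) (S (c.+1 + r.+1)%N)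
     (nth 0%N nu c - nth 0%N nu c.+1) (nth 0%N s c - nth 0%N nu c)
     (nth 0%N s c - nth 0%N s c.+1) (nth 0%N s c.+1 - nth 0%N nu c.+1).
have stepP p : \prod_(r < n) ((kappa r * S 0%N / S 0%N) ^+ (entry_of p r 0 - entry_of p r.+1 0) *
    (qpoch q ((kappa r)^-1 * S r.+1 * S r.+1) (entry_of p r 0 - entry_of p r.+1 0) /
     qpoch q q (entry_of p r 0 - entry_of p r.+1 0)) *
    \prod_(c < (size la).+1) row_weight q kappa S S (tau_diag S) (mult_mx n (size la).+1 p)
       (diff_mx n (size la).+1 p) r c) =
    \prod_(r < n) step (0 + r)%N (nth [::] p r) (nth [::] p r.+1).
  by apply: eq_bigr => r _; rewrite /step add0n xE; congr (_ * _); apply: eq_bigr => c _;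
    rewrite /row_weight !mxE.
have hM : (head 0 (padded n la) < (part la 1).+1)%N by rewrite -nth0 nth_padded.
(* If la has more than n parts, no chain exists: n interlacing steps down to zero force part n + 1
   to be 0. Constant lengths are used here, since lists shrinking from length n could not hold
   la. *)
case: ifP => le; last first.
  have sle : (size la <= size la)%N by [].
  have hM' : (head 0 (padded (size la) la) < (part la 1).+1)%N by rewrite -nth0 nth_padded.
  rewrite (@boundary_sum_chains E q n kappa S S (tau_diag S) la (size la).+1 (part la 1).+1 id
   (padded (size la) la) (nth_padded _ la) (ltnSn _) hM' (fun k => leqnn k)
   (@fits_id (padded (size la) la) n) (fun i a => (kappa i * S 0%N / S 0%N) ^+ a *
    (qpoch q ((kappa i)^-1 * S i.+1 * S i.+1) a / qpoch q q a))).
  rewrite big_seq_cond big1 ?mulr0 // => p vp.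
  have [_ p0 il pn] := chain_facts (fun k => leqnn k) vp.
  have := lower_entry il (j := n) (r := 0) 0; rewrite !add0n => /(_ (leqnn n)).
  rewrite pn p0 nth_padded /part /= leqn0 => /eqP h.
  have nla : (n < size la)%N by rewrite ltnNge le.
  have /andP[_ /negP[]] := valP la; rewrite -[X in X \in _]h; exact: mem_nth.
rewrite (@boundary_sum_chains E q n kappa S S (tau_diag S) la (size la).+1 (part la 1).+1 predn
   (padded n la) (nth_padded _ la) (ltnSn _) hM leq_pred _ (fun i a => (kappa i * S 0%N / S 0%N) ^+ a *
    (qpoch q ((kappa i)^-1 * S i.+1 * S i.+1) a / qpoch q q a))); last first.
  move=> P _ il Pn r c rn; rewrite iter_predn size_padded // => h.
  by apply: (fits_predn (s0 := padded n la)) il Pn _ _ rn h; rewrite size_padded.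
under eq_bigr => p _ do rewrite stepP.
rewrite (chains_fpol (q := q) (A := A) (n := n) (L := (size la).+1) (x := x)
  (cn := diag_gauge (size la).+1)) ?size_padded //.
- by rewrite xs (diag_gauge_cS (nth_padded n la)) mulrA mulfVK ?cS_neq0.
- exact: diag_gauge_neq0.
- by move=> r; rewrite /diag_gauge big1 // => c _; rewrite !nth_nil subnn !qpoch0 divr1.
- by move=> r s nu rn sz il sL; rewrite /step diag_step //; [exact: x0|exact/interlaceP].
by move=> c Lc; rewrite nth_padded part_out.
Qed.

(** The padding length is left free so that it can be matched with the one that F imposes. *)
Lemma bbFstar_invE m n (chi : 'I_m -> E) (la : intpart) : (forall i, chi i != 0) -> (size la <= n)%N ->
  bbFstar_inv q chi S la = negS S la * gpol q [seq chi i | i <- enum 'I_m] A (padded n la).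
Proof.
move=> k0 le; rewrite /bbFstar_inv /bbFstar /bbF negS_empty cS_empty !div1r maxn0 divr1.
pose x j := nth 0 [seq chi i | i <- enum 'I_m] j.
have xE (i : 'I_m) : x i = chi i.
  by rewrite /x (nth_map i) ?size_enum_ord // nth_ord_enum.
have x0 r : (r < m)%N -> x r != 0 by move=> rm; rewrite (xE (Ordinal rm)).
have xs : [seq chi i | i <- enum 'I_m] = [seq x j | j <- iota 0 m].
  by have := mkseq_nth 0 [seq chi i | i <- enum 'I_m]; rewrite size_map size_enum_ord => /esym.
pose step r (s nu : seq nat) := (x r * S 0%N / (S 0%N)^-1) ^+ (nth 0%N s 0 - nth 0%N nu 0) *
    (qpoch q ((x r)^-1 * S r.+1 * (S r.+1)^-1) (nth 0%N s 0 - nth 0%N nu 0) / qpoch q q (nth 0%N s 0 - nth 0%N nu 0)) *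
  \prod_(c < (size la).+1) vertex_weight q ((S (r.+1 + c.+1)%N)^-1 * S (r.+1 + c.+1)%N / x r) (S c.+1)
     (nth 0%N nu c - nth 0%N nu c.+1) (nth 0%N s c - nth 0%N nu c)
     (nth 0%N s c - nth 0%N s c.+1) (nth 0%N s c.+1 - nth 0%N nu c.+1).
have hM : (head 0 (padded n la) < (part la 1).+1)%N by rewrite -nth0 nth_padded.
rewrite (@boundary_sum_chains E q m chi (fun i => (S i)^-1) S (tau_inv S) la (size la).+1 (part la 1).+1 id
   (padded n la) (nth_padded _ la) (ltnSn _) hM (fun k => leqnn k)
   (@fits_id (padded n la) m) (fun i a => (chi i * S 0%N / (S 0%N)^-1) ^+ a *
    (qpoch q ((chi i)^-1 * S i.+1 * (S i.+1)^-1) a / qpoch q q a))).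
rewrite (eq_bigr (fun p => \prod_(r < m) step (0 + r)%N (nth [::] p r) (nth [::] p r.+1))); last first.
  move=> p _; apply: eq_bigr => r _; rewrite /step add0n xE; congr (_ * _); apply: eq_bigr => c _.
  by rewrite /row_weight !mxE.
rewrite (chains_gpol (q := q) (A := A) (n := m) (L := (size la).+1) (x := x)
  (cn := inv_gauge (size la).+1)) //.
- rewrite xs (inv_gauge_negS (nth_padded n la)).
  by field; rewrite cS_neq0 negS_neq0.
- exact: inv_gauge_neq0.
- move=> s s0; rewrite /inv_gauge big1 // => c _.
  have -> : nth 0%N s c = 0%N.
    by have [cs|cs] := ltnP c (size s); [apply/eqP/(all_nthP 0%N s0)|rewrite nth_default].
  by rewrite expr0.
- by move=> r s nu rn sz il sL; rewrite /step inv_step //; [exact: x0|exact/interlaceP].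
by move=> c Lc; rewrite nth_padded part_out.
Qed.
End Diagonal.

(** * Unordered summation over partitions *)

Lemma nth_map_enum (T : Type) (x0 : T) n (x : 'I_n -> T) (i : 'I_n) :
  nth x0 [seq x i | i <- enum 'I_n] i = x i.
Proof. by rewrite (nth_map i) ?size_enum_ord // nth_ord_enum. Qed.

(** The quotients of infinite products are formed here, from the identity with the denominators
    multiplied out. *)
Lemma cauchy_productE (R : comUnitRingType) n m (pinf : R -> R) (kappa : 'I_n -> R)
    (chi : 'I_m -> R) (S : nat -> R) (Z : R) (ks := [seq kappa i | i <- enum 'I_n])
    (xs := [seq chi j | j <- enum 'I_m]) :
    (forall i : 'I_n, pinf (S i.+1 ^+ 2) \is a GRing.unit) ->
    (forall i j, pinf (kappa i * chi j) \is a GRing.unit) ->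
    Z * \prod_(i < n) \prod_(x <- xs) (pinf (column_params S i) * pinf (nth 0 ks i * x)) =
    \prod_(i < n) \prod_(x <- xs) (pinf (nth 0 ks i) * pinf (column_params S i * x)) ->
  cauchy_product pinf kappa chi S = Z.
Proof.
move=> Su ku EZ.
have unit_prod (I : Type) (s : seq I) (d : I -> R) : (forall i, d i \is a GRing.unit) ->
    \prod_(i <- s) d i \is a GRing.unit.
  by move=> du; elim/big_rec: _ => [|i x _ xu]; rewrite ?unitr1 // unitrM du.
have du (i : 'I_n) (j : 'I_m) : pinf (S i.+1 ^+ 2) * pinf (kappa i * chi j) \is a GRing.unit.
  by rewrite unitrM Su ku.
pose D := \prod_(i < n) \prod_(j < m) (pinf (S i.+1 ^+ 2) * pinf (kappa i * chi j)).
have Du : D \is a GRing.unit by apply: (unit_prod _ _ _) => i; apply: (unit_prod _ _ _).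
apply: (mulIr Du); transitivity (\prod_(i < n) \prod_(j < m)
    (pinf (kappa i) * pinf (S i.+1 ^+ 2 * chi j))).
  rewrite /cauchy_product /D -big_split; apply: eq_bigr => i _.
  by rewrite -big_split; apply: eq_bigr => j _; rewrite /= mulrVK.
have mapE (f : R -> R) : \prod_(x <- xs) f x = \prod_(j < m) f (chi j).
  by rewrite /xs big_map big_enum.
rewrite (eq_bigr (fun i : 'I_n => \prod_(x <- xs) (pinf (nth 0 ks i) * pinf (column_params S i * x))))
  => [|i _]; last by rewrite mapE nth_map_enum.
by rewrite -EZ; congr (_ * _); apply: eq_bigr => i _; rewrite mapE nth_map_enum.
Qed.

Lemma filter_parts (la : intpart) : [seq x <- la | x != 0%N] = la.
Proof.
apply/all_filterP/allP => x; case: la => s /= /andP[_ s0] xs.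
by apply: contraNneq s0 => <-.
Qed.

Lemma filter_padded n la : [seq x <- padded n la | x != 0%N] = la.
Proof.
rewrite filter_cat filter_parts (_ : [seq x <- nseq _ _ | _] = [::]) ?cats0 //.
by elim: (n - size la)%N.
Qed.

Lemma padded_inj n : injective (padded n).
Proof.
move=> la mu /(congr1 (fun s => [seq x <- s | x != 0%N])).
by rewrite !filter_padded => /val_inj.
Qed.

(** With [padded_inj], this identifies partitions of length at most n with sorted lists of length n;
    deleting the zeros is the inverse map. *)
Lemma sorted_padded n s : size s = n -> sorted geq s ->
  exists2 la : intpart, (size la <= n)%N & padded n la = s.
Proof.
move=> sn srt.
have geqT : transitive geq by move=> x y z xy yz; apply: leq_trans yz xy.
have h : sorted geq [seq x <- s | x != 0%N] && (0%N \notin [seq x <- s | x != 0%N]).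
  by rewrite sorted_filter // mem_filter eqxx.
exists (IntPart h); first by rewrite /= size_filter -sn count_size.
rewrite /padded /=; elim: s n sn srt {h} => [|x s IH] n <- //= srt.
have ss := path_sorted srt; case: eqP => [x0|_] /=; last first.
  by rewrite -[in X in _ = X](IH _ erefl ss).
have s0 : all (pred1 0%N) s.
  apply/allP => y ys; move: srt; rewrite path_sortedE // => /andP[/allP/(_ y ys)].
  by rewrite x0 /= leqn0.
have -> : [seq x <- s | x != 0%N] = [::].
  by rewrite (@eq_in_filter _ _ pred0) ?filter_pred0 // => y /(allP s0) /= /eqP ->.
by rewrite subn0 x0 [in RHS](all_pred1P _ _ s0).
Qed.

(** It is enough that the finite set contains the partitions coming from the box; the longer
    partitions that it may also contain contribute 0. *)
Lemma partial_sum_padded (V : zmodType) n M (f : intpart -> V) (t : seq nat -> V) :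
    (forall la : intpart, (size la <= n)%N -> f la = t (padded n la)) ->
    (forall la : intpart, (n < size la)%N -> f la = 0) ->
  \forall B \near totally, exists S : seq (seq nat),
    [/\ uniq S, all (fun la => size la == n) S,
        forall la, la \in box M n -> sorted geq la -> la \in S
      & partial_sum f B = \sum_(la <- S) t la].
Proof.
move=> ft f0.
pose B0 : {fset intpart} := [fset la in pmap insub [seq [seq x <- s | x != 0%N] | s <- box M n]]%fset.
exists B0 => // B /= sub; exists [seq padded n la | la : intpart <- enum_fset B & (size la <= n)%N].
split.
- by rewrite map_inj_uniq ?filter_uniq ?fset_uniq //; exact: padded_inj.
- apply/allP => _ /mapP[la + ->]; rewrite mem_filter => /andP[le _].
  by rewrite size_padded.
- move=> s sb srt; have /andP[/eqP sn sM] : (size s == n) && all (fun x => x < M)%N s.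
    by rewrite -mem_box.
  have [la le ps] := sorted_padded sn srt; apply/mapP; exists la => //.
  rewrite mem_filter le /=; apply: (fsubsetP sub); rewrite in_fset /= mem_pmap.
  apply/mapP; exists [seq x <- s | x != 0%N]; first by apply/mapP; exists s.
  by rewrite -ps filter_padded valK.
rewrite big_map big_filter /partial_sum -(big_seq_fsetE _ _ xpredT f) /=.
rewrite (bigID (fun la : intpart => (size la <= n)%N)) /= [X in _ + X]big1 ?addr0.
  by apply: eq_bigr => la le; apply: ft.
by move=> la; rewrite -ltnNge; apply: f0.
Qed.

Theorem cauchy_partial_sums (F : archiRealFieldType) (R : idomainType) (N : R -> F)
    (q : R) (S : nat -> R) (pinf : R -> R) n m (kappa : 'I_n -> R) (chi : 'I_m -> R)
    (f : intpart -> R) :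
    complete_norm N -> N q < 1 ->
    (forall k, qpoch q q k \is a GRing.unit) ->
    (forall c k, qpoch q (column_params S c) k \is a GRing.unit) ->
    inv_bounded N q q -> (forall c, inv_bounded N q (column_params S c)) ->
    (forall i, N (kappa i) < 1) -> (forall j, N (chi j) < 1) ->
    (forall x, norm_cvg N (qpoch q x) (pinf x)) ->
    (forall i : 'I_n, pinf (S i.+1 ^+ 2) \is a GRing.unit) ->
    (forall i j, pinf (kappa i * chi j) \is a GRing.unit) ->
    (forall la : intpart, f la = if (size la <= n)%N then
       cauchy_term q (column_params S) [seq kappa i | i <- enum 'I_n]
         [seq chi j | j <- enum 'I_m] (padded n la) else 0) ->
  forall e, 0 < e -> \forall B \near totally,
    N (partial_sum f B - cauchy_product pinf kappa chi S) < e.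
Proof.
move=> HN q1 q_unit A_unit q_inv A_inv kappa1 chi1 pinfP Su ku fE e e0.
have ks1 k : k \in [seq kappa i | i <- enum 'I_n] -> N k < 1 by case/mapP=> i _ ->.
have xs1 x : x \in [seq chi j | j <- enum 'I_m] -> N x < 1 by case/mapP=> i _ ->.
have [Z [[K t] /= t01 hZ] EZ] :=
  cauchy_summation HN q1 q_unit A_unit q_inv A_inv ks1 pinfP xs1.
have sks : size [seq kappa i | i <- enum 'I_n] = n by rewrite size_map size_enum_ord.
rewrite sks in hZ EZ; rewrite (cauchy_productE Su ku EZ).
have K0 : 0 < `|K| + 1 by have := normr_ge0 K; lra.
have [M /(_ M (leqnn M)) hM] := expr_eventually_lt t01 (divr_gt0 e0 K0).
rewrite ltr_pdivlMr // in hM.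
have := @partial_sum_padded R n M f (cauchy_term q (column_params S)
  [seq kappa i | i <- enum 'I_n] [seq chi j | j <- enum 'I_m]).
case=> [la le|la gt|B0 _ near0]; [by rewrite fE le|by rewrite fE leqNgt gt|].
exists B0 => // B /near0 [T [uT szT subT ->]].
apply: le_lt_trans (hZ M T uT szT subT) _; apply: le_lt_trans hM.
rewrite mulrC; apply: ler_wpM2l; first by case/andP: t01 => t0 _; rewrite exprn_ge0.
by apply: le_trans (ler_norm K) _; rewrite lerDl.
Qed.

Local Open Scope complex_scope.

(** * The complex case *)

Section ComplexNorm.
Variable R : realType.
Local Notation C := (complex_field R).
Implicit Types (x y z : C).

(** The modulus is itself a complex number here; its real part lies in the ordered field that
    [complete_norm] asks for. *)
Definition cnorm (z : C) : R := complex.Re (`|z| : R[i]).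

Lemma cnormE z : `|z| = (cnorm z)%:C :> R[i].
Proof. by rewrite /cnorm RRe_real // normr_real. Qed.

Lemma lt_cnorm z (e : C) : 0 < e -> cnorm z < complex.Re (e : R[i]) -> `|z| < e.
Proof.
move=> e0 ze; rewrite cnormE ltcE /= ze andbT.
by move: e0; rewrite ltcE /= => /andP[/eqP ->].
Qed.

Lemma cnorm_lt z (e : R) : `|z| < e%:C :> R[i] -> cnorm z < e.
Proof. by rewrite cnormE ltcR. Qed.

Lemma cnorm_sqrt z :
  cnorm z = Num.sqrt (complex.Re (z : R[i]) ^+ 2 + complex.Im (z : R[i]) ^+ 2).
Proof. by apply: (@complexI R); rewrite -cnormE normc_def. Qed.

Lemma cnorm_le_ReIm z : cnorm z <= `|complex.Re (z : R[i])| + `|complex.Im (z : R[i])|.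
Proof.
rewrite cnorm_sqrt -[leRHS]ger0_norm ?addr_ge0 // -sqrtr_sqr ler_sqrt ?sqr_ge0 //.
rewrite sqrrD !real_normK ?num_real // lerD2r lerDl.
by rewrite mulrn_wge0 // mulr_ge0.
Qed.

Lemma Re_le_cnorm z : `|complex.Re (z : R[i])| <= cnorm z.
Proof. by rewrite -lecR -cnormE; exact: normc_ge_Re. Qed.

Lemma Im_le_cnorm z : `|complex.Im (z : R[i])| <= cnorm z.
Proof. by rewrite cnorm_sqrt -sqrtr_sqr ler_sqrt ?addr_ge0 ?sqr_ge0 // lerDr sqr_ge0. Qed.

Lemma cnormM x y : cnorm (x * y) = cnorm x * cnorm y.
Proof.
apply: (@complexI R); rewrite rmorphM /= -!cnormE; exact: normrM.
Qed.

Lemma cnormV x : cnorm x^-1 = (cnorm x)^-1.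
Proof.
apply: (@complexI R); rewrite fmorphV /= -!cnormE; exact: normfV.
Qed.

Lemma cnorm_prod (I : Type) (s : seq I) (f : I -> C) :
  cnorm (\prod_(i <- s) f i) = \prod_(i <- s) cnorm (f i).
Proof.
elim/big_rec2: _ => [|i a b _ <-]; last by rewrite cnormM.
by apply: (@complexI R); rewrite -cnormE normr1.
Qed.

(** With D(1 - r) = K, the sequence a_k + D r^k is nonincreasing and a_k - D r^k is nondecreasing,
    so the former is bounded below and converges. *)
Lemma real_geometric_cvg (a : nat -> R) K r : 0 <= r < 1 ->
  (forall k, `|a k.+1 - a k| <= K * r ^+ k) -> exists l, forall e, 0 < e ->
    exists k0, forall k, (k0 <= k)%N -> `|a k - l| < e.
Proof.
move=> r01 h; have /andP[r0 r1] := r01; have r1' : 0 < 1 - r by lra.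
have K0 : 0 <= K by have := h 0%N; rewrite expr0 mulr1; apply: le_trans.
pose D := K / (1 - r); have D0 : 0 <= D by rewrite divr_ge0 // ltW.
have DK : D * (1 - r) = K by rewrite /D mulfVK // gt_eqF.
pose b k := a k + D * r ^+ k.
have bd k : b k.+1 <= b k.
  rewrite /b exprS; have := h k; rewrite ler_norml => /andP[_]; rewrite -DK; lra.
have cd k : a k - D * r ^+ k <= a k.+1 - D * r ^+ k.+1.
  rewrite exprS; have := h k; rewrite ler_norml => /andP[+ _]; rewrite -DK; lra.
have c0 k : a 0%N - D <= a k - D * r ^+ k.
  elim: k => [|k IH]; first by rewrite expr0 mulr1.
  exact: le_trans IH (cd k).
have bcvg : cvgn b.
  apply: nonincreasing_is_cvgn; first exact/nonincreasing_seqP.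
  exists (a 0%N - D) => _ [k _ <-]; have := c0 k; have := mulr_ge0 D0 (exprn_ge0 k r0).
  rewrite /b; lra.
exists (limn b) => e e0; have e2 : 0 < e / 2 by lra.
have /cvgrPdist_lt/(_ _ e2)[k1 _ h1] := bcvg.
have e3 : 0 < e / 2 / (D + 1) by rewrite divr_gt0 //; lra.
have [k2 h2] := expr_eventually_lt r01 e3.
exists (maxn k1 k2) => k; rewrite geq_max => /andP[/h1 {}h1 /h2].
rewrite ltr_pdivlMr; last by lra.
move=> {}h2; move: h1; rewrite /= /b ltr_norml => /andP[h3 h4].
have := exprn_ge0 k r0; have := mulr_ge0 D0 (exprn_ge0 k r0) => g1 g2.
rewrite ltr_norml; apply/andP; split; lra.
Qed.

Lemma cnorm_complete : complete_norm cnorm.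
Proof.
split.
- by move=> x x0; apply/eqP; rewrite -normr_eq0; apply/eqP; rewrite cnormE x0.
- by apply: (@complexI R); rewrite -cnormE normr0.
- by rewrite -lecR -cnormE normr1.
- by move=> x; apply: (@complexI R); rewrite -!cnormE normrN.
- by move=> x y; rewrite -lecR rmorphD /= -!cnormE; exact: ler_normD.
- by move=> x y; rewrite cnormM.
move=> u K r r01 h.
have [|a ha] := @real_geometric_cvg (fun k => complex.Re (u k : R[i])) K r r01.
  move=> k; apply: le_trans (h k); apply: le_trans (Re_le_cnorm _).
  by rewrite raddfB.
have [|b hb] := @real_geometric_cvg (fun k => complex.Im (u k : R[i])) K r r01.
  move=> k; apply: le_trans (h k); apply: le_trans (Im_le_cnorm _).
  by rewrite raddfB.
exists (a +i* b) => e e0; have e2 : 0 < e / 2 by lra.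
have [k1 h1] := ha _ e2; have [k2 h2] := hb _ e2.
exists (maxn k1 k2) => k; rewrite geq_max => /andP[/h1 {}h1 /h2 {}h2].
apply: le_lt_trans (cnorm_le_ReIm _) _; rewrite !raddfB /=; lra.
Qed.

Lemma cnorm1 : cnorm 1 = 1.
Proof. by apply: (@complexI R); rewrite -cnormE normr1. Qed.

(** Once y = |b| |q|^i is at most 1/2, 1/(1 - y) <= 1 + 2y, and the product of these bounds is
    bounded. The finitely many earlier inverse factors are at most [D] each. *)
Lemma cnorm_inv_bounded (q b : C) : cnorm q < 1 -> (forall k, b * q ^+ k != 1) ->
  inv_bounded cnorm q b.
Proof.
move=> q1 bq; have HC := cnorm_complete; have q01 : 0 <= cnorm q < 1 by rewrite (norm_ge0 HC).
have b0 : 0 <= cnorm b := norm_ge0 HC b.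
have pos i : 0 < cnorm (1 - b * q ^+ i).
  rewrite lt_neqAle (norm_ge0 HC) andbT eq_sym; apply: contraNneq (bq i) => h.
  by rewrite -subr_eq0 -opprB oppr_eq0; apply/eqP/(norm_eq0 HC).
have e2 : 0 < 2^-1 / (cnorm b + 1) by rewrite divr_gt0 //; lra.
have [i0 h0] := expr_eventually_lt q01 e2.
have large i : (i0 <= i)%N -> (cnorm (1 - b * q ^+ i))^-1 <= 1 + 2 * cnorm b * cnorm q ^+ i.
  move=> /h0; rewrite ltr_pdivlMr; last by lra.
  have qi := exprn_ge0 i (norm_ge0 HC q) => h.
  have y2 : cnorm b * cnorm q ^+ i <= 2^-1.
    by rewrite (_ : cnorm b * _ = cnorm q ^+ i * (cnorm b + 1) - cnorm q ^+ i); [lra|ring].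
  have y0 := mulr_ge0 b0 qi.
  have le : 1 - cnorm b * cnorm q ^+ i <= cnorm (1 - b * q ^+ i).
    have := norm_D HC (1 - b * q ^+ i) (b * q ^+ i); rewrite subrK cnorm1.
    have := norm_M HC b (q ^+ i); have := ler_wpM2l b0 (norm_exp HC q i); lra.
  rewrite -[_^-1]mul1r ler_pdivrMr // -mulrA.
  set y := cnorm b * _ in y2 y0 le *; set w := cnorm _ in le *.
  have y3 : 0 <= 2^-1 - y by lra.
  have y4 : 0 <= 1 + 2 * y by lra.
  by have := ler_wpM2l y4 le; have := mulr_ge0 y0 y3; lra.
pose D := \sum_(i < i0) (cnorm (1 - b * q ^+ i))^-1 + 1.
have D1 : 1 <= D by rewrite lerDr sumr_ge0 // => i _; rewrite invr_ge0 ltW.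
have [B B0 hB] := prod1D_bounded (mulr_ge0 (ler0n _ 2) b0) q01.
exists (D ^+ i0 * B) => k; rewrite cnormV /qpoch cnorm_prod -prodfV.
have fpos i : 0 <= 1 + 2 * cnorm b * cnorm q ^+ i.
  by have := mulr_ge0 b0 (exprn_ge0 i (norm_ge0 HC q)); lra.
apply: (@le_trans _ _ (D ^+ minn k i0 * \prod_(i < k) (1 + 2 * cnorm b * cnorm q ^+ i))); last first.
  apply: ler_pM => //; [by rewrite exprn_ge0 //; lra|exact: prodr_ge0|].
  by apply: ler_weXn2l => //; exact: geq_minr.
elim: k => [|k IH]; first by rewrite !big_ord0 min0n expr0 mulr1.
rewrite !big_ord_recr /=; have [ki|ki] := ltnP k i0.
  have -> : minn k.+1 i0 = (minn k i0).+1 by lia.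
  rewrite exprSr mulrACA; apply: ler_pM => //.
  - by rewrite prodr_ge0 // => i _; rewrite invr_ge0 ltW.
  - by rewrite invr_ge0 ltW.
  apply: (@le_trans _ _ D); last first.
    by rewrite ler_peMr //; [lra|]; have := mulr_ge0 b0 (exprn_ge0 k (norm_ge0 HC q)); lra.
  rewrite /D (bigD1 (Ordinal ki)) //= -addrA lerDl addr_ge0 // sumr_ge0 // => i _.
  by rewrite invr_ge0 ltW.
have -> : minn k.+1 i0 = minn k i0 by lia.
rewrite mulrA; apply: ler_pM => //.
- by rewrite prodr_ge0 // => i _; rewrite invr_ge0 ltW.
- by rewrite invr_ge0 ltW.
exact: large.
Qed.

Lemma cnorm_cvg (I : Type) (F : set_system I) (FF : Filter F) (f : I -> C) l :
  (forall e, 0 < e -> \forall i \near F, cnorm (l - f i) < e) -> f @ F --> l.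
Proof.
move=> h; apply/cvgrPdist_lt => e e0.
have e0' : 0 < complex.Re (e : R[i]) by move: e0; rewrite ltcE /= => /andP[].
by apply: filterS (h _ e0') => i; apply: lt_cnorm.
Qed.

Lemma qpoch_inf_cvg (q x : C) : cnorm q < 1 -> norm_cvg cnorm (qpoch q x) (qpoch_inf q x).
Proof.
move=> q1; have HC := cnorm_complete.
have [l hl] := qpoch_cvg HC q1 x.
suff -> : qpoch_inf q x = l by [].
apply: cvg_lim; first exact: norm_hausdorff.
apply: cnorm_cvg => e /hl[k0 h]; exists k0 => // k /= /h.
by rewrite (norm_distC HC).
Qed.

(** A bound on the inverses keeps the sequence away from 0. *)
Lemma norm_cvg_neq0 (u : nat -> C) l : norm_cvg cnorm u l -> (forall k, u k != 0) ->
  (exists B, forall k, cnorm (u k)^-1 <= B) -> l != 0.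
Proof.
move=> ul u0 [B hB]; apply/eqP => l0; subst l; have HC := cnorm_complete.
have B0 : 0 <= B := le_trans (norm_ge0 HC _) (hB 0%N).
have e0 : 0 < (B + 1)^-1 by rewrite invr_gt0; lra.
have [k /(_ k (leqnn k))] := ul _ e0; rewrite subr0 -[(B + 1)^-1]mul1r ltr_pdivlMr; last by lra.
have : 1 <= cnorm (u k) * B.
  rewrite -cnorm1 -(mulfV (u0 k)) cnormM; apply: ler_wpM2l => //; exact: norm_ge0.
have := norm_ge0 HC (u k); lra.
Qed.

Theorem cauchy_complex (n m : nat) (S : nat -> C) (q : C) (kappa : 'I_n -> C) (chi : 'I_m -> C) :
    0 < `|q| < 1 -> (forall i, 0 < `|kappa i| < 1) -> (forall j, 0 < `|chi j| < 1) ->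
    (forall i, S i != 0) -> (forall i k, S i.+1 ^+ 2 * q ^+ k != 1) ->
  partial_sum (fun la => bbFstar_inv q chi S la * bbF_diag q kappa S la)
    @ totally --> cauchy_product (qpoch_inf q) kappa chi S.
Proof.
move=> q01 k01 c01 S0 Sq; have HC := cnorm_complete.
have lt1 (z : C) : 0 < `|z| < 1 -> cnorm z < 1 by case/andP=> _; exact: (@cnorm_lt z 1).
have neq0 (z : C) : 0 < `|z| < 1 -> z != 0 by case/andP; rewrite normr_gt0.
have small z : cnorm z < 1 -> forall k, z * q ^+ k != 1.
  move=> z1 k; apply: contraTneq z1 => h; rewrite -leNgt -cnorm1 -h cnormM.
  rewrite ler_piMr ?(norm_ge0 HC) //; apply: le_trans (norm_exp HC _ _) _.
  by rewrite exprn_ile1 ?(norm_ge0 HC) // ltW // lt1.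
have reg b : (forall k, b * q ^+ k != 1) -> forall k, qpoch q b k != 0.
  by move=> h k; apply/prodf_neq0 => i _; rewrite subr_eq0 eq_sym.
have q1 := lt1 _ q01; have q_reg := reg _ (small _ q1).
have S_reg c := reg _ (Sq c).
have k0 i : kappa i != 0 := neq0 _ (k01 i). have c0 j : chi j != 0 := neq0 _ (c01 j).
have pinf_unit b : (forall k, b * q ^+ k != 1) -> qpoch_inf q b \is a GRing.unit.
  move=> h; rewrite unitfE; apply: norm_cvg_neq0 (qpoch_inf_cvg b q1) (reg _ h) _.
  exact: cnorm_inv_bounded.
(* The factors (-S)^la of F* and F cancel, and F vanishes on partitions with more than n parts. *)
have fE (la : intpart) : bbFstar_inv q chi S la * bbF_diag q kappa S la =
    if (size la <= n)%N then cauchy_term q (column_params S) [seq kappa i | i <- enum 'I_n]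
      [seq chi j | j <- enum 'I_m] (padded n la) else 0.
  rewrite (bbF_diagE q_reg S_reg S0 la k0); case: ifP => le; last by rewrite mulr0.
  by rewrite (bbFstar_invE q_reg S_reg S0 c0 le) mulrCA mulrA mulKf ?negS_neq0.
have FF : Filter (@totally intpart) by have [] := @totally_filter intpart.
have q_unit k : qpoch q q k \is a GRing.unit by rewrite unitfE.
have A_unit c k : qpoch q (column_params S c) k \is a GRing.unit by rewrite unitfE; exact: S_reg.
have pinfP x := qpoch_inf_cvg x q1.
have pinf_kc (i : 'I_n) (j : 'I_m) : qpoch_inf q (kappa i * chi j) \is a GRing.unit.
  apply: pinf_unit; apply: small; rewrite cnormM.
  have := lt1 _ (k01 i); have := lt1 _ (c01 j).
  by have := norm_ge0 HC (kappa i); have := norm_ge0 HC (chi j); nra.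
apply: cnorm_cvg => e e0.
have := cauchy_partial_sums HC q1 q_unit A_unit (cnorm_inv_bounded q1 (small _ q1))
  (fun c => cnorm_inv_bounded q1 (Sq c)) (fun i => lt1 _ (k01 i)) (fun j => lt1 _ (c01 j))
  pinfP (fun i => pinf_unit _ (Sq i)) pinf_kc fE e0.
by apply: filterS => B; rewrite (norm_distC HC).
Qed.
End ComplexNorm.

(** * The formal case *)

Lemma fps_lim_cvg N (K : fieldType) (u : nat -> fps N K) l :
  norm_cvg (@fps_norm N K) u l -> fps_lim u = l.
Proof.
move=> ul; apply/fpsP => m; rewrite /fps_lim /=.
have e0 : 0 < 2^-1 ^+ (mpoly.mdeg m).+1 :> rat by rewrite exprn_gt0.
have [k0 hk0] := ul _ e0.
have ev k : (k0 <= k)%N -> fps_coef (u k) m = fps_coef l m.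
  move=> /hk0 /fps_norm_lt_coef /(_ (ltnSn _)); rewrite fps_coefD fps_coefN.
  by move/eqP; rewrite subr_eq0 => /eqP.
apply: xget_unique; first by exists k0 => // k /= /ev.
move=> c [k1 _ h1]; have := h1 (maxn k0 k1) (leq_maxr _ _) => /= <-.
by rewrite ev ?leq_maxl.
Qed.

(** As soon as [u k - l] has norm below 1, [u k] and [l] share their constant term, which decides
    invertibility. *)
Lemma fps_coef0_lim N (K : fieldType) (u : nat -> fps N K) l :
  norm_cvg (@fps_norm N K) u l -> (forall k, u k \is a GRing.unit) ->
  l \is a GRing.unit.
Proof.
move=> ul uu; have [k /(_ k (leqnn k)) h] := ul 1 ltr01.
rewrite fps_unitE; have := uu k; rewrite fps_unitE; apply: contraNneq => l0.
by have := fps_norm_lt1P h; rewrite fps_coefD fps_coefN l0 subr0 => ->.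
Qed.

(* [negS] is only available over a field. *)
Definition negS_ring (R : pzRingType) (S : nat -> R) (la : intpart) : R :=
  \prod_(1 <= i < (size la).+1) (- S i.-1) ^+ part la i.

Lemma negS_ring_unit (R : comUnitRingType) (S : nat -> R) la :
  (forall i, S i \is a GRing.unit) -> negS_ring S la \is a GRing.unit.
Proof.
move=> Su; rewrite /negS_ring; elim/big_ind: _ => [|x y xu yu|i _].
- exact: unitr1.
- by rewrite unitrM xu.
by apply: unitrX; rewrite unitrN.
Qed.

Section IntegralForms.
Variables (R : idomainType) (q : R) (S : nat -> R).
Hypothesis q_unit : forall k, qpoch q q k \is a GRing.unit.
Hypothesis S_unit : forall i, S i \is a GRing.unit.
Hypothesis A_unit : forall c k, qpoch q (column_params S c) k \is a GRing.unit.
Local Notation iota := (@FracField.tofrac R).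

(** The original definition divides by the variables, which are not invertible power series. This
    form divides by units only and agrees with it in the fraction field. *)
Definition integral_F n (kappa : 'I_n -> R) (la : intpart) : R :=
  if (size la <= n)%N then
    (negS_ring S la)^-1 * fpol q [seq kappa i | i <- enum 'I_n] (column_params S) (padded n la)
  else 0.

(** The length [maxn n (size la)] accommodates every la and equals n whenever F can be nonzero. *)
Definition integral_Fstar n m (chi : 'I_m -> R) (la : intpart) : R :=
  negS_ring S la *
  gpol q [seq chi j | j <- enum 'I_m] (column_params S) (padded (maxn n (size la)) la).

Let S_neq0 i : iota (S i) != 0.
Proof. by rewrite tofrac_eq0; apply: contraTneq (S_unit i) => ->; rewrite unitr0. Qed.

Let S_reg c k : qpoch (iota q) (iota (S c.+1) ^+ 2) k != 0.
Proof. by rewrite -rmorphXn; apply: (tofrac_qpoch_neq0 (A_unit c)). Qed.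

Let negSE la : iota (negS_ring S la) = negS (fun i => iota (S i)) la.
Proof.
by rewrite /negS_ring rmorph_prod; apply: eq_bigr => i _; rewrite rmorphXn rmorphN.
Qed.

Let column_paramsE : iota \o column_params S = column_params (fun i => iota (S i)).
Proof. by apply/funext => c; rewrite /= /column_params rmorphXn. Qed.

Lemma tofrac_integral_F n (kappa : 'I_n -> R) la : (forall i, kappa i != 0) ->
  iota (integral_F kappa la) =
  bbF_diag (iota q) (fun i => iota (kappa i)) (fun i => iota (S i)) la.
Proof.
move=> k0; rewrite (bbF_diagE (tofrac_qpoch_neq0 q_unit) S_reg S_neq0); last first.
  by move=> j; rewrite tofrac_eq0.
rewrite /integral_F; case: ifP => _; last by rewrite rmorph0.
by rewrite rmorphM rmorphV ?negS_ring_unit //= negSE rmorph_fpol //= column_paramsE -map_comp.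
Qed.

Lemma tofrac_integral_Fstar n m (chi : 'I_m -> R) la : (forall j, chi j != 0) ->
  iota (integral_Fstar n chi la) =
  bbFstar_inv (iota q) (fun j => iota (chi j)) (fun i => iota (S i)) la.
Proof.
move=> c0; rewrite (bbFstar_invE (tofrac_qpoch_neq0 q_unit) S_reg S_neq0
  (n := maxn n (size la))) ?leq_maxr //; last first.
  by move=> j; rewrite tofrac_eq0.
by rewrite /integral_Fstar rmorphM /= negSE rmorph_gpol //= column_paramsE -map_comp.
Qed.

Lemma integral_term n m (kappa : 'I_n -> R) (chi : 'I_m -> R) la :
  integral_Fstar n chi la * integral_F kappa la =
  if (size la <= n)%N then
    cauchy_term q (column_params S) [seq kappa i | i <- enum 'I_n]
      [seq chi j | j <- enum 'I_m] (padded n la)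
  else 0.
Proof.
rewrite /integral_Fstar /integral_F; case: ifP => le; last by rewrite mulr0.
by rewrite (maxn_idPl le) mulrACA divrr ?negS_ring_unit // mul1r.
Qed.
End IntegralForms.

Theorem cauchy_formal (n m : nat) :
  exists Fstar F : intpart -> formal_ring n m,
     [/\ forall la, FracField.tofrac (Fstar la) =
           bbFstar_inv (FracField.tofrac (var_q n m)) (fun j => FracField.tofrac (var_chi n j))
             (fun i => FracField.tofrac (par_s n m i)) la,
         forall la, FracField.tofrac (F la) =
           bbF_diag (FracField.tofrac (var_q n m)) (fun i => FracField.tofrac (var_kappa m i))
             (fun i => FracField.tofrac (par_s n m i)) la
       & fps_sums_to (fun la => Fstar la * F la)
           (cauchy_product (fun x => fps_lim (qpoch (var_q n m) x))
              (@var_kappa n m) (@var_chi n m) (par_s n m))].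
Proof.
pose R := formal_ring n m; pose N := @fps_norm (n + m + 1) ratfunS.
have HN : complete_norm (N : R -> rat) := @fps_complete_norm _ _.
pose q : R := var_q n m; pose S := par_s n m; pose A := column_params S.
pose ks : seq R := [seq var_kappa m i | i <- enum 'I_n].
pose xs : seq R := [seq var_chi n j | j <- enum 'I_m].
have q1 : N q < 1 := fps_norm_X _ _.
have coefX i : fps_coef (fpsX ratfunS i : R) mpoly.mnm0 = 0 := fps_norm_lt1P (fps_norm_X _ i).
have q_unit k : qpoch q q k \is a GRing.unit.
  by apply: fps_qpoch_unit => //; rewrite coefX eq_sym oner_eq0.
have S_coef i : fps_coef (S i) mpoly.mnm0 = indetS i by rewrite /= eqxx.
have A_coef c : fps_coef (A c) mpoly.mnm0 != 1.
  by rewrite /A /column_params expr2 fps_coefM0 S_coef -expr2 indetS_sqr_neq1.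
have A_unit c k : qpoch q (A c) k \is a GRing.unit by exact: fps_qpoch_unit.
have S_unit i : S i \is a GRing.unit by rewrite fps_unitE S_coef indetS_neq0.
have X0 i : (fpsX ratfunS i : R) != 0.
  apply/eqP => /(congr1 (fun f => fps_coef f (mpoly.mnm1 i))); rewrite fps_coef0 /= eqxx.
  by move/eqP; rewrite oner_eq0.
exists (integral_Fstar q S n (@var_chi n m)), (integral_F q S (@var_kappa n m)).
split=> [la|la|].
- exact: (tofrac_integral_Fstar q_unit S_unit A_unit n la (fun j => X0 _)).
- exact: (tofrac_integral_F q_unit S_unit A_unit la (fun j => X0 _)).
have pinfP x : norm_cvg (N : R -> rat) (qpoch q x) (fps_lim (qpoch q x)).
  by have [l hl] := qpoch_cvg HN q1 x; rewrite (fps_lim_cvg hl).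
have pinf_unit x : fps_coef x mpoly.mnm0 != 1 -> fps_lim (qpoch q x) \is a GRing.unit.
  by move=> x1; apply: fps_coef0_lim (pinfP x) _ => k; apply: fps_qpoch_unit.
(* A difference of norm below this threshold has zero coefficient at the monomial [c]. *)
move=> c; have e0 : 0 < 2^-1 ^+ (mpoly.mdeg c).+1 :> rat by rewrite exprn_gt0.
have FF : Filter (@totally intpart) by have [] := @totally_filter intpart.
have A_pinf (i : 'I_n) : fps_lim (qpoch q (S i.+1 ^+ 2)) \is a GRing.unit.
  by apply: pinf_unit; exact: A_coef.
have X_pinf (i : 'I_n) (j : 'I_m) :
    fps_lim (qpoch q (var_kappa m i * var_chi n j)) \is a GRing.unit.
  by apply: pinf_unit; rewrite fps_coefM0 coefX mul0r eq_sym oner_eq0.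
have := cauchy_partial_sums HN q1 q_unit A_unit (fps_inv_bounded _ _)
  (fun c => fps_inv_bounded _ (A c)) (fun i => fps_norm_X _ _) (fun j => fps_norm_X _ _) pinfP
  A_pinf X_pinf (fun la => integral_term q S_unit (@var_kappa n m) (@var_chi n m) la) e0.
apply: filterS => B lt; have := fps_norm_lt_coef lt (ltnSn _); rewrite fps_coefD fps_coefN.
by move/eqP; rewrite subr_eq0 => /eqP.
Qed.

Theorem corollary6p5 (n m : nat) (n_ge1 : (1 <= n)%N) (m_ge1 : (1 <= m)%N) :
  (exists Fstar F : intpart -> formal_ring n m,
     [/\ forall la, tofrac (Fstar la) =
           bbFstar_inv (tofrac (var_q n m)) (fun j => tofrac (var_chi n j))
             (fun i => tofrac (par_s n m i)) la,
         forall la, tofrac (F la) =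
           bbF_diag (tofrac (var_q n m)) (fun i => tofrac (var_kappa m i))
             (fun i => tofrac (par_s n m i)) la
       & fps_sums_to (fun la => Fstar la * F la)
           (cauchy_product (fun x => fps_lim (qpoch (var_q n m) x))
              (@var_kappa n m) (@var_chi n m) (par_s n m))]) /\
  (forall (R : realType) (S : nat -> complex_field R) (q : complex_field R)
      (kappa : 'I_n -> complex_field R) (chi : 'I_m -> complex_field R),
    0 < `|q| < 1 ->
    (forall i, 0 < `|kappa i| < 1) ->
    (forall j, 0 < `|chi j| < 1) ->
    (forall i, S i != 0) ->
    (forall i k, S i.+1 ^+ 2 * q ^+ k != 1) ->
    partial_sum (fun la => bbFstar_inv q chi S la * bbF_diag q kappa S la)
      @ totally --> cauchy_product (qpoch_inf q) kappa chi S).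
Proof.
split; first exact: cauchy_formal.
by move=> R S q kappa chi; exact: cauchy_complex.
Qed.
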